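(* Let $T$ be a tournament of order at least $5$ that is not a transitive tournament of even order. Then $$\delta(T)=\left\lceil \frac{\delta'(T)}{2}\right\rceil=\left\lceil \frac{\Delta(T)}{2}\right\rceil .$$ Moreover, for every integer $n\ge 5$, $$\delta'(n)=\begin{cases}\left\lceil \frac{n+1}{2}\right\rceil & \text{if } n\neq 6,\\[2pt] 3 & \text{if } n=6.\end{cases}$$
   Context: A tournament $T=(V(T),A(T))$ is a finite vertex set with, for every two distinct vertices $x,y$, exactly one of the arcs $(x,y),(y,x)$ in $A(T)$; its order is $|V(T)|$. $T$ is transitive if $(x,y),(y,z)\in A(T)$ implies $(x,z)\in A(T)$. For $X\subseteq V(T)$, $\overline X=V(T)\setminus X$, and $\mathrm{Inv}(T,X)$ is the tournament obtained from $T$ by reversing all arcs having both endpoints in $X$. A module of $T$ is a set $M\subseteq V(T)$ such that for all $x,y\in M$ and $v\in V(T)\setminus M$, $(v,x)\in A(T)$ if and only if $(v,y)\in A(T)$. The trivial modules are $\varnothing$, the singletons $\{u\}$ ($u\in V(T)$) and $V(T)$. $T$ is indecomposable if all its modules are trivial, and decomposable otherwise. A co-module of $T$ is a set $M\subseteq V(T)$ such that $M$ or $\overline M$ is a nontrivial module of $T$. The co-modular index $\Delta(T)$ is the maximum size of a set of pairwise disjoint co-modules of $T$ (so $\Delta(T)=0$ if $T$ is indecomposable). For $T$ of order at least $5$, the decomposability arc-index $\delta(T)$ is the smallest integer $m$ such that reversing some set of $m$ arcs of $T$ yields an indecomposable tournament. For $T$ of order at least $5$ that is not transitive of even order, the decomposability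 subtournament-index $\delta'(T)$ is the smallest integer $m$ for which there exists $X\subseteq V(T)$ with $|X|=m$ such that $\mathrm{Inv}(T,X)$ is indecomposable (such an $X$ always exists). For an integer $n\ge 5$, $\delta'(n)$ is the maximum of $\delta'(T)$ over all tournaments $T$ of order $n$, where $T$ is restricted to be non-transitive when $n$ is even. *)

(* Defs.v *)
From HB Require Import structures.
From mathcomp Require Import all_boot.

Set Implicit Arguments.
Unset Strict Implicit.
Unset Printing Implicit Defensive.

Record tournament := Tournament {
  vertex :> finType;
  arc : rel vertex;
  arc_irr : irreflexive arc;
  arc_total : forall x y, x != y -> arc x y (+) arc y x
}.

Section Tournament.

Variable T : tournament.

Implicit Types (M X : {set T}) (B : {set T * T}).

Definition Inv_arc X : rel T :=
  fun x y => if (x \in X) && (y \in X) then arc y x else arc x y.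

Lemma Inv_arc_irr X : irreflexive (Inv_arc X).
Proof. by move=> x; rewrite /Inv_arc arc_irr if_same. Qed.

Lemma Inv_arc_total X x y : x != y -> Inv_arc X x y (+) Inv_arc X y x.
Proof.
move=> xy; rewrite /Inv_arc [(y \in X) && _]andbC.
by case: ifP => _; apply: arc_total; rewrite // eq_sym.
Qed.

Definition Inv X : tournament := Tournament (Inv_arc_irr X) (@Inv_arc_total X).

Definition arcs : {set T * T} := [set p | arc p.1 p.2].

(* The condition is symmetric in x and y so that the result is a tournament
   for every B; only sets B of arcs of T are used below. *)
Definition rev_arc B : rel T :=
  fun x y => if ((x, y) \in B) || ((y, x) \in B) then arc y x else arc x y.

Lemma rev_arc_irr B : irreflexive (rev_arc B).
Proof. by move=> x; rewrite /rev_arc arc_irr if_same. Qed.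

Lemma rev_arc_total B x y : x != y -> rev_arc B x y (+) rev_arc B y x.
Proof.
move=> xy; rewrite /rev_arc [((y, x) \in B) || _]orbC.
by case: ifP => _; apply: arc_total; rewrite // eq_sym.
Qed.

Definition reverse B : tournament :=
  Tournament (rev_arc_irr B) (@rev_arc_total B).

Definition is_module M : bool :=
  [forall x in M, forall y in M, forall v in ~: M, arc v x == arc v y].

Definition trivial_set M : bool :=
  [|| M == set0, [exists u, M == [set u]] | M == setT].

Definition nontrivial_module M : bool := is_module M && ~~ trivial_set M.

Definition indecomposable : bool :=
  [forall M : {set T}, is_module M ==> trivial_set M].

Definition comodule M : bool :=
  nontrivial_module M || nontrivial_module (~: M).

Definition comodular_index : nat :=
  \max_(P : {set {set T}} | trivIset P && [forall M in P, comodule M]) #|P|.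

End Tournament.

(* In the two minima below, the default value exceeds every candidate; it is
   the value of the minimum exactly when there is no candidate. *)
Definition decomp_arc_index (T : tournament) : nat :=
  \big[minn/#|arcs T|.+1]_(B : {set T * T} |
      (B \subset arcs T) && indecomposable (reverse B)) #|B|.

Definition decomp_sub_index (T : tournament) : nat :=
  \big[minn/#|T|.+1]_(X : {set T} | indecomposable (Inv X)) #|X|.

Definition transitive_even (T : tournament) : Prop :=
  transitive (@arc T) /\ ~~ odd #|T|.

(* [decomp_sub_index_of_order n m] says that m is the maximum of
   [decomp_sub_index] over the tournaments of order n, non-transitive ones
   if n is even. *)
Definition decomp_sub_index_of_order (n m : nat) : Prop :=
  (exists T : tournament,
     [/\ #|T| = n, ~ transitive_even T & decomp_sub_index T = m]) /\
  (forall T : tournament,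
     #|T| = n -> ~ transitive_even T -> decomp_sub_index T <= m).

Lemma bigminn_le (I : finType) (N : nat) (P : pred I) (F : I -> nat) i :
  P i -> \big[minn/N]_(j | P j) F j <= F i.
Proof.
move=> Pi; have: i \in index_enum I by rewrite mem_index_enum.
elim: (index_enum I) => // j s IHs; rewrite in_cons big_cons.
case/orP => [/eqP <-|/IHs le_s]; first by rewrite Pi geq_minl.
by case: ifP => // _; apply: leq_trans (geq_minr _ _) le_s.
Qed.

Lemma bigminn_attained (I : finType) (N : nat) (P : pred I) (F : I -> nat) i :
  P i -> (forall j, P j -> F j < N) ->
  exists2 j, P j & \big[minn/N]_(j | P j) F j = F j.
Proof.
move=> Pi FN.
have: \big[minn/N]_(j | P j) F j = N \/
    exists2 j, P j & \big[minn/N]_(j | P j) F j = F j.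
  apply: (big_ind (fun m => m = N \/ exists2 j, P j & m = F j)).
  - by left.
  - by move=> a b Ha Hb; rewrite /minn; case: ifP.
  - by move=> j Pj; right; exists j.
case=> // E; have := bigminn_le N F Pi.
by rewrite E leqNgt FN.
Qed.

Lemma decomp_arc_index_le (T : tournament) (B : {set T * T}) :
  B \subset arcs T -> indecomposable (reverse B) -> decomp_arc_index T <= #|B|.
Proof. by move=> sB iB; apply: bigminn_le; rewrite sB. Qed.

Lemma decomp_arc_index_attained (T : tournament) (B : {set T * T}) :
  B \subset arcs T -> indecomposable (reverse B) ->
  exists2 B' : {set T * T},
    (B' \subset arcs T) && indecomposable (reverse B') &
    decomp_arc_index T = #|B'|.
Proof.
move=> sB iB; apply: (bigminn_attained (i := B)); first by rewrite sB.
by move=> B' /andP[sB' _]; rewrite ltnS subset_leq_card.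
Qed.

Lemma decomp_sub_index_le (T : tournament) (X : {set T}) :
  indecomposable (Inv X) -> decomp_sub_index T <= #|X|.
Proof. exact: bigminn_le. Qed.

Lemma decomp_sub_index_attained (T : tournament) (X : {set T}) :
  indecomposable (Inv X) ->
  exists2 X' : {set T}, indecomposable (Inv X') & decomp_sub_index T = #|X'|.
Proof.
by move=> iX; apply: (bigminn_attained iX) => X' _; rewrite ltnS max_card.
Qed.

(* Main.v *)
(* Write Delta for the co-modular index. Every set X with Inv(T, X) indecomposable, and
   the set of endpoints of every set of arcs whose reversal is indecomposable, meets all
   co-modules, so Delta <= delta' and Delta <= 2 delta. Conversely there are pairwise disjoint
   co-modules, nearly all of them minimal nontrivial modules, with a transversal X that
   meets every co-module and contains no two-element module. Let G be a graph on X without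
   isolated vertices having an edge across every nontrivial module of T, and reverse the
   arcs of T that are edges of G. If M is a nontrivial module of the result, a vertex a of M with
   a G-neighbour outside M is a source or a sink of M: a second point of its block lies
   outside M, sees M uniformly, and sees M as a does. Hence M has at most two such
   vertices, and the rest of M is a module of T that no edge leaves, so it has at most one
   element; only a few small configurations remain, treated separately. The complete
   graph on X yields delta' <= Delta. For delta <= ceil(Delta / 2), X is sorted along a linear
   order for which all modules are intervals, and the i-th element is joined to the
   (i + floor(|X| / 2))-th one. *)
Require Import Defs.
From mathcomp Require Import all_boot zify.
Import Defs.

Set Implicit Arguments.
Unset Strict Implicit.
Unset Printing Implicit Defensive.

(** * Modules and linear orders *)

(** An order in which all modules are intervals reduces the choice of blocks and transversal to
    stabbing intervals greedily by their last elements. Three obstacles remain. A co-module may be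
    missed when only its complement is a module: a source or a sink is then added as a block of its
    own, or else one vertex outside a maximal module containing the transversal. Next, a pair of
    twins inside [X] would survive the reversal; taking last elements avoids this, and so does an
    extreme vertex placed first, but a source and a sink cannot both be first. Pairs of twins are
    then peeled off from the source, and the only way to end with the source and the sink as twins
    is a transitive tournament of even order. Finally, when [X] has two or three elements the graph
    on it may be too small for the general argument, and reversed arcs are chosen that end elsewhere
    in the blocks. *)

Section Modules.

Variables (V : finType) (e : rel V).
Implicit Types (S M N A Q : {set V}).

(** A tournament as a relation on a fixed vertex type, so that T and its reversals share their
    vertices. The diagonal is left free, so xor with a symmetric relation preserves the property. *)
Definition tour := forall x y, x != y -> e x y = ~~ e y x.

(** Modules of the subtournament induced by [S]; the relative form serves the induction for the
    linear order and the study of a single block. *)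
Definition modin S M :=
  (M \subset S) && [forall x in M, forall y in M, forall v in S :\: M, e v x == e v y].

Definition ntmod S M := [&& modin S M, 1 < #|M| & M != S].

Definition initial S A :=
  (A \subset S) && [forall x in A, forall y in S :\: A, e x y].

Lemma modinP S M :
  reflect (M \subset S /\ forall x y v, x \in M -> y \in M -> v \in S -> v \notin M ->
             e v x = e v y)
    (modin S M).
Proof.
apply: (iffP andP) => -[sMS H]; split=> //.
  move=> x y v xM yM vS vM; apply/eqP.
  move/forall_inP/(_ x xM)/forall_inP/(_ y yM)/forall_inP: H; apply.
  by rewrite in_setD vM.
apply/forall_inP=> x xM; apply/forall_inP=> y yM; apply/forall_inP=> v.
by rewrite in_setD => /andP[vM vS]; apply/eqP/H.
Qed.

Lemma modin_eq S M x y v : modin S M -> x \in M -> y \in M -> v \in S -> v \notin M ->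
  e v x = e v y.
Proof. by case/modinP=> _; apply. Qed.

Lemma initialP S A :
  reflect (A \subset S /\ forall x y, x \in A -> y \in S -> y \notin A -> e x y) (initial S A).
Proof.
apply: (iffP andP) => -[sAS H]; split=> //.
  move=> x y xA yS yA.
  by move/forall_inP/(_ x xA)/forall_inP: H; apply; rewrite in_setD yA.
apply/forall_inP=> x xA; apply/forall_inP=> y.
by rewrite in_setD => /andP[yA yS]; apply: H.
Qed.

Lemma modin_restr S S' M : modin S M -> S' \subset S -> modin S' (M :&: S').
Proof.
move=> /modinP[sMS H] sS; apply/modinP; split; first exact: subsetIr.
move=> x y v; rewrite !inE => /andP[xM _] /andP[yM _] vS'.
by rewrite vS' andbT; apply: H; rewrite // (subsetP sS).
Qed.

Lemma modin_trans S N M : modin S N -> modin N M -> modin S M.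
Proof.
move=> /modinP[sNS HN] /modinP[sMN HM]; apply/modinP; split.
  exact: subset_trans sNS.
move=> x y v xM yM vS vM; case: (boolP (v \in N)) => vN; first exact: HM.
by apply: HN; rewrite // (subsetP sMN).
Qed.

Lemma modinU S M N z : modin S M -> modin S N -> z \in M -> z \in N -> modin S (M :|: N).
Proof.
move=> /modinP[sM HM] /modinP[sN HN] zM zN; apply/modinP; split.
  by rewrite subUset sM.
have H x v : x \in M :|: N -> v \in S -> v \notin M :|: N -> e v x = e v z.
  rewrite !inE negb_or => /orP[] xM vS /andP[vM vN]; first exact: HM.
  exact: HN.
by move=> x y v xU yU vS vU; rewrite (H x) // (H y).
Qed.

Hypothesis te : tour.

Lemma tourF x y : x != y -> e y x = ~~ e x y.
Proof. by move=> xy; rewrite te // eq_sym. Qed.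

Lemma mem_neq (M : {set V}) x y : x \in M -> y \notin M -> x != y.
Proof. by move=> xM; apply: contraNneq => <-. Qed.

Lemma modin_eq' S M x y v : modin S M -> x \in M -> y \in M -> v \in S -> v \notin M ->
  e x v = e y v.
Proof.
move=> mM xM yM vS vM; rewrite (te (mem_neq xM vM)) (te (mem_neq yM vM)).
by rewrite (modin_eq mM xM yM vS vM).
Qed.

(** A vertex of [M :\: N] sees [N] uniformly and a vertex of [N :\: M] sees [M] uniformly, so all
    arcs between [M :\: N] and [N] have one direction, and one of these two sets is initial. *)
Lemma cover_initial S M N m n z : modin S M -> modin S N -> M :|: N = S ->
  m \in M -> m \notin N -> n \in N -> n \notin M -> z \in M -> z \in N ->
  exists A, [/\ initial S A, A != set0 & A != S].
Proof.
move=> mM mN MN mM1 mN1 nN nM zM zN.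
case/modinP: (mM) => sM HM; case/modinP: (mN) => sN HN.
have H x y : x \in M -> x \notin N -> y \in N -> e x y = e m n.
  move=> xM xN yN; rewrite (HN y n x) ?(subsetP sM) //.
  by apply: (modin_eq' mM); rewrite // (subsetP sN).
case E: (e m n) H => H.
  exists (M :\: N); split.
  - apply/initialP; split; first exact: subset_trans (subsetDl _ _) sM.
    move=> x y; rewrite !inE => /andP[xN xM] yS yN; apply: H => //.
    by move: yS yN; rewrite -MN inE; case: (y \in N); rewrite ?orbF // => ->.
  - by apply/set0Pn; exists m; rewrite inE mN1.
  - by apply/negP=> /eqP/setP/(_ n); rewrite !inE nN (subsetP sN).
exists N; split.
- apply/initialP; split=> // x y xN yS yN.
  rewrite (te (mem_neq xN yN)) H //.
  by move: yS; rewrite -MN inE (negbTE yN) orbF.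
- by apply/set0Pn; exists n.
- by apply/negP=> /eqP NS; rewrite NS (subsetP sM) // in mN1.
Qed.

Lemma initial_mod S A : initial S A -> modin S A.
Proof.
case/initialP=> sA H; apply/modinP; split=> // x y v xA yA vS vA.
by rewrite (tourF (mem_neq xA vA)) (tourF (mem_neq yA vA)) !H.
Qed.

Lemma initial_modC S A : initial S A -> modin S (S :\: A).
Proof.
case/initialP=> sA H; apply/modinP; split; first exact: subsetDl.
move=> x y v; rewrite !inE => /andP[xA xS] /andP[yA yS] vS.
by rewrite vS andbT negbK => vA; rewrite !H.
Qed.

(* The clause on initial sets keeps the induction going when the tournament induced by S
   is not strongly connected. *)
Lemma factorizing_order S : exists r : V -> nat,
  [/\ {in S &, injective r},
      forall M x y z, modin S M -> x \in M -> z \in M -> y \in S ->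
        r x <= r y <= r z -> y \in M &
      forall A x y, initial S A -> x \in A -> y \in S -> y \notin A -> r x < r y].
Proof.
have [n] := ubnP #|S|; elim: n S => // n IH S; rewrite ltnS => leSn.
case: (boolP [exists A : {set V}, [&& initial S A, A != set0 & A != S]]) => [exA|strong].
  (* Not strongly connected: a smallest proper initial set [B] comes first, then its complement,
     each ordered by induction. *)
  have [A1 A1P] := existsP exA.
  case: (@arg_minnP _ A1 [pred A : {set V} | [&& initial S A, A != set0 & A != S]]
           (fun A : {set V} => #|A|) A1P) => B /= /and3P[iB B0 BS] minB.
  have [sB HB] := initialP _ _ iB.
  have prB : B \proper S by rewrite properEneq BS.
  have prC : S :\: B \proper S.
    rewrite properE subsetDl /=; apply/negP=> /subsetP sSD.
    by case/set0Pn: B0 => b bB; move: (sSD b (subsetP sB _ bB)); rewrite inE bB.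
  have [r1 [inj1 int1 ini1]] := IH B (leq_trans (proper_card prB) leSn).
  have [r2 [inj2 int2 ini2]] := IH (S :\: B) (leq_trans (proper_card prC) leSn).
  have [K r1K] : exists K, forall x, r1 x < K.
    by exists (\max_(x in V) r1 x).+1 => x; rewrite ltnS leq_bigmax.
  have DP y : y \in S -> y \notin B -> y \in S :\: B by rewrite inE => -> ->.
  (* Two disjoint nonempty initial sets would dominate each other, so they meet, and their
     intersection is initial; by minimality it is [B]. *)
  have iniB A : initial S A -> A != set0 -> B \subset A.
    case/initialP=> sA HA A0; have [->|AS] := eqVneq A S; first exact: sB.
    have [a aA] := set0Pn _ A0.
    have AB : A :&: B != set0.
      apply/negP=> /eqP AB0; have [b bB] := set0Pn _ B0.
      have aB : a \notin B by apply/negP=> aB; move/setP/(_ a): AB0; rewrite !inE aA aB.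
      have bA : b \notin A by apply/negP=> bA; move/setP/(_ b): AB0; rewrite !inE bA bB.
      move: (HA a b aA (subsetP sB _ bB) bA) (HB b a bB (subsetP sA _ aA) aB).
      by rewrite te ?(mem_neq aA bA) // => /negbTE->.
    apply/setIidPr/eqP; rewrite eqEcard subsetIr minB // AB.
    apply/andP; split; last first.
      by apply: contraNneq BS => IS; rewrite eqEsubset sB -IS subsetIr.
    apply/initialP; split; first exact: subset_trans (subsetIl _ _) sA.
    move=> x y; rewrite !inE => /andP[xA xB] yS.
    by rewrite negb_and => /orP[] yN; [apply: HA | apply: HB].
  exists (fun v => if v \in B then r1 v else K + r2 v); split.
  - move=> x y xS yS; case: ifP => xB; case: ifP => yB //.
    + exact: inj1.
    + by move=> E; move: (r1K x); rewrite E ltnNge leq_addr.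
    + by move=> E; move: (r1K y); rewrite -E ltnNge leq_addr.
    by move=> /addnI; apply: inj2; apply: DP; rewrite ?xB ?yB.
  - move=> M x y z mM xM zM yS.
    have [sM HM] := modinP _ _ mM.
    have mB := modin_restr mM sB.
    have mD := modin_restr mM (subsetDl S B).
    (* If such a module did not contain [B], then [B :\: M] would be a smaller nonempty initial
       set. *)
    have key : x \in B -> z \notin B -> initial S (B :|: M) /\ B \subset M.
      move=> xB zB; have zS := subsetP sM _ zM.
      have BM : B \subset M.
        apply/subsetP=> b bB; apply/negPn/negP=> bM.
        have iBM : initial S (B :\: M).
          apply/initialP; split; first exact: subset_trans (subsetDl _ _) sB.
          move=> u w; rewrite !inE => /andP[uM uB] wS.
          rewrite negb_and negbK => /orP[wM|]; last exact: HB.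
          by rewrite (HM w z u) ?(subsetP sB) //; apply: HB.
        have /subsetP/(_ x xB) : B \subset B :\: M.
          by apply: iniB => //; apply/set0Pn; exists b; rewrite inE bM.
        by rewrite inE xM.
      split=> //; rewrite (setUidPr BM); apply/initialP; split=> // u w uM wS wM.
      have wB : w \notin B by apply: contra wM; apply: (subsetP BM).
      by rewrite (modin_eq' mM uM xM wS wM) HB.
    case: ifP => xB; case: ifP => yB; case: ifP => zB // le.
    + by have := int1 _ x y z mB; rewrite !inE xM zM xB yB zB => /(_ isT isT isT le) /andP[].
    + by apply: (subsetP (key xB (negbT zB)).2).
    + by case/andP: le => _ /(leq_ltn_trans)/(_ (r1K z)); rewrite ltnNge leq_addr.
    + have [iM BM] := key xB (negbT zB); rewrite (setUidPr BM) in iM.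
      apply/negPn/negP=> yM.
      have iD : initial (S :\: B) (M :\: B).
        case/initialP: iM => _ HiM; apply/initialP; split; first exact: setSD.
        move=> u w; rewrite !inE => /andP[uB uM] /andP[wB wS].
        by rewrite wB => wM; apply: HiM.
      have := ini2 _ z y iD; rewrite !inE zB zM yB yS (negbTE yM) => /(_ isT isT isT).
      by case/andP: le => _; rewrite leq_add2l leqNgt => /negbTE->.
    + by case/andP: le => /(leq_ltn_trans)/(_ (r1K y)); rewrite ltnNge leq_addr.
    + by case/andP: le => /(leq_ltn_trans)/(_ (r1K y)); rewrite ltnNge leq_addr.
    + case/andP: le => /leq_trans le /le /(leq_ltn_trans)/(_ (r1K z)).
      by rewrite ltnNge leq_addr.
    + have := int2 _ x y z mD; rewrite !inE xM zM xB yB zB yS.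
      by rewrite !(subsetP sM) //; move=> /(_ isT isT isT); rewrite !leq_add2l in le; move=> /(_ le) /andP[].
  - move=> A x y iA xA yS yA; have [sA HA] := initialP _ _ iA.
    have BA : B \subset A by apply: iniB => //; apply/set0Pn; exists x.
    have yB : y \notin B by apply: contra yA; apply: (subsetP BA).
    rewrite (negbTE yB); case: ifP => xB; first exact: leq_trans (r1K x) (leq_addr _ _).
    rewrite ltn_add2l; apply: (ini2 (A :\: B)); rewrite ?inE ?xB ?yB ?(negbTE yA) //.
    apply/initialP; split; first exact: setSD.
    move=> u w; rewrite !inE => /andP[uB uA] /andP[wB wS].
    by rewrite wB /= => wA; apply: HA.
have iniS A : initial S A -> A = set0 \/ A = S.
  move=> iA; move/existsPn/(_ A): strong; rewrite iA /= negb_and !negbK.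
  by case/orP=> /eqP; [left | right].
have ini0 (r : V -> nat) A x y : initial S A -> x \in A -> y \in S -> y \notin A -> r x < r y.
  by move=> /iniS[] ->; rewrite ?inE // => _ ->.
case: (boolP [exists M : {set V}, ntmod S M]) => [exM|noM]; last first.
  exists (fun v => enum_rank v : nat); split=> //.
  - by move=> x y _ _ /val_inj/enum_rank_inj.
  - move=> M x y z mM xM zM yS /andP[le1 le2].
    move/existsPn/(_ M): noM; rewrite /ntmod mM /= negb_and -leqNgt negbK.
    case/orP=> [/card_le1_eqP le|/eqP-> //].
    have E : z = x by [apply: le]; rewrite E in le2.
    suff -> : y = x by [].
    by apply/enum_rank_inj/val_inj/eqP; rewrite eqn_leq le2.
  - by move=> A x y; apply: (ini0 (fun v => enum_rank v : nat)).
have [M0 M0P] := existsP exM.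
case: (@arg_maxnP _ M0 (ntmod S) (fun A : {set V} => #|A|) M0P) => N /and3P[mN N1 NS] maxN.
have [sN HN] := modinP _ _ mN.
(* A largest nontrivial module overlaps no module: the union would be a larger module, hence all of
   [S], and [cover_initial] would contradict strong connectivity. *)
have nover M : modin S M -> [disjoint M & N] \/ (M \subset N \/ N \subset M).
  move=> mM; have [sM _] := modinP _ _ mM.
  case: (boolP [disjoint M & N]) => [|/pred0Pn[z /andP[/= zM zN]]]; first by left.
  right; case: (boolP (M \subset N)) => [|/subsetPn[m mM1 mN1]]; first by left.
  case: (boolP (N \subset M)) => [|/subsetPn[k kN kM]]; first by right.
  have mU := modinU mM mN zM zN.
  have [US|US] := eqVneq (M :|: N) S.
    have [A [iA A0 AS]] := cover_initial mM mN US mM1 mN1 kN kM zM zN.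
    by move/existsPn/(_ A): strong; rewrite iA A0 AS.
  have prN : N \proper M :|: N.
    rewrite properE subsetUr /=; apply/subsetPn; exists m => //.
    by rewrite inE mM1.
  have nU : ntmod S (M :|: N).
    by apply/and3P; split; rewrite // (leq_trans N1) // subset_leq_card // proper_sub.
  by have := maxN _ nU; rewrite /= leqNgt proper_card.
have [x0 x0N] : exists x, x \in N by apply/set0Pn; rewrite -card_gt0 (ltn_trans _ N1).
pose S1 := x0 |: (S :\: N).
have sS1 : S1 \subset S by rewrite subUset sub1set (subsetP sN) // subsetDl.
have c1 : #|S1| < n.
  apply: leq_trans leSn; apply: leq_ltn_trans (_ : #|S :\: N|.+1 < _).
    by rewrite cardsU1; case: (_ \notin _); rewrite ?leqnSn ?add1n.
  by rewrite -(cardsID N S) (setIidPr sN) -[_.+2]add2n leq_add2r.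
have c2 : #|N| < n.
  by apply: leq_trans leSn; apply: proper_card; rewrite properEneq NS.
have [r1 [inj1 int1 _]] := IH S1 c1.
have [r2 [inj2 int2 _]] := IH N c2.
have [K r2K] : exists K, forall x, r2 x < K.
  by exists (\max_(x in V) r2 x).+1 => x; rewrite ltnS leq_bigmax.
(* Lexicographic order: [N] is contracted to [x0], the quotient is ordered by [r1], and [r2] orders
   [N] inside the place of [x0]. *)
pose h v := if v \in N then x0 else v.
pose s v := if v \in N then r2 v else 0.
have sK v : s v < K by rewrite /s; case: ifP => // _; apply: leq_ltn_trans (r2K v).
pose r v := r1 (h v) * K + s v.
have hS v : v \in S -> h v \in S1.
  by rewrite /h; case: ifP => vN vS; rewrite !inE ?eqxx ?vN ?vS ?orbT.
have rle v w : r v <= r w -> r1 (h v) <= r1 (h w).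
  move=> le; rewrite leqNgt; apply/negP=> lt.
  have : r w < r v; last by rewrite ltnNge le.
  apply: leq_trans (leq_addr _ _); apply: leq_trans (leq_mul lt (leqnn K)).
  by rewrite /r mulSnr ltn_add2l.
have hN v w : h v = h w -> v \in N -> w \in N.
  by rewrite /h => E vN; apply: contraTT x0N => wN; move: E; rewrite vN (negbTE wN) => ->.
have hE v w : h v = h w -> v = w \/ (v \in N /\ w \in N).
  move=> E; case: (boolP (v \in N)) => vN; first by right; rewrite (hN v w).
  case: (boolP (w \in N)) => wN; first by rewrite (hN w v) in vN.
  by left; move: E; rewrite /h (negbTE vN) (negbTE wN).
exists r; split=> //.
- move=> x y xS yS E.
  have Eh : h x = h y.
    by apply: inj1; rewrite ?hS //; apply/eqP; rewrite eqn_leq !rle // E.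
  case: (hE _ _ Eh) => // -[xN yN]; move: E; rewrite /r Eh => /addnI.
  by rewrite /s xN yN; apply: inj2.
- move=> M x y z mM xM zM yS /andP[le1 le2]; have [sM HM] := modinP _ _ mM.
  have l1 := rle _ _ le1; have l2 := rle _ _ le2.
  case: (nover M mM) => [dis|[MN|NM]].
  + have nN v : v \in M -> v \notin N by move=> vM; rewrite (disjointFr dis vM).
    have hM v : v \in M -> h v = v by move=> vM; rewrite /h (negbTE (nN v vM)).
    have mS1 := modin_restr mM sS1.
    have inI v : v \in M -> v \in M :&: S1.
      by move=> vM; rewrite inE vM -(hM v vM) hS // (subsetP sM).
    have := int1 _ x (h y) z mS1 (inI _ xM) (inI _ zM) (hS _ yS).
    rewrite (hM x xM) in l1; rewrite (hM z zM) in l2; rewrite l1 l2 => /(_ isT); rewrite inE => /andP[hyM _].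
    move: hyM; rewrite /h; case: ifP => // yN x0M.
    by rewrite (negbTE (nN _ x0M)) in x0N.
  + have xN := subsetP MN _ xM; have zN := subsetP MN _ zM.
    have Ey : r1 (h y) = r1 x0.
      by apply/eqP; move: l1 l2; rewrite /h xN zN eqn_leq => -> ->.
    have yN : y \in N.
      apply: (hN x0); rewrite // /h x0N; symmetry; apply: inj1; rewrite ?hS //.
      by rewrite !inE eqxx.
    move: le1 le2; rewrite /r /s /h xN yN zN !leq_add2l => le1 le2.
    have mMN := modin_restr mM sN.
    have := int2 _ x y z mMN; rewrite !inE xM zM xN zN yN le1 le2.
    by move=> /(_ isT isT isT isT)/andP[].
  + have hM v : v \in M -> h v \in M :&: S1.
      move=> vM; rewrite inE hS ?(subsetP sM) // andbT /h; case: ifP => // _.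
      exact: (subsetP NM).
    have := int1 _ (h x) (h y) (h z) (modin_restr mM sS1) (hM _ xM) (hM _ zM) (hS _ yS).
    rewrite l1 l2 => /(_ isT); rewrite inE => /andP[hyM _].
    by move: hyM; rewrite /h; case: ifP => // yN _; apply: (subsetP NM).
- by move=> A x y; apply: (ini0 r).
Qed.

End Modules.

(** * Transversals of the co-modules *)

(** Greedy stabbing: the interval whose last element [x] comes earliest becomes the block of [x],
    all intervals containing [x] are discarded, and the remaining ones lie entirely after [x]. *)
Lemma interval_transversal (V : finType) (r : V -> nat) (F : {set {set V}}) :
  injective r -> (forall I, I \in F -> I != set0) ->
  (forall I x y z, I \in F -> x \in I -> z \in I -> r x <= r y <= r z -> y \in I) ->
  exists (X : {set V}) (b : V -> {set V}),
    [/\ forall x, x \in X -> [/\ b x \in F, x \in b x & forall y, y \in b x -> r y <= r x],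
        {in X &, forall x y, x != y -> [disjoint b x & b y]} &
        forall I, I \in F -> exists2 x, x \in X & x \in I].
Proof.
move=> rI; have [n] := ubnP #|F|; elim: n F => // n IH F; rewrite ltnS => leF F0 Fint.
case: (set_0Vmem F) => [->|[I0 I0F]].
  by exists set0, (fun=> set0); split=> [x|x y|I]; rewrite inE.
pose rmax (I : {set V}) := \max_(x in I) r x.
have rmaxP I : I \in F -> exists2 x, x \in I & rmax I = r x.
  move=> IF; have [|x xI Ex] := @eq_bigmax_cond _ (mem I) r; last by exists x.
  by rewrite card_gt0 F0.
case: (arg_minnP rmax I0F) => I IF minI; have [x xI Ex] := rmaxP I IF.
pose F' := [set J in F | x \notin J].
have sF : F' \subset F by apply/subsetP=> J; rewrite inE => /andP[].
have [|||X [b [Xb Xd Xh]]] := IH F'.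
- apply: leq_trans leF; apply: proper_card; rewrite properE sF /=.
  by apply/subsetPn; exists I; rewrite // inE xI andbF.
- by move=> J JF; apply: F0; apply: (subsetP sF).
- by move=> J u v w JF; apply: Fint; apply: (subsetP sF).
have bF y : y \in X -> b y \in F /\ x \notin b y.
  by case/Xb; rewrite inE => /andP[].
have xX : x \notin X by apply/negP=> /[dup] /bF[_ /negP xb] /Xb[].
have rI_max y : y \in I -> r y <= r x by move=> yI; rewrite -Ex leq_bigmax_cond.
have Id y : y \in X -> [disjoint I & b y].
  move=> yX; have [byF xb] := bF y yX; apply/pred0P=> w /=; apply/negP=> /andP[wI wb].
  have [m mb Em] := rmaxP _ byF; case/negP: xb; apply: (Fint (b y) w x m) => //.
  by rewrite rI_max // -Em -Ex minI.
exists (x |: X), (fun y => if y == x then I else b y); split.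
- move=> y; rewrite !inE; case: eqP => [-> _|_ /= yX] //.
  by have [? ? ?] := Xb _ yX; have [] := bF _ yX.
- move=> y z; rewrite !inE; case: eqP => [->|_] /=; case: eqP => [->|_] //=.
  + by rewrite eqxx.
  + by move=> _ zX _; apply: Id.
  + by move=> yX _ _; rewrite disjoint_sym; apply: Id.
  exact: Xd.
- move=> J JF; case: (boolP (x \in J)) => xJ; first by exists x; rewrite // !inE eqxx.
  have [|y yX yJ] := Xh J; first by rewrite inE JF.
  by exists y; rewrite // inE yX orbT.
Qed.

(** * Disjoint minimal modules with a twin-free transversal *)

Section Systems.

Variables (V : finType) (e : rel V).
Hypothesis te : tour e.
Implicit Types (S M N A Q U X Z : {set V}) (b : V -> {set V}).

Notation ntm := (ntmod e setT).

Definition minmod Q := ntm Q && [forall R : {set V}, ntm R ==> (R \subset Q) ==> (R == Q)].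

Lemma minmodP Q : reflect (ntm Q /\ forall R, ntm R -> R \subset Q -> R = Q) (minmod Q).
Proof.
apply: (iffP andP) => -[nQ H]; split=> //.
  by move=> R nR sR; move/forallP/(_ R): H; rewrite nR sR => /eqP.
by apply/forallP=> R; apply/implyP=> nR; apply/implyP=> sR; rewrite (H R).
Qed.

Lemma minmod_sub Q : ntm Q -> exists2 R, minmod R & R \subset Q.
Proof.
move=> nQ; pose P R := ntm R && (R \subset Q).
have PQ : P Q by rewrite /P nQ subxx.
case: (@arg_minnP _ Q P (fun A : {set V} => #|A|) PQ) => R /andP[nR sR] minR.
exists R => //; apply/minmodP; split=> // R' nR' sR'.
apply/eqP; rewrite eqEcard sR' minR // /P nR' /=; exact: subset_trans sR.
Qed.

Lemma ntm_mod Q : ntm Q -> modin e setT Q. Proof. by case/and3P. Qed.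

Lemma ntmI M : modin e setT M -> 1 < #|M| -> M != setT -> ntm M.
Proof. by move=> mM M1 MT; apply/and3P; split. Qed.

Lemma ntm_eq M x y v : modin e setT M -> x \in M -> y \in M -> v \notin M -> e v x = e v y.
Proof. by move=> mM xM yM; apply: (modin_eq mM); rewrite ?inE. Qed.

Lemma modT M : (forall x y v, x \in M -> y \in M -> v \notin M -> e v x = e v y) ->
  modin e setT M.
Proof. by move=> H; apply/modinP; split; rewrite ?subsetT // => x y v ? ? _; apply: H. Qed.

(** A two-element module inside [X] would survive the inversion of [X]: every other vertex has both
    or none of its arcs to the pair reversed. *)
Definition notwins X := {in X &, forall x y, x != y -> ~~ modin e setT [set x; y]}.

Definition disjfam X b := {in X &, forall x y, x != y -> [disjoint b x & b y]}.

(** The disjoint blocks show that no set smaller than [X] meets all nontrivial modules inside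
    [U]. *)
Definition packing U X b :=
  [/\ forall x, x \in X -> [/\ x \in b x, minmod (b x) & b x \subset U],
      disjfam X b &
      forall Q, ntm Q -> Q \subset U -> exists2 x, x \in X & x \in Q].

Lemma card2_ex (Q : {set V}) x : 1 < #|Q| -> exists2 z, z \in Q & z != x.
Proof.
case/card_gt1P=> u [v [uQ vQ uv]]; have [ux|ux] := eqVneq u x; last by exists u.
by exists v; rewrite // -ux eq_sym.
Qed.

(** The greedy choice makes each [x] the last element of its block. If [{x, y}] with [x] before [y]
    were a module, the block of [y] would avoid [x] and contain an element before [y]; as the block
    is an interval, that element would lie strictly between [x] and [y], although [{x, y}] is an
    interval too. An element of [Z] is first in the order and lies in no block. *)
Lemma packing_exists (r : V -> nat) U Z :
  injective r ->
  (forall M x y z, modin e setT M -> x \in M -> z \in M -> r x <= r y <= r z -> y \in M) ->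
  (forall z, z \in Z -> z \notin U /\ forall v, r z <= r v) ->
  exists X b, packing U X b /\ notwins (Z :|: X).
Proof.
move=> rI rint ZP; pose F := [set Q : {set V} | minmod Q & Q \subset U].
have FP Q : Q \in F -> minmod Q /\ ntm Q.
  by rewrite inE => /andP[mQ _]; split=> //; case/minmodP: mQ.
have [||X [b [Xb Xd Xh]]] := @interval_transversal V r F rI.
- move=> I /FP[_ /and3P[_ I1 _]]; rewrite -card_gt0; lia.
- by move=> I x y z /FP[_ /ntm_mod]; apply: rint.
have Xb' x : x \in X -> [/\ x \in b x, minmod (b x) & b x \subset U].
  by case/Xb; rewrite inE => /andP[].
exists X, b; split.
  split=> // Q nQ sQ; have [R mR sR] := minmod_sub nQ.
  have [|x xX xR] := Xh R; first by rewrite inE mR (subset_trans sR).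
  by exists x; rewrite // (subsetP sR).
suff key x y : x \in Z :|: X -> y \in Z :|: X -> r x < r y -> ~~ modin e setT [set x; y].
  move=> x y xX yX xy; case: (ltngtP (r x) (r y)) => [|yx|/rI E]; first exact: key.
    by rewrite setUC; apply: key.
  by rewrite E eqxx in xy.
move=> xX yX xy; apply/negP=> mxy.
have yX' : y \in X.
  move: yX; rewrite inE => /orP[/ZP[_ /(_ x)]|//]; lia.
have [byF yb bmax] := Xb _ yX'; have [_ _ bU] := Xb' _ yX'.
have xb : x \notin b y.
  move: xX; rewrite inE => /orP[/ZP[xU _]|xX].
    by apply: contra xU; apply: (subsetP bU).
  have [xb _ _] := Xb' _ xX; have xNy : x != y by apply: contraTneq xy => ->; rewrite ltnn.
  by rewrite (disjointFr (Xd _ _ xX yX' xNy) xb).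
have [_ /and3P[mb b1 _]] := FP _ byF.
have [z zb zy] := card2_ex y b1.
have rz := bmax _ zb.
have zx : r x < r z.
  by rewrite ltnNge; apply: contra xb => le; apply: (rint _ z x y mb); rewrite // le ltnW.
have : z \in [set x; y].
  by apply: (rint _ x z y mxy); rewrite ?inE ?eqxx ?orbT // (ltnW zx).
by rewrite !inE (negbTE zy) orbF => /eqP E; rewrite E ltnn in zx.
Qed.

Definition extreme p := modin e setT (~: [set p]).

Definition src S s := s \in S /\ forall v, v \in S -> v != s -> e s v.
Definition snk S t := t \in S /\ forall v, v \in S -> v != t -> e v t.

Lemma extremeP p : extreme p -> src setT p \/ snk setT p.
Proof.
move=> xp; case: (set_0Vmem (~: [set p])) => [E|[q]].
  left; split=> // v _ vp; suff : v \in set0 by rewrite inE.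
  by rewrite -E !inE.
rewrite !inE => qp; case Eq: (e p q); [left | right]; split=> // v _ vp.
  by rewrite (@ntm_eq _ v q p xp) // !inE ?eqxx.
by rewrite te // (@ntm_eq _ v q p xp) ?Eq // !inE ?eqxx.
Qed.

Lemma snk_extreme p : snk setT p -> extreme p.
Proof.
case=> _ H; apply: modT => x y v; rewrite !inE negbK => xp yp /eqP->.
by rewrite (tourF te xp) (tourF te yp) !H ?inE.
Qed.

(** A source comes first by the clause on initial sets; a sink comes last, and modules stay
    intervals when the order is reversed. *)
Lemma order_at p : extreme p -> exists r : V -> nat,
  [/\ injective r,
      forall M x y z, modin e setT M -> x \in M -> z \in M -> r x <= r y <= r z -> y \in M &
      forall v, r p <= r v].
Proof.
move=> xp; have [r [rI rint rini]] := factorizing_order te [set: V].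
have rI' : injective r by move=> x y; apply: rI; rewrite inE.
have rint' M x y z : modin e setT M -> x \in M -> z \in M -> r x <= r y <= r z -> y \in M.
  by move=> mM xM zM; apply: rint mM xM zM _; rewrite inE.
case: (extremeP xp) => -[_ H].
  exists r; split=> // v; have [->//|vp] := eqVneq v p.
  apply/ltnW/(rini [set p]); rewrite ?inE ?eqxx //.
  apply/initialP; split; rewrite ?subsetT // => x y; rewrite !inE => /eqP-> _ yp.
  by rewrite H ?inE.
have rp v : r v <= r p.
  have [->//|vp] := eqVneq v p.
  apply/ltnW/(rini (~: [set p])); rewrite ?inE ?eqxx //.
  apply/initialP; split; rewrite ?subsetT // => x y; rewrite !inE negbK => xp' _ /eqP->.
  by rewrite H ?inE.
exists (fun v => r p - r v); split.
- move=> x y E; apply: rI'; have := rp x; have := rp y; lia.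
- move=> M x y z mM xM zM le; apply: (rint' M z y x) => //.
  by have := rp x; have := rp y; have := rp z; lia.
- by move=> v; rewrite subnn.
Qed.

Definition trans_even S :=
  {in S & &, forall x y z, e x y -> e y z -> e x z} /\ ~~ odd #|S|.

(* Peels the source s of S and the source s2 of S \ s: if {s2, s3} is a twin
   pair for the next source s3, it becomes the block of s3. *)
Lemma packing_two_ends S s t :
  modin e setT S -> src S s -> snk setT t -> t \in S -> s != t -> ~ trans_even S ->
  exists X b, packing (S :\ s :\ t) X b /\ notwins (s |: (t |: X)).
Proof.
move=> + + tsink; have [n] := ubnP #|S|.
elim: n S s => // n IH S s; rewrite ltnS => leS mS [sS srcs] tS st nte.
have [r [rI rint rt]] := order_at (snk_extreme tsink).
have helper U : t \notin U -> exists X b, packing U X b /\ notwins (t |: X).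
  by move=> tU; apply: (packing_exists rI rint) => z; rewrite inE => /eqP->.
have twin_s (X : {set V}) : notwins (t |: X) ->
    (forall y, y \in t |: X -> y != s -> ~~ modin e setT [set s; y]) -> notwins (s |: (t |: X)).
  move=> nX ns x y; rewrite in_setU1 => /orP[/eqP->|xX]; rewrite in_setU1 => /orP[/eqP->|yX].
  - by rewrite eqxx.
  - by move=> sy; apply: ns; rewrite // eq_sym.
  - by move=> xs; rewrite setUC; apply: ns.
  - exact: nX.
case: (boolP [exists s2, (s2 \in S :\ s) && [forall v in S :\ s, (v != s2) ==> e s2 v]]).
  move=> /existsP[s2 /andP[s2S /forall_inP srcs2']].
  have srcs2 v : v \in S -> v != s -> v != s2 -> e s2 v.
    by move=> vS vs vs2; have := srcs2' v; rewrite !inE vS vs vs2; apply.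
  move: s2S; rewrite !inE => /andP[s2s s2S].
  have ss2 := srcs s2 s2S s2s.
  (* [s2] separates [s] from every other vertex of [S]. *)
  have ns y : y \in S -> y != s2 -> y != s -> ~~ modin e setT [set s; y].
    move=> yS ys2 ys; apply/negP=> m.
    have : e s2 s = e s2 y by apply: (ntm_eq m); rewrite !inE ?eqxx ?orbT // negb_or s2s eq_sym.
    by rewrite (srcs2 y) // te // ss2.
  (* Both [s] and [t] are forced into the transversal. If they are twins here, [S = {s, t}] is
     transitive of even order, which is excluded. *)
  have [s2t|s2t] := eqVneq s2 t.
    case: nte; have ES : S = [set s; t].
      apply/setP=> v; rewrite !inE; apply/idP/orP=> [vS|[]/eqP-> //].
      have [vs|vs] := eqVneq v s; [by left | right].
      have [//|vt] := eqVneq v t.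
      have := srcs2 v vS vs; rewrite s2t => /(_ vt).
      by case: tsink => _ Ht; rewrite te 1?eq_sym // Ht ?inE.
    split; last by rewrite ES cards2 st.
    move=> x y z; rewrite ES !inE => /orP[]/eqP-> /orP[]/eqP-> /orP[]/eqP-> //;
      by rewrite (tourF te st); case: (e s t).
  pose S' := S :\ s :\ s2.
  have S'S v : v \in S' -> [/\ v \in S, v != s & v != s2].
    by rewrite !inE => /and3P[].
  have S'I v : v \in S -> v != s -> v != s2 -> v \in S' by rewrite !inE => -> -> ->.
  have tS' : t \in S' by apply: S'I => //; rewrite eq_sym.
  have mS' : modin e setT S'.
    apply: modT => x y v /S'S[xS xs xs2] /S'S[yS ys ys2] vS'.
    case: (boolP (v \in S)) => vS; last exact: (ntm_eq mS).
    have [->|vs] := eqVneq v s; first by rewrite !srcs.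
    have [->|vs2] := eqVneq v s2; first by rewrite !srcs2.
    by rewrite S'I in vS'.
  (* Dropping [s2] from a nontrivial module leaves a nontrivial one, unless the module is a pair
     whose other element is a source of [S']. *)
  have twin3 Q : ntm Q -> Q \subset S :\ s :\ t -> s2 \in Q ->
      (forall q, q \in S' -> q \in Q -> ~~ [forall v in S', (v != q) ==> e q v]) -> ntm (Q :\ s2).
    move=> nQ sQ s2Q nq; have sQ' q : q \in Q :\ s2 -> q \in S'.
      by rewrite inE => /andP[qs2 /(subsetP sQ)]; rewrite !inE in qs2 * => /and3P[_ -> ->]; rewrite qs2.
    have mQ := ntm_mod nQ.
    have mQ2 : modin e setT (Q :\ s2).
      apply: modT => x y v xQ yQ vQ.
      have [xS xs x2] := S'S x (sQ' x xQ); have [yS ys y2] := S'S y (sQ' y yQ).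
      case: (boolP (v \in Q)) => vQ'.
        by move: vQ; rewrite !inE vQ' andbT negbK => /eqP->; rewrite !srcs2.
      by apply: (ntm_eq mQ) vQ'; [move: xQ | move: yQ]; rewrite inE => /andP[].
    apply: ntmI => //; last by apply/eqP=> /setP/(_ s2); rewrite !inE eqxx.
    case/and3P: nQ => _ Q1 _; have [q qQ qs2] := card2_ex s2 Q1.
    rewrite ltnNge; apply/negP=> /card_le1_eqP c1.
    have qQ2 : q \in Q :\ s2 by rewrite !inE qs2.
    have qS' := sQ' _ qQ2.
    case/negP: (nq q qS' qQ); apply/forall_inP=> v vS'; apply/implyP=> vq.
    have [vS vs vs2] := S'S v vS'.
    have vQ : v \notin Q by apply: contra vq => vQ; rewrite (c1 v q) // !inE vs2.
    rewrite (modin_eq' te mQ qQ s2Q (in_setT v) vQ); exact: srcs2.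
  case: (boolP [exists s3, (s3 \in S') && [forall v in S', (v != s3) ==> e s3 v]]); last first.
    move=> /existsPn noS'.
    have [|X [b [[Xb Xd Xh] nX]]] := helper (S' :\ t); first by rewrite !inE eqxx.
    have XS' x : x \in X -> x \in S' :\ t by case/Xb=> xb _ /subsetP; apply.
    exists X, b; split; last first.
      apply: twin_s => // y; rewrite in_setU1 => /orP[/eqP->|/XS'] ys.
        by apply: ns; rewrite // eq_sym.
        by move: ys; rewrite in_setD1 => /andP[_ /S'S[? ? ?]] _; apply: ns.
    split=> //.
      move=> x /Xb[xb mx bS]; split=> //; apply: subset_trans bS _.
      by apply/subsetP=> v; rewrite !inE => /and4P[-> _ -> ->].
    move=> Q nQ sQ; have sS't (R : {set V}) : R \subset S :\ s :\ t -> s2 \notin R -> R \subset S' :\ t.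
      move=> sR s2R; apply/subsetP=> v vR; have := subsetP sR v vR; rewrite !inE => /and3P[-> -> ->].
      by rewrite !andbT /=; apply: contraNneq s2R => <-.
    case: (boolP (s2 \in Q)) => s2Q; last exact: Xh (sS't _ sQ s2Q).
    have [||x xX] := Xh (Q :\ s2).
    - apply: twin3 => // q qS' _; have := noS' q; by rewrite qS'.
    - by apply: sS't; rewrite ?inE ?eqxx // (subset_trans (subsetDl _ _)).
    - by rewrite !inE => /andP[_ xQ]; exists x.
  move=> /existsP[s3 /andP[s3S' /forall_inP srcs3']].
  have srcs3 v : v \in S' -> v != s3 -> e s3 v.
    by move=> vS vs3; have := srcs3' v vS; rewrite vs3; apply.
  have [s3S s3s s3s2] := S'S _ s3S'.
  (* If [s3 = t] then [S = {s, s2, t}], and no nontrivial module fits between the two ends. *)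
  have [s3t|s3t] := eqVneq s3 t.
    have ES v : v \in S' -> v = t.
      move=> vS'; apply/eqP/negPn/negP=> vt; have := srcs3 v vS'; rewrite s3t => /(_ vt).
      by case: tsink => _ Ht; rewrite te 1?eq_sym // Ht ?inE.
    exists set0, (fun=> set0); split.
      split=> [x|x y|Q nQ sQ]; rewrite ?inE //; exfalso.
      have [q qQ qs2] := card2_ex s2 (proj1 (andP (proj2 (andP nQ)))).
      have := subsetP sQ q qQ; rewrite !inE => /and3P[qt qs qS].
      by rewrite (ES q) ?eqxx // in qt; apply: S'I.
    apply: twin_s; first by move=> x y; rewrite setU0 !inE => /eqP-> /eqP->; rewrite eqxx.
    move=> y; rewrite setU0 inE => /eqP-> ts; apply: ns; rewrite // eq_sym //.
  have s23 : modin e setT [set s2; s3].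
    apply: modT => x y v xI yI; rewrite !inE negb_or => /andP[v2 v3].
    suff H : forall w, w \in [set s2; s3] -> e v w = e v s2 by rewrite !H.
    move=> w; rewrite !inE => /orP[]/eqP-> //.
    case: (boolP (v \in S)) => vS; last exact: (ntm_eq mS).
    have [->|vs] := eqVneq v s; first by rewrite !srcs.
    rewrite [in LHS]te // [in RHS]te //; congr (~~ _).
    by rewrite srcs2 // srcs3 //; apply: S'I.
  have [||||||X [b [[Xb Xd Xh] nX]]] := IH S' s3.
  - apply: leq_trans leS; apply: proper_card; apply/properP; split.
      by apply/subsetP=> v /S'S[].
    by exists s; rewrite // !inE eqxx andbF.
  - exact: mS'.
  - by split.
  - exact: tS'.
  - exact: s3t.
  (* Removing two vertices keeps the parity, and putting the successive sources [s] and [s2] back in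
     front preserves transitivity. *)
  - case=> tr ev; case: nte; split; last first.
      have -> : #|S| = #|S'|.+2.
        by rewrite (cardsD1 s) sS (cardsD1 s2) !inE s2s s2S.
      by rewrite /= negbK.
    have into_s v : v \in S -> v != s -> e v s = false by move=> vS vs; rewrite te // srcs.
    have into_s2 v : v \in S -> v != s -> e v s2 -> v = s2.
      by move=> vS vs; have [//|v2] := eqVneq v s2; rewrite te // srcs2.
    move=> x y z xS yS zS.
    have [->|ys] := eqVneq y s; first by have [->|xs] := eqVneq x s; rewrite ?(into_s x).
    have [->|y2] := eqVneq y s2.
      have [->|xs] := eqVneq x s; last by move/(into_s2 x xS xs)->.
      move=> _ s2z; apply: srcs => //; apply: contraTneq s2z => ->.
      by rewrite into_s.
    have zs' : e y z -> z != s by apply: contraTneq => ->; rewrite into_s.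
    have zs2 : e y z -> z != s2.
      by apply: contraTneq => ->; apply/negP=> /(into_s2 y yS ys)/eqP; rewrite (negbTE y2).
    have [->|xs] := eqVneq x s; first by move=> _ /zs'; apply: srcs.
    have [->|x2] := eqVneq x s2; first by move=> _ yz; apply: srcs2; rewrite ?zs' ?zs2.
    move=> xy yz; apply: (tr x y z) => //; apply: S'I => //; [exact: zs' | exact: zs2].
  have XS' x : x \in X -> x \in S' :\ s3 :\ t by case/Xb=> xb _ /subsetP; apply.
  have bS' x : x \in X -> [disjoint [set s2; s3] & b x].
    case/Xb=> _ _ /subsetP bS; apply/pred0P=> w /=; apply/negP=> /andP[w23 /bS].
    by move: w23; rewrite !inE => /orP[]/eqP->; rewrite eqxx ?andbF.
  exists (s3 |: X), (fun x => if x == s3 then [set s2; s3] else b x); split.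
    split.
    + move=> x; rewrite in_setU1; case: eqP => [-> _|_ /= /Xb[xb mb bS]].
        split; first by rewrite !inE eqxx orbT.
          apply/minmodP; split.
            apply: ntmI => //; first by rewrite cards2 eq_sym s3s2.
            by apply/eqP=> /setP/(_ s); rewrite !inE eq_sym (negbTE s2s) eq_sym (negbTE s3s).
          move=> R /and3P[_ R1 _] sR; apply/eqP; rewrite eqEcard sR.
          by rewrite cards2 eq_sym s3s2.
        by apply/subsetP=> w; rewrite !inE => /orP[]/eqP->; rewrite ?s2t ?s2s ?s3t ?s3s.
      split=> //; apply: subset_trans bS _.
      by apply/subsetP=> v; rewrite !inE => /and5P[-> _ _ -> ->].
    + move=> x y; rewrite !in_setU1; case: eqP => [->|_] /=; case: eqP => [->|_] //=.
      * by rewrite eqxx.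
      * by move=> _ yX _; apply: bS'.
      * by move=> xX _ _; rewrite disjoint_sym; apply: bS'.
      * exact: Xd.
    + move=> Q nQ sQ.
      case: (boolP (s3 \in Q)) => s3Q; first by exists s3; rewrite // !inE eqxx.
      have s2Q : s2 \notin Q.
        apply/negP=> s2Q; have [q qQ qs2] := card2_ex s2 (proj1 (andP (proj2 (andP nQ)))).
        have := subsetP sQ q qQ; rewrite !inE => /and3P[qt qs qS].
        have qs3 : q != s3 by apply: contraNneq s3Q => <-.
        have := ntm_eq (ntm_mod nQ) qQ s2Q s3Q.
        by rewrite srcs3 ?S'I // te // srcs2.
      have [||x xX xQ] := Xh Q => //.
        apply/subsetP=> v vQ; have := subsetP sQ v vQ; rewrite !inE => /and3P[-> -> ->].
        rewrite !andbT /=; apply/andP; split.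
          by apply: contraNneq s3Q => <-.
        by apply: contraNneq s2Q => <-.
      by exists x; rewrite // inE xX orbT.
  apply: twin_s => [x y|y].
    by rewrite setUCA; apply: nX.
  rewrite !in_setU1 => /or3P[/eqP->|/eqP->|/XS'] ys.
  - by apply: ns; rewrite // eq_sym.
  - exact: ns.
  - by move: ys; rewrite 2!in_setD1 => /and3P[_ _ /S'S[? ? ?]] _; apply: ns.
(* A twin of [s] in [S] would dominate the rest of [S] as [s] does, hence be a source of
   [S :\ s]. *)
move=> /existsPn noS2.
have [|X [b [pX nX]]] := helper (S :\ s :\ t); first by rewrite !inE eqxx.
exists X, b; split=> //; apply: twin_s => // y yX ys; apply/negP=> m.
have yS : y \in S.
  move: yX; rewrite in_setU1 => /orP[/eqP->//|yX]; case: pX => Xb _ _.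
  by have [yb _ /subsetP/(_ _ yb)] := Xb _ yX; rewrite !inE => /and3P[].
case/negP: (noS2 y); rewrite !inE ys yS /=; apply/forall_inP=> v.
rewrite !inE => /andP[vs vS]; apply/implyP=> vy.
have -> : e y v = e s v.
  by apply: (modin_eq' te m); rewrite ?inE ?eqxx ?orbT // negb_or vs.
exact: srcs.
Qed.

End Systems.

(** * Transversals of all co-modules *)

Section Systems.

Variables (V : finType) (e : rel V).
Hypothesis te : tour e.
Implicit Types (S M N A Q U X Z : {set V}) (b : V -> {set V}).

Notation ntm := (ntmod e setT).
Notation minmod := (minmod e).
Notation notwins := (notwins e).

Definition comod Q := ntm Q || ntm (~: Q).

(** Needed when the transversal of the minimal modules lies inside a nontrivial module: the
    complement of a maximal such module is a co-module that is missed, and it becomes the block of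
    one further vertex. The last two clauses record that the other vertices already meet all
    nontrivial modules, and the maximality. *)
Definition outer X b x :=
  [/\ ntm (~: b x), 1 < #|b x|,
      forall y, y \in X -> y != x -> minmod (b y),
      forall Q, ntm Q -> exists y, [/\ y \in X, y != x & y \in Q] &
      forall M, modin e setT M -> ~: b x \subset M -> M = ~: b x \/ M = setT].

Definition block X b x :=
  [\/ minmod (b x), b x = [set x] /\ extreme e x | outer X b x].

Definition sys X b :=
  [/\ forall x, x \in X -> x \in b x, forall x, x \in X -> block X b x, disjfam X b,
      forall Q, comod Q -> exists2 x, x \in X & x \in Q & notwins X].

Lemma two_extremes p q : p != q -> extreme e p -> extreme e q -> src e setT p -> snk e setT q.
Proof.
move=> pq xp xq [_ Hp]; case: (extremeP te xq) => // -[_ Hq].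
by have := Hp q (in_setT _); rewrite eq_sym pq => /(_ isT); rewrite te // Hq ?inE.
Qed.

Lemma ntm_card Q x : ntm Q -> exists2 y, y \in Q & y != x.
Proof. by case/and3P=> _ Q1 _; apply: card2_ex. Qed.

(** The cases are two, one or no extreme vertex. An extreme vertex [p] makes [{p}] a co-module and
    so has to be in [X]; with none, an outer block is added if [X] lies in a nontrivial module. *)
Lemma sys_exists : 2 < #|V| -> ~ trans_even e setT -> (exists Q, ntm Q) ->
  exists X b, sys X b.
Proof.
move=> V3 nte [Q0 nQ0].
case: (boolP [exists s, extreme e s]) => [/existsP[s xs]|/existsPn nox].
  case: (boolP [exists t, extreme e t && (t != s)]) => [/existsP[t /andP[xt ts]]|/existsPn no2].
    wlog srcs : s t xs xt ts / src e setT s.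
      move=> H; case: (extremeP te xs); first exact: (H s t).
      move=> sinks; case: (extremeP te xt) => [srct|sinkt].
        by apply: (H t s); rewrite // eq_sym.
      case: sinks sinkt => _ Hs [_ Ht]; have := Hs t (in_setT _) ts.
      by rewrite te // Ht ?inE // eq_sym.
    have st : s != t by rewrite eq_sym.
    have sinkt := two_extremes st xs xt srcs.
    have mT : modin e setT setT by apply: modT => x y v; rewrite !inE.
    have [X [b [[Xb Xd Xh] nX]]] := packing_two_ends te mT srcs sinkt (in_setT t) st nte.
    have XU x : x \in X -> x \in b x /\ (x != s /\ x != t).
      case/Xb=> xb _ /subsetP/(_ x xb); rewrite !inE => /and3P[-> -> _].
      by split.
    have notb x w : x \in X -> w \in b x -> (w == s) || (w == t) = false.
      by case/Xb=> _ _ /subsetP bU /bU; rewrite !inE => /and3P[/negbTE-> /negbTE-> _].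
    pose b' x := if (x == s) || (x == t) then [set x] else b x.
    have b'X x : x \in X -> b' x = b x.
      by case/XU=> _ [xs' xt']; rewrite /b' (negbTE xs') (negbTE xt').
    have inY x : x \in s |: (t |: X) -> x \in X \/ ((x == s) || (x == t) /\ extreme e x).
      rewrite !in_setU1 => /or3P[/eqP->|/eqP->|]; rewrite ?eqxx ?orbT; [right|right|left] => //.
    exists (s |: (t |: X)), b'; split=> //.
    - move=> x /inY[xX|[xst _]]; first by rewrite b'X //; case: (XU x xX).
      by rewrite /b' xst inE.
    - move=> x /inY[xX|[xst xx]]; last by constructor 2; rewrite /b' xst.
      by constructor 1; rewrite b'X //; case: (Xb x xX).
    - move=> x y /inY xX /inY yX xy; apply/pred0P=> w /=; apply/negP=> /andP[].
      case: xX => [xX|[xst _]]; case: yX => [yX|[yst _]].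
      + by rewrite !b'X // => wx; rewrite (disjointFr (Xd x y xX yX xy) wx).
      + by rewrite b'X // {1}/b' yst inE => /(notb x w xX) H /eqP E; rewrite E yst in H.
      + by rewrite (b'X y) // {1}/b' xst inE => /eqP E /(notb y w yX); rewrite E xst.
      + by rewrite /b' xst yst !inE => /eqP-> /eqP E; rewrite E eqxx in xy.
    - have hs Q : s \in Q -> exists2 x, x \in s |: (t |: X) & x \in Q.
        by exists s; rewrite // in_setU1 eqxx.
      have ht Q : t \in Q -> exists2 x, x \in s |: (t |: X) & x \in Q.
        by exists t; rewrite // !in_setU1 eqxx orbT.
      move=> Q cQ; case: (boolP (s \in Q)) => [/hs//|sQ].
      case: (boolP (t \in Q)) => [/ht//|tQ]; case/orP: cQ => nQ.
        have [||x xX xQ] := Xh Q => //; last by exists x; rewrite // !in_setU1 xX !orbT.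
        apply/subsetP=> w wQ; rewrite !inE; apply/and3P; split=> //.
          by apply: contraNneq tQ => <-.
        by apply: contraNneq sQ => <-.
      (* A vertex of [Q] would see the source [s] and the sink [t], both in the module [~: Q],
         differently. *)
      case/and3P: nQ => mQ _ /eqP QT; case: QT; apply/setP=> v; rewrite !inE.
      apply/negP=> vQ; have vN : v \notin ~: Q by rewrite inE negbK.
      have vs : v != s by apply: contraNneq sQ => <-.
      have vt : v != t by apply: contraNneq tQ => <-.
      have := ntm_eq (x := s) (y := t) mQ; rewrite !inE => /(_ v sQ tQ vN).
      case: srcs sinkt => _ Hs [_ Ht]; rewrite Ht // te // Hs //.
  have only p : extreme e p -> p = s.
    by move=> xp; have := no2 p; rewrite xp negbK => /eqP.
  have [r [rI rint rs]] := order_at te xs.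
  have [|X [b [[Xb Xd Xh] nX]]] := @packing_exists _ e r (~: [set s]) [set s] rI rint.
    by move=> z; rewrite inE => /eqP->; rewrite !inE eqxx.
  have sX x : x \in X -> x != s.
    by case/Xb=> xb _ /subsetP/(_ x xb); rewrite !inE.
  have sb x : x \in X -> s \notin b x.
    by case/Xb=> _ _ /subsetP bU; apply/negP=> /bU; rewrite !inE eqxx.
  pose b' x := if x == s then [set x] else b x.
  have b'X x : x \in X -> b' x = b x by move/sX; rewrite /b' => /negbTE->.
  exists (s |: X), b'; split=> //.
  - move=> x; rewrite in_setU1 => /orP[/eqP->|xX]; first by rewrite /b' eqxx inE.
    by rewrite b'X //; case: (Xb x xX).
  - move=> x; rewrite in_setU1 => /orP[/eqP->|xX]; first by constructor 2; rewrite /b' eqxx.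
    by constructor 1; rewrite b'X //; case: (Xb x xX).
  - move=> x y; rewrite !in_setU1 => /orP[/eqP->|xX] /orP[/eqP->|yX].
    + by rewrite eqxx.
    + by rewrite (b'X y) // /b' eqxx disjoints1 sb.
    + by rewrite (b'X x) // /b' eqxx disjoint_sym disjoints1 sb.
    + by rewrite !b'X //; apply: Xd.
  - have hit Q : ntm Q -> s \notin Q -> exists2 x, x \in s |: X & x \in Q.
      move=> nQ sQ; have [||x xX xQ] := Xh Q => //; last by exists x; rewrite // in_setU1 xX orbT.
      by apply/subsetP=> w wQ; rewrite !inE; apply: contraNneq sQ => <-.
    move=> Q cQ; case: (boolP (s \in Q)) => sQ; first by exists s; rewrite // in_setU1 eqxx.
    case/orP: cQ => [/hit|nQ]; first exact.
    (* Here [~: Q] is a module containing [s]. Its vertices see each element of [Q] as [s] does, and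
       [s] sees them all alike, so [Q] is a module too. It is no singleton, since [s] is the only
       extreme vertex. *)
    case/and3P: nQ => mQ Q1 QT; apply: hit => //.
    have mQ' : modin e setT Q.
      apply: modT => x y v xQ yQ vQ.
      have vN : v \in ~: Q by rewrite inE.
      have xs' w : w \in Q -> w != s by move=> wQ; apply: contraNneq sQ => <-.
      have E w : w \in Q -> e v w = e s w.
        move=> wQ; apply: (modin_eq' te mQ); rewrite ?inE // negbK //.
      by rewrite !E //; apply: (ntm_eq xs); rewrite !inE ?eqxx ?xs'.
    apply: ntmI => //; last by apply: contraNneq sQ => ->; rewrite inE.
    rewrite ltnNge; apply/negP=> Q1'; case/negP: QT.
    case: (set_0Vmem Q) => [->|[q qQ]]; first by rewrite setC0.
    have EQ : Q = [set q] by apply/eqP; rewrite eq_sym eqEcard sub1set qQ cards1.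
    by case/negP: sQ; rewrite EQ inE (only q) // /extreme -EQ.
have [r [rI rint _]] := factorizing_order te [set: V].
have [|||X [b [[Xb Xd Xh] nX]]] := @packing_exists _ e r setT set0.
- by move=> x y; apply: rI; rewrite inE.
- by move=> M x y z mM xM zM; apply: rint mM xM zM _; rewrite inE.
- by move=> z; rewrite inE.
rewrite set0U in nX.
have Xh' Q : ntm Q -> exists2 x, x \in X & x \in Q by move=> nQ; apply: Xh.
have Xb' x : x \in X -> x \in b x by case/Xb.
case: (boolP [exists N : {set V}, ntm N && (X \subset N)]) => [exN|/existsPn noN]; last first.
  exists X, b; split=> //; first by move=> x /Xb[_ mx _]; constructor 1.
  move=> Q /orP[/Xh'//|nQ]; have := noN (~: Q); rewrite nQ /= => /subsetPn[x xX].
  by rewrite inE negbK; exists x.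
have [N0 N0P] := existsP exN.
case: (@arg_maxnP _ N0 [pred N : {set V} | ntm N && (X \subset N)] (fun A : {set V} => #|A|) N0P).
move=> N /= /andP[nN XN] maxN.
have mN := ntm_mod nN.
have [x1 x1X _] := Xh' _ nN.
have card1C A : A != set0 -> A != setT -> modin e setT A -> modin e setT (~: A) -> ntm A.
  move=> A0 AT mA mC; apply: ntmI => //; rewrite ltnNge; apply/negP=> A1.
  have [a aA] := set0Pn _ A0.
  have EA : A = [set a] by apply/eqP; rewrite eq_sym eqEcard sub1set aA cards1.
  by have := nox a; rewrite /extreme -EA mC.
have initC A : initial e setT A -> modin e setT (~: A).
  by move=> /initial_modC; rewrite setTD.
(* A proper nonempty initial set [A] and its complement would be nontrivial modules, both met by [X]
   and hence by [N]. A vertex outside [N] then makes [A :\: N] or the complement of [A :|: N] a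
   nontrivial module that misses [X]. *)
have strong A : initial e setT A -> A = set0 \/ A = setT.
  move=> iA; have [->|A0] := eqVneq A set0; [by left | right].
  apply/eqP/negPn/negP=> AT.
  have AC0 : ~: A != set0 by rewrite -setCT (inj_eq (@setC_inj _)).
  have ACT : ~: A != setT by rewrite -setC0 (inj_eq (@setC_inj _)).
  have nA := card1C A A0 AT (initial_mod te iA) (initC A iA).
  have nC : ntm (~: A).
    by apply: card1C; rewrite ?setCK ?initC // (initial_mod te).
  have [_ HA] := initialP _ _ _ iA.
  have [a aX aA] := Xh' _ nA; have [c cX cA] := Xh' _ nC.
  have aN := subsetP XN _ aX; have cN := subsetP XN _ cX; rewrite inE in cA.
  case/and3P: (nN) => _ _ /eqP NT; case: NT; apply/setP=> v; rewrite [in RHS]inE.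
  apply/negPn/negP=> vN; case: (boolP (v \in A)) => vA.
    have iAN : initial e setT (A :\: N).
      apply/initialP; split; rewrite ?subsetT // => x y; rewrite !inE => /andP[xN xA] _.
      rewrite negb_and negbK; case: (boolP (y \in A)) => yA; last by rewrite HA ?inE.
      by rewrite orbF => yN; rewrite (ntm_eq mN yN cN xN) HA ?inE.
    have [|x xX] := Xh' (A :\: N).
      apply: card1C; [| | exact: (initial_mod te) | exact: initC].
        by apply/set0Pn; exists v; rewrite inE vN.
      by apply/eqP=> /setP/(_ a); rewrite !inE aN.
    by rewrite inE (subsetP XN).
  have iAN : initial e setT (A :|: N).
    apply/initialP; split; rewrite ?subsetT // => x y; rewrite !inE negb_or => xAN _ /andP[yA yN].
    case/orP: xAN => [xA|xN]; first by rewrite HA ?inE.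
    by rewrite (modin_eq' te mN xN aN _ yN) ?inE ?HA ?inE.
  have [|x xX] := Xh' (~: (A :|: N)).
    apply: card1C; [| | exact: initC | by rewrite setCK; exact: (initial_mod te)].
      by apply/set0Pn; exists v; rewrite !inE negb_or vA.
    by apply/eqP=> /setP/(_ a); rewrite !inE aN orbT.
  by rewrite !inE (subsetP XN) ?orbT.
have maxN' M z : modin e setT M -> z \in M -> z \in N -> M \subset N \/ M = setT.
  move=> mM zM zN; case: (boolP (M \subset N)) => [|/subsetPn[m mM1 mN1]]; first by left.
  right; have mU := modinU mM mN zM zN.
  have UT : M :|: N = setT.
    apply/eqP/negPn/negP=> UT.
    have prU : N \proper M :|: N.
      by apply/properP; split; [exact: subsetUr | exists m; rewrite // inE mM1].
    have nU : ntm (M :|: N) && (X \subset M :|: N).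
      rewrite ntmI //; first exact: subset_trans (subsetUr _ _).
      by case/and3P: nN => _ N1 _; apply: leq_trans N1 (subset_leq_card (proper_sub prU)).
    by have := maxN _ nU; rewrite leqNgt proper_card.
  case: (boolP (N \subset M)) => [/setUidPl<-//|/subsetPn[k kN kM]].
  have [A [iA A0 AT]] := cover_initial te mM mN UT mM1 mN1 kN kM zM zN.
  by case: (strong A iA) => E; rewrite E eqxx in A0 AT.
have bN x : x \in X -> b x \subset N.
  move=> xX; have [xb /minmodP[nb _] _] := Xb x xX.
  case: (maxN' (b x) x (ntm_mod nb) xb (subsetP XN _ xX)) => // E.
  by case/and3P: nb => _ _; rewrite E eqxx.
have [x0 x0N] : exists x0, x0 \notin N.
  case/and3P: nN => _ _; rewrite -subTset => /subsetPn[x0 _ x0N]; by exists x0.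
have CN1 : 1 < #|~: N|.
  rewrite ltnNge; apply/negP=> C1; have := nox x0; rewrite /extreme.
  suff -> : [set x0] = ~: N by rewrite setCK mN.
  by apply/eqP; rewrite eqEcard sub1set inE x0N cards1.
have x0X x : x \in X -> x != x0 by move=> xX; apply: contraNneq x0N => <-; apply: (subsetP XN).
pose b' x := if x == x0 then ~: N else b x.
have b'X x : x \in X -> b' x = b x by move/x0X; rewrite /b' => /negbTE->.
exists (x0 |: X), b'; split.
- move=> x; rewrite in_setU1 => /orP[/eqP->|xX]; first by rewrite /b' eqxx inE.
  by rewrite b'X ?Xb'.
- move=> x; rewrite in_setU1 => /orP[/eqP->|xX]; last first.
    by constructor 1; rewrite b'X //; case: (Xb x xX).
  constructor 3; rewrite /outer {1 2 4 5}/b' eqxx setCK; split=> //.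
  + move=> y; rewrite in_setU1 => /orP[->//|yX] _; rewrite b'X //; by case: (Xb y yX).
  + move=> Q /Xh'[y yX yQ]; exists y; rewrite in_setU1 yX orbT; split=> //; exact: x0X.
  + move=> M mM NM; case: (maxN' M x1 mM) => //; rewrite ?(subsetP NM) ?(subsetP XN) //.
      by move=> MN; left; apply/eqP; rewrite eqEsubset MN.
    by right.
- have dis x : x \in X -> [disjoint ~: N & b x].
    by move=> xX; rewrite disjoint_sym disjoints_subset setCK bN.
  move=> x y; rewrite !in_setU1 => /orP[/eqP->|xX] /orP[/eqP->|yX].
  + by rewrite eqxx.
  + by rewrite (b'X y) // /b' eqxx => _; apply: dis.
  + by rewrite (b'X x) // /b' eqxx disjoint_sym => _; apply: dis.
  + by rewrite !b'X //; apply: Xd.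
- move=> Q; case: (boolP (x0 \in Q)) => x0Q; first by exists x0; rewrite // in_setU1 eqxx.
  case/orP=> [/Xh'[x xX xQ]|nQ]; first by exists x; rewrite // in_setU1 xX orbT.
  case: (boolP (X \subset ~: Q)) => [XQ|/subsetPn[x xX]]; last first.
    by rewrite inE negbK; exists x; rewrite // in_setU1 xX orbT.
  have x1Q := subsetP XQ _ x1X; have x1N := subsetP XN _ x1X.
  case: (maxN' (~: Q) x1 (ntm_mod nQ) x1Q x1N) => [/subsetP/(_ x0)|E].
    by rewrite inE x0Q (negbTE x0N) => /(_ isT).
  by case/and3P: nQ => _ _; rewrite E eqxx.
(* The pair [{x0, x}] meets [N] without lying in it, so it would be the whole vertex set. *)
- have key x : x \in X -> ~~ modin e setT [set x0; x].
    move=> xX; apply/negP=> m; have xN := subsetP XN _ xX.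
    case: (maxN' [set x0; x] x m) => //; first by rewrite !inE eqxx orbT.
      by move/subsetP/(_ x0); rewrite !inE eqxx (negbTE x0N) => /(_ isT).
    move=> E; have : #|[set x0; x]| <= 2 by rewrite cards2; case: (_ != _).
    by rewrite E cardsT leqNgt V3.
  move=> x y; rewrite !in_setU1 => /orP[/eqP->|xX] /orP[/eqP->|yX].
  + by rewrite eqxx.
  + by move=> _; apply: key.
  + by move=> _; rewrite setUC; apply: key.
  + exact: nX.
Qed.

End Systems.

(** * Reversals along a graph on a transversal *)

Section Switch.

Variables (V : finType) (e : rel V).
Hypothesis te : tour e.
Implicit Types (M N Q : {set V}).

Notation ntm := (ntmod e setT).
Notation minmod := (minmod e).
Notation md := (modin e setT).

Definition switch (g : rel V) : rel V := fun x y => e x y (+) g x y.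

Variables (X : {set V}) (b : V -> {set V}).
Hypothesis sysX : sys e X b.

Variable g : rel V.
Hypothesis gsym : symmetric g.
Hypothesis girr : irreflexive g.
Hypothesis gX : forall x y, g x y -> x \in X.
Hypothesis gnbr : forall x, x \in X -> exists y, g x y.
Hypothesis gcut : forall N, ntm N -> exists x y, [/\ x \in N, y \notin N & g x y].
(** Vacuous for the complete graph on [X]; in the graph on ranks, [y] lies between [x] and [z] in an
    order that makes modules intervals. *)
Hypothesis gpath : forall x y z N, g x y -> g y z -> x != z -> ~~ g x z ->
  md N -> x \in N -> z \in N -> y \in N.

(** Arises from a bad module [{a, m}], where [c] is the only neighbour of [a] and [m] is another
    element of the block of [c]. *)
Definition pendant_block := exists a c,
  [/\ a \in X, c \in X, g a c, forall y, g a y -> y = c &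
      [/\ minmod (b c), md (a |: b c) & 2 < #|b c|]].

(** The maximal module [~: b x0] is then a pair of twins. *)
Definition outer_pair := exists x0 c n,
  [/\ x0 \in X, outer e X b x0, c != n, ~: b x0 = [set c; n] & X = [set x0; c]].

Let Xb x : x \in X -> x \in b x. Proof. by case: sysX => H _ _ _ _; apply: H. Qed.
Let Xk x : x \in X -> block e X b x. Proof. by case: sysX => _ H _ _ _; apply: H. Qed.
Let Xd : disjfam X b. Proof. by case: sysX. Qed.
Let Xtw : notwins e X. Proof. by case: sysX. Qed.

Let gX' x y : g x y -> y \in X. Proof. by rewrite gsym => /gX. Qed.

Let b_uniq x y w : x \in X -> y \in X -> w \in b x -> w \in b y -> x = y.
Proof.
move=> xX yX wx wy; apply/eqP/negPn/negP=> xy.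
by rewrite (disjointFr (Xd xX yX xy) wx) in wy.
Qed.

Let bX x y : x \in X -> y \in X -> y \in b x -> y = x.
Proof. by move=> xX yX yx; apply: b_uniq (Xb yX) yx. Qed.

Let bNX x w : x \in X -> w \in b x -> w != x -> w \notin X.
Proof. by move=> xX wx; apply: contra => wX; rewrite (bX xX wX wx). Qed.

Let gNX x y : y \notin X -> g x y = false.
Proof. by move=> yX; apply/negP=> /gX'; apply/negP. Qed.

Let gNX' x y : x \notin X -> g x y = false.
Proof. by move=> xX; apply/negP=> /gX; apply/negP. Qed.

Let regular_other x : minmod (b x) -> exists2 w, w \in b x & w != x.
Proof. by case/minmodP=> /and3P[_ c1 _] _; apply: card2_ex. Qed.

Let regular_mod x : minmod (b x) -> md (b x). Proof. by case/minmodP=> /ntm_mod. Qed.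

Section BadModule.

Variable M : {set V}.
Hypothesis nM : ntmod (switch g) setT M.

Let same v x y : v \notin M -> x \in M -> y \in M -> g v x = g v y -> e v x = e v y.
Proof.
move=> vM xM yM gE; have := ntm_eq (ntm_mod nM) xM yM vM.
by rewrite /switch gE; apply: addIb.
Qed.

Let diff v x y : v \notin M -> x \in M -> y \in M -> g v x -> ~~ g v y -> e v x = ~~ e v y.
Proof.
move=> vM xM yM gx /negbTE gy; have := ntm_eq (ntm_mod nM) xM yM vM.
by rewrite /switch gx gy addbF addbT => <-; rewrite negbK.
Qed.

(** In T, [c] sees the whole block of [a] alike; the reversal changes its arc to [a] but not its arc
    to [w], which is outside [X]. *)
Let regular_out a c w : a \in X -> minmod (b a) -> a \in M -> g a c -> c \notin M ->
  w \in b a -> w != a -> w \notin M.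
Proof.
move=> aX ra aM gac cM wb wa; apply/negP=> wM.
have cb : c \notin b a.
  by apply/negP=> cb; move: cM; rewrite (bX aX (gX' gac) cb) aM.
have := diff cM aM wM; rewrite gsym gac gNX ?(bNX aX wb) // => /(_ isT isT).
by rewrite (ntm_eq (regular_mod ra) (Xb aX) wb cb); case: (e c w).
Qed.

Let regular_unif a c : a \in X -> minmod (b a) -> a \in M -> g a c -> c \notin M ->
  exists o, forall m, m \in M -> m != a -> e a m = o.
Proof.
move=> aX ra aM gac cM; have [w wb wa] := regular_other ra.
have wM := regular_out aX ra aM gac cM wb wa.
exists (e w a) => m mM ma.
have mb : m \notin b a by apply: contraL mM => mb; apply: (regular_out aX ra aM gac cM).
rewrite (modin_eq' te (regular_mod ra) (Xb aX) wb (in_setT m) mb).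
by apply: same; rewrite // !gNX' ?(bNX aX wb).
Qed.

(** If [x0] is the only vertex of its block in [M], adding it to [N = ~: b x0] yields a module,
    against maximality. Otherwise [M] contains a second one, [w]; every vertex of [N] tells [x0]
    from [w], so those outside [M] must be neighbours of [x0], and this leaves only an [N] of size
    two. *)
Let outer_bad x0 c : x0 \in X -> outer e X b x0 -> x0 \in M -> g x0 c -> c \notin M ->
  outer_pair.
Proof.
move=> x0X /[dup] ox0 [nN b1 oreg ohit omax] x0M g0c cM.
pose N := ~: b x0; have mN : md N := ntm_mod nN.
have NX y : y \in X -> y != x0 -> y \in N.
  by move=> yX; rewrite inE; apply: contra => yb; rewrite (bX x0X yX yb).
have x0N : x0 \notin N by rewrite inE negbK Xb.
have cX := gX' g0c; have cx0 : c != x0 by apply: contraNneq cM => ->.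
have cN := NX c cX cx0.
have XN x : x \in b x0 -> x \notin N by rewrite inE negbK.
case: (boolP [exists w, [&& w \in b x0, w \in M & w != x0]]); last first.
  move=> /existsPn no; have no' w : w \in b x0 -> w != x0 -> w \notin M.
    by move=> wb wx; have := no w; rewrite wb wx andbT.
  have [m mM mx0] := ntm_card x0 nM.
  have mN1 : m \in N by rewrite inE; apply: contraL mM => mb; apply: no'.
  have mU : md (x0 |: N).
    have H x v : x \in x0 |: N -> v \notin x0 |: N -> e v x = e v x0.
      rewrite !in_setU1 negb_or => /orP[/eqP->//|xN] /andP[vx0 vN].
      have vb : v \in b x0 by move: vN; rewrite inE negbK.
      rewrite (ntm_eq mN xN mN1 vN); apply: same => //; first exact: no'.
      by rewrite !gNX' ?(bNX x0X vb).
    by apply: modT => x y v xU yU vU; rewrite (H x) ?(H y).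
  have [w wb wx0] := card2_ex x0 b1.
  case: (omax _ mU); first exact: subsetUr.
    by move/setP/(_ x0); rewrite in_setU1 eqxx (negbTE x0N).
  by move/setP/(_ w); rewrite in_setU1 (negbTE wx0) (negbTE (XN w wb)) inE.
move=> /existsP[w /and3P[wb wM wx0]].
have wX := bNX x0X wb wx0.
have Nsplit n : n \in N -> e n x0 = ~~ e n w.
  move=> nN'; rewrite (modin_eq' te mN nN' cN (in_setT _) x0N).
  rewrite (modin_eq' te mN nN' cN (in_setT _) (XN w wb)).
  by apply: diff => //; [rewrite gsym | rewrite gNX].
have NMg n : n \in N -> n \notin M -> g n x0.
  move=> nN' nM'; apply/negPn/negP=> gn.
  have : e n x0 = e n w by apply: same; rewrite // (negbTE gn) gNX.
  by rewrite Nsplit //; case: (e n w).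
have bN y : y \in X -> y != x0 -> b y \subset N.
  move=> yX yx0; apply/subsetP=> u ub; rewrite inE; apply/negP=> ub0.
  by rewrite (b_uniq yX x0X ub ub0) eqxx in yx0.
have inner a y : a \in M -> a != x0 -> g a y -> y \in M.
  move=> aM ax0 gay; apply/negPn/negP=> yM; have aX := gX gay.
  have ra := oreg a aX ax0; have [u ub ua] := regular_other ra.
  have uM := regular_out aX ra aM gay yM ub ua.
  by have := gX (NMg u (subsetP (bN a aX ax0) u ub) uM); rewrite (negbTE (bNX aX ub ua)).
have inner' v x : v \notin M -> x \in M -> x != x0 -> g v x = false.
  by move=> vM xM xx0; apply/negP; rewrite gsym => /inner; rewrite (negbTE vM) => /(_ xM xx0).
have Nx0 x : x \in N -> x != x0 by move=> xN; apply: contraNneq x0N => <-.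
have mNM : md (N :&: M).
  apply: modT => x y v; rewrite !in_setI => /andP[xN xM] /andP[yN yM].
  rewrite negb_and; case: (boolP (v \in N)) => /= [vN vM|vN _]; last exact: (ntm_eq mN).
  by apply: same; rewrite // !inner' ?Nx0.
have reg_in y : y \in X -> y \in N -> exists u, [/\ u \in b y, u != y & u \in N :&: M].
  move=> yX yN; have yx0 := Nx0 y yN; have [u ub uy] := regular_other (oreg y yX yx0).
  have uN := subsetP (bN y yX yx0) u ub; exists u; split; rewrite // inE uN.
  by apply/negPn/negP=> /(NMg u uN)/gX; rewrite (negbTE (bNX yX ub uy)).
case: (ltnP 1 #|N :&: M|) => [NM1|/card_le1_eqP NM1].
  (* An edge leaving this module must end in [x0]; then [x], [x0], [c] is an induced path with ends
     in [N] and middle outside. *)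
  have nNM : ntm (N :&: M).
    by apply: ntmI => //; apply: contraNneq cM => NMT; move: (in_setT c); rewrite -NMT => /setIP[].
  have [x [y [/setIP[xN xM] yNM gxy]]] := gcut nNM.
  have yM := inner x y xM (Nx0 x xN) gxy.
  have yx0 : y = x0.
    apply/eqP/negPn/negP=> yx0; case/negP: yNM; rewrite inE yM andbT.
    exact: NX (gX' gxy) yx0.
  rewrite yx0 in gxy; case/negP: x0N; apply: (gpath gxy g0c _ _ mN xN cN).
    by apply: contraNneq cM => <-.
  by rewrite gsym inner' ?Nx0.
have [u [ub uc uNM]] := reg_in c cX cN.
have cu : forall v, v \in N -> v \notin M -> v = c.
  move=> v vN vM; have vX := gX (NMg v vN vM).
  have [u' [u'b _ u'NM]] := reg_in v vX vN.
  by apply: (b_uniq vX cX u'b); rewrite (NM1 u u').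
exists x0, c, u; split=> //; first by rewrite eq_sym.
  apply/setP=> v; rewrite -/N in_set2; apply/idP/orP=> [vN|[]/eqP->//]; last by case/setIP: uNM.
  case: (boolP (v \in M)) => vM; last by left; rewrite (cu v).
  by right; rewrite (NM1 u v) // inE vN.
apply/setP=> v; rewrite in_set2; apply/idP/orP=> [vX|[]/eqP->//].
have [->|vx0] := eqVneq v x0; [by left | right].
case: (boolP (v \in M)) => vM; last by rewrite (cu v) // NX.
have vNM : v \in N :&: M by rewrite inE vM NX.
by move: vX; rewrite (NM1 u v uNM vNM) (negbTE (bNX cX ub uc)).
Qed.

Lemma bad_module : pendant_block \/ outer_pair.
Proof.
have [_ M1 MT] := and3P nM.
pose A := [set a in M | [exists c, g a c && (c \notin M)]].
have AP a : a \in A -> [/\ a \in M, a \in X & exists2 c, g a c & c \notin M].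
  by rewrite inE => /andP[aM /existsP[c /andP[gac cM]]]; split=> //; [apply: gX gac | exists c].
have NA x c : x \in M -> x \notin A -> g x c -> c \in M.
  move=> xM; rewrite inE xM => /existsPn/(_ c); rewrite negb_and negbK.
  by case/orP=> // /negbTE->.
case: (boolP [exists x0, (x0 \in A) && ~~ minmod (b x0) && ~~ ((b x0 == [set x0]) && extreme e x0)]).
  move=> /existsP[x0 /andP[/andP[x0A nr] nx]]; right.
  have [x0M x0X [c g0c cM]] := AP _ x0A.
  case: (Xk x0X) nr nx => [->//|[-> ->]|ox0 _ _]; first by rewrite eqxx.
  exact: outer_bad ox0 x0M g0c cM.
move=> /existsPn noA.
have ext_unif a : extreme e a -> forall x y, x != a -> y != a -> e a x = e a y.
  by move=> xa x y xa' ya'; apply: (ntm_eq xa); rewrite !inE ?eqxx.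
have Aunif a : a \in A -> exists o, forall m, m \in M -> m != a -> e a m = o.
  move=> aA; have [aM aX [c gac cM]] := AP a aA; have := noA a; rewrite aA /= -negb_or negbK.
  case/orP=> [ra|/andP[_ xa]]; first exact: regular_unif gac cM.
  have [m mM ma] := card2_ex a M1; exists (e a m) => x xM xa'; exact: ext_unif.
pose M' := M :\: A.
have M'P x : x \in M' -> x \in M /\ x \notin A by rewrite inE => /andP[].
have gout x v : x \in M' -> v \notin M -> g v x = false.
  by move=> /M'P[xM xA] vM; apply/negP; rewrite gsym => /(NA x v xM xA); apply/negP.
have modM' : md M'.
  apply: modT => x y v /[dup] xM' /M'P[xM xA] /[dup] yM' /M'P[yM yA] vM'.
  case: (boolP (v \in M)) => vM; last by apply: same; rewrite // !gout.
  have vA : v \in A by move: vM'; rewrite inE vM andbT negbK.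
  have [o Ho] := Aunif v vA.
  by rewrite !Ho //; [apply: contraNneq yA => -> | apply: contraNneq xA => ->].
(* For an outside neighbour [z] of [y], the path [x], [y], [z] is induced, and [z] tells [x] from
   [y] in T. This excludes an extreme or outer [z]. If the block of [z] is minimal, its other
   elements also tell them apart, so they lie in [M'], and [M'] together with the block is a module
   that contains both ends of the path but not [y]. *)
have noedge x y : x \in M' -> y \in A -> ~~ g x y.
  move=> /[dup] xM' /M'P[xM xA] /AP[yM yX [z gyz zM]]; apply/negP=> gxy.
  have xX := gX gxy; have zX := gX' gyz.
  have zx : x != z by apply: contraNneq zM => <-.
  have zy : y != z by apply: contraNneq zM => <-.
  have E : e z y = ~~ e z x by apply: diff => //; [rewrite gsym | rewrite gout].
  have xb : x \notin b z by apply/negP=> /(bX zX xX)/eqP; apply/negP.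
  have yb : y \notin b z by apply/negP=> /(bX zX yX)/eqP; apply/negP.
  case: (Xk zX) => [rz|[_ xz]|[/ntm_mod mN _ _ _ _]].
  - have z'M' w : w \in b z -> w != z -> w \in M'.
      move=> wb wz; have wX := bNX zX wb wz.
      have wM : w \in M.
        apply/negPn/negP=> wM; have : e w x = e w y by apply: same; rewrite // !gNX'.
        rewrite (modin_eq' te (regular_mod rz) wb (Xb zX) (in_setT x) xb).
        rewrite (modin_eq' te (regular_mod rz) wb (Xb zX) (in_setT y) yb) E.
        by case: (e z x).
      by rewrite inE wM andbT; apply: contra wX => /AP[].
    have [w wb wz] := regular_other rz.
    have mU := modinU modM' (regular_mod rz) (z'M' w wb wz) wb.
    have := gpath gxy gyz zx _ mU; rewrite !in_setU xM' (Xb zX) orbT (negbTE yb) orbF.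
    rewrite gsym gout // => /(_ isT isT isT) /M'P[_].
    by rewrite inE yM /= => /existsPn/(_ z); rewrite gyz zM.
  - by have := ext_unif z xz x y zx zy; rewrite E; case: (e z x).
  - have := ntm_eq mN (x := x) (y := y) (v := z); rewrite !in_setC xb yb (Xb zX).
    by move=> /(_ isT isT isT); rewrite E; case: (e z x).
have M'1 : #|M'| <= 1.
  rewrite leqNgt; apply/negP=> M'1.
  have nM' : ntm M'.
    apply: ntmI => //; apply: contraNneq MT => M'T; rewrite -subTset -M'T; exact: subsetDl.
  have [x [y [xM' yM' gxy]]] := gcut nM'; have [xM xA] := M'P x xM'.
  have yM := NA x y xM xA gxy.
  have yA : y \in A by move: yM'; rewrite inE yM andbT negbK.
  by case/negP: (noedge x y xM' yA).
have AM a : a \in A -> a \in M by case/AP.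
have ne a m : m \notin A -> a \in A -> m != a by move=> mA aA; apply: contraNneq mA => ->.
have sides a1 a2 : a1 \in A -> a2 \in A -> a1 != a2 ->
    forall m, m \in M -> m != a1 -> m != a2 -> e a1 m = ~~ e a2 m.
  move=> A1 A2 a12 m mM m1 m2; have [o1 H1] := Aunif a1 A1; have [o2 H2] := Aunif a2 A2.
  rewrite H1 // H2 //; rewrite -(H1 a2) ?AM // 1?eq_sym // -(H2 a1) ?AM //.
  by rewrite te.
have A2 a1 a2 a3 : a1 \in A -> a2 \in A -> a3 \in A -> a1 != a2 -> a3 != a1 -> a3 = a2.
  move=> A1 A2 A3 a12 a31; apply/eqP/negPn/negP=> a32.
  have [a21 a13 a23] : [/\ a2 != a1, a1 != a3 & a2 != a3] by split; rewrite eq_sym.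
  have [o1 H1] := Aunif a1 A1; have [o2 H2] := Aunif a2 A2; have [o3 H3] := Aunif a3 A3.
  have := H1 a2 (AM _ A2) a21; have := H1 a3 (AM _ A3) a31.
  have := H2 a1 (AM _ A1) a12; have := H2 a3 (AM _ A3) a32.
  have := H3 a1 (AM _ A1) a13; have := H3 a2 (AM _ A2) a23.
  rewrite (te a12) (te a31) (te a32).
  by case: (e a2 a1); case: (e a1 a3); case: (e a2 a3) => /= *; congruence.
case: (set_0Vmem M') => [M'0|[m mM']].
  have MA x : x \in M -> x \in A.
    move=> xM; apply/negPn/negP=> xA; have xM' : x \in M' by rewrite inE xA.
    by rewrite M'0 inE in xM'.
  have [a1 [a2 [m1 m2 a12]]] := card_gt1P M1.
  have [A1 A2'] := (MA _ m1, MA _ m2).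
  have [_ X1 _] := AP _ A1; have [_ X2 _] := AP _ A2'.
  have Meq x : x \in M -> x = a1 \/ x = a2.
    move=> xM; have [->|x1] := eqVneq x a1; [by left | right].
    exact: (A2 a1 a2 x A1 A2' (MA _ xM)).
  (* [M] consists of two vertices of [X], which would be twins in T: a vertex joined to only one of
     them sees them alike because of its own block. *)
  exfalso; case/negP: (Xtw X1 X2 a12); apply: modT.
  suff H v : v \notin [set a1; a2] -> e v a1 = e v a2.
    by move=> x y v; rewrite in_set2 => /orP[]/eqP->; rewrite in_set2 => /orP[]/eqP-> /H.
  rewrite in_set2 negb_or => /andP[v1 v2].
  have vM : v \notin M by apply/negP=> /Meq[]/eqP; apply/negP.
  have [gE|gE] := eqVneq (g v a1) (g v a2); first exact: same.
  have vX : v \in X by apply/negPn/negP=> vX; rewrite !gNX' // in gE.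
  have b1 : a1 \notin b v by apply/negP=> /(bX vX X1) E; rewrite E eqxx in v1.
  have b2 : a2 \notin b v by apply/negP=> /(bX vX X2) E; rewrite E eqxx in v2.
  case: (Xk vX) => [rv|[_ xv]|[/ntm_mod mN _ _ _ _]].
  - have [w wb wv] := regular_other rv; have wX := bNX vX wb wv.
    have wM : w \notin M by apply/negP=> /Meq[]E; rewrite E ?X1 ?X2 in wX.
    rewrite (modin_eq' te (regular_mod rv) (Xb vX) wb (in_setT _) b1).
    rewrite (modin_eq' te (regular_mod rv) (Xb vX) wb (in_setT _) b2).
    by apply: same; rewrite // !gNX'.
  - by apply: ext_unif => //; rewrite eq_sym.
  - by apply: (ntm_eq mN); rewrite !in_setC // Xb.
have [mM1 mA] := M'P m mM'.
have M'E x : x \in M -> x \notin A -> x = m.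
  by move=> xM xA; move/card_le1_eqP: M'1; apply; rewrite // inE xA.
have mX : m \notin X.
  apply/negP=> mX; have [y gmy] := gnbr mX; have yM := NA m y mM1 mA gmy.
  case: (boolP (y \in A)) => yA; first by rewrite (negbTE (noedge m y mM' yA)) in gmy.
  by move: gmy; rewrite (M'E y yM yA) girr.
(* The outside neighbour [c] tells [a] from [m] in T. A second point of a minimal block of [c] does
   so too, but its arcs are not reversed; so it lies in [M], where it can only be [m]. *)
have far a c : a \in A -> g a c -> c \notin M ->
    [/\ e c a = ~~ e c m, m \in b c & minmod (b c) \/ outer e X b c].
  move=> aA gac cM; have [aM aX _] := AP a aA; have cX := gX' gac.
  have E : e c a = ~~ e c m by apply: diff => //; [rewrite gsym | rewrite gNX].
  have ac : a != c by apply: contraNneq cM => <-.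
  have mc : m != c by apply: contraNneq cM => <-.
  have ab : a \notin b c by apply/negP=> /(bX cX aX)/eqP; apply/negP.
  split=> //; last first.
    case: (Xk cX) => [|[_ xc]|]; [by left | | by right].
    by have := ext_unif c xc a m ac mc; rewrite E; case: (e c m).
  apply/negPn/negP=> mb; case: (Xk cX) => [rc|[_ xc]|[/ntm_mod mN _ _ _ _]].
  - have [w wb wc] := regular_other rc; have wX := bNX cX wb wc.
    have wM : w \notin M.
      apply/negP=> wM; case: (boolP (w \in A)) => [/AP[_]|wA]; first by rewrite (negbTE wX).
      by move: wb; rewrite (M'E w wM wA) (negbTE mb).
    have : e w a = e w m by apply: same; rewrite // !gNX'.
    rewrite -(modin_eq' te (regular_mod rc) (Xb cX) wb (in_setT _) ab).
    rewrite -(modin_eq' te (regular_mod rc) (Xb cX) wb (in_setT _) mb) E.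
    by case: (e c m).
  - by have := ext_unif c xc a m ac mc; rewrite E; case: (e c m).
  - have := ntm_eq mN (x := a) (y := m) (v := c); rewrite !in_setC ab mb (Xb cX).
    by move=> /(_ isT isT isT); rewrite E; case: (e c m).
have [a0 aA] : exists a, a \in A.
  have [x xM xm] := card2_ex m M1; exists x; apply/negPn/negP=> xA.
  by rewrite (M'E x xM xA) eqxx in xm.
case: (boolP [exists a2, (a2 \in A) && (a2 != a0)]) => [/existsP[a2 /andP[aA2 a20]]|/existsPn noa2].
  (* Both outside neighbours have [m] in their block, so they are the same [c]. It sees [a0] and
     [a2] alike, whereas these see [m], and with it a minimal block of [c], oppositely. For an outer
     block, [m] itself sees them alike. *)
  exfalso; have a02 : a0 != a2 by rewrite eq_sym.
  have [aM aX [c gac cM]] := AP _ aA; have [aM2 aX2 [c2 gac2 cM2]] := AP _ aA2.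
  have [E1 mb1 k1] := far _ _ aA gac cM; have [E2 mb2 k2] := far _ _ aA2 gac2 cM2.
  have cX := gX' gac; have c2X := gX' gac2.
  have Ec := b_uniq cX c2X mb1 mb2; rewrite -{}Ec in gac2 cM2 E2 mb2 k2 c2X.
  have m0 := ne a0 m mA aA; have m2 := ne a2 m mA aA2.
  have S := sides a0 a2 aA aA2 a02 m mM1 m0 m2.
  have ac : a0 != c by apply: contraNneq cM => <-.
  have ac2 : a2 != c by apply: contraNneq cM => <-.
  have ab : a0 \notin b c by apply/negP=> /(bX cX aX)/eqP; apply/negP.
  have ab2 : a2 \notin b c by apply/negP=> /(bX cX aX2)/eqP; apply/negP.
  case: k1 => [rc|[/ntm_mod mN _ _ _ _]].
    have F1 := ntm_eq (regular_mod rc) (Xb cX) mb1 ab.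
    have F2 := ntm_eq (regular_mod rc) (Xb cX) mb1 ab2.
    move: E1 E2 F1 F2; rewrite (te ac) (te ac2) => E1 E2 F1 F2.
    move: S; rewrite -F1 -F2; move: E1 E2; rewrite (tourF te ac) (tourF te ac2).
    by case: (e a0 c); case: (e a2 c); case: (e c m).
  have := ntm_eq mN (x := a0) (y := a2) (v := m); rewrite !in_setC ab ab2 mb1.
  move=> /(_ isT isT isT); rewrite (te m0) (te m2) S.
  by case: (e a2 m).
have Aeq a : a \in A -> a = a0.
  by move=> aA'; have := noa2 a; rewrite aA' negbK => /eqP.
have Meq x : x \in M -> x = a0 \/ x = m.
  by move=> xM; case: (boolP (x \in A)) => [/Aeq|/(M'E x xM)]; [left | right].
have [aM aX [c gac cM]] := AP _ aA.
have anb y : g a0 y -> y \notin M.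
  move=> gay; apply/negP=> /Meq[]E; first by rewrite E girr in gay.
  by rewrite E gNX in gay.
have cX := gX' gac; have [E mb kc] := far _ _ aA gac cM.
have uniqc y : g a0 y -> y = c.
  move=> gay; have [_ mby _] := far _ _ aA gay (anb _ gay).
  exact: b_uniq (gX' gay) cX mby mb.
have ac : a0 != c by apply: contraNneq cM => <-.
have am : m != a0 := ne a0 m mA aA.
have mc : m != c by apply: contraNneq cM => <-.
have ab : a0 \notin b c by apply/negP=> /(bX cX aX)/eqP; apply/negP.
have sameM v : v \notin M -> v != c -> e v a0 = e v m.
  move=> vM vc; apply: same => //; rewrite (gNX _ mX); apply/negP; rewrite gsym => /uniqc/eqP.
  by apply/negP.
case: kc => [rc|oc].
  have mW : md (a0 |: b c).
    have H x v : x \in a0 |: b c -> v \notin a0 |: b c -> e v x = e v m.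
      rewrite !in_setU1 negb_or => /orP[/eqP->|xb] /andP[va vb]; last exact: (ntm_eq (regular_mod rc)).
      apply: sameM; last by apply: contraNneq vb => ->; apply: Xb.
      by apply/negP=> /Meq[]/eqP; [apply/negP | move/eqP=> Ev; rewrite Ev mb in vb].
    by apply: modT => x y v xW yW vW; rewrite (H x) ?(H y).
  (* If the block of [c] were just [{c, m}], the vertices [a0] and [c] of [X] would be twins. *)
  left; exists a0, c; split=> //; split=> //; rewrite ltnNge; apply/negP=> b2.
  have bE : b c = [set c; m].
    apply/esym/eqP; rewrite eqEcard cards2 eq_sym mc b2 andbT.
    by apply/subsetP=> w; rewrite in_set2 => /orP[]/eqP-> //; apply: Xb.
  case/negP: (Xtw aX cX ac); apply: modT.
  suff H v : v \notin [set a0; c] -> e v a0 = e v c.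
    by move=> x y v; rewrite in_set2 => /orP[]/eqP->; rewrite in_set2 => /orP[]/eqP-> /H.
  rewrite in_set2 negb_or => /andP[va vc].
  have [->|vm] := eqVneq v m.
    have F := ntm_eq (regular_mod rc) (Xb cX) mb ab.
    rewrite (te am) -F (te mc); move: E; rewrite (tourF te ac).
    by case: (e a0 c); case: (e c m).
  by apply: (ntm_eq mW); rewrite !inE ?eqxx ?(Xb cX) ?orbT // negb_or va bE in_set2 negb_or vc.
right; have [nN b1 oreg ohit omax] := oc.
pose N := ~: b c; have mN : md N := ntm_mod nN.
have aN : a0 \in N by rewrite inE.
have mN1 : m \notin N by rewrite inE negbK.
have cN : c \notin N by rewrite inE negbK Xb.
have Nunif n : n \in N -> n != a0 -> e a0 n = e m a0.
  move=> nN' na; have nm : n != m by apply: contraNneq mN1 => <-.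
  have nM' : n \notin M by apply/negP=> /Meq[]/eqP; apply/negP.
  have nc : n != c by apply: contraNneq cN => <-.
  have := sameM n nM' nc; rewrite (te na) (te nm) => /(can_inj negbK)->.
  exact: (ntm_eq mN).
have mNa : md (N :\ a0).
  apply: modT => x y v; rewrite !in_setD1 => /andP[xa xN] /andP[ya yN].
  have [->|va] := eqVneq v a0; first by rewrite !Nunif.
  by move=> vN; apply: (ntm_eq mN).
have NX y : y \in X -> y != c -> y \in N.
  by move=> yX; rewrite inE; apply: contra => yb; rewrite (bX cX yX yb).
(* An edge leaving the module [N :\ a0] must end in [c], and [x], [c], [a0] would be an induced path
   with ends in [N]. So [N] is a pair. *)
case: (ltnP 1 #|N :\ a0|) => [N1|/card_le1_eqP N1].
  have nNa : ntm (N :\ a0).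
    by apply: ntmI => //; apply/eqP=> /setP/(_ a0); rewrite !inE eqxx.
  have [x [y [/setD1P[xa xN] yN gxy]]] := gcut nNa.
  have gax : ~~ g x a0 by apply: contra cN; rewrite gsym => /uniqc<-.
  have ya : y != a0 by apply: contraNneq gax => <-.
  have yc : y = c.
    apply/eqP/negPn/negP=> yc; case/negP: yN; rewrite in_setD1 ya.
    exact: NX (gX' gxy) yc.
  case/negP: cN; rewrite yc in gxy; apply: (gpath gxy _ xa gax mN xN aN).
  by rewrite gsym.
have [n nN' na] : exists2 n, n \in N & n != a0 by apply: ntm_card nN.
have NE : ~: b c = [set a0; n].
  apply/setP=> v; rewrite -/N in_set2; apply/idP/orP=> [vN|[]/eqP-> //].
  have [->|va] := eqVneq v a0; [by left | right].
  by rewrite (N1 n v) // in_setD1 ?va ?na.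
have nb : n \in b a0.
  have ra := oreg a0 aX ac; have [w wb wa] := regular_other ra.
  suff <- : w = n by [].
  have : w \in ~: b c.
    by rewrite in_setC; apply/negP=> wc; rewrite (b_uniq aX cX wb wc) eqxx in ac.
  by rewrite NE in_set2 (negbTE wa) => /eqP.
exists c, a0, n; split=> //; first by rewrite eq_sym.
apply/setP=> v; rewrite in_set2; apply/idP/orP=> [vX|[]/eqP->//].
have [->|vc] := eqVneq v c; [by left | right].
have := NX v vX vc; rewrite -/N /N NE in_set2 => /orP[//|/eqP E'].
by move: (bNX aX nb na); rewrite -E' vX.
Qed.

End BadModule.

End Switch.

(** * The complete graph and the graph on ranks *)

Definition indec (V : finType) (e : rel V) := forall M, ~~ ntmod e setT M.

Definition clique (V : finType) (Y : {set V}) : rel V :=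
  fun x y => [&& x \in Y, y \in Y & x != y].

(** Undirected edges given as a list, whose length bounds the number of reversed arcs. *)
Definition link (V : eqType) (l : seq (V * V)) : rel V :=
  fun x y => ((x, y) \in l) || ((y, x) \in l).

Lemma link_sym (V : eqType) (l : seq (V * V)) : symmetric (link l).
Proof. by move=> x y; rewrite /link orbC. Qed.

Lemma half_bounds m : m./2 + m./2 <= m <= (m./2 + m./2).+1.
Proof. by rewrite addnn -{2 3}(odd_double_half m); case: (odd m); rewrite ?leqnn ?leqnSn. Qed.

Section Transversal.

Variables (V : finType) (e : rel V).
Hypothesis te : tour e.
Implicit Types (M N Q : {set V}).

Notation ntm := (ntmod e setT).
Notation md := (modin e setT).

Variables (X : {set V}) (b : V -> {set V}).
Hypothesis sysX : sys e X b.

Lemma sys_hit N : ntm N -> (exists2 x, x \in X & x \in N) /\ exists2 x, x \in X & x \notin N.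
Proof.
case: sysX => _ _ _ h _ nN; split; first by apply: h; rewrite /comod nN.
by case: (h (~: N)) => [|x xX]; [rewrite /comod setCK nN orbT | rewrite inE; exists x].
Qed.

(** Three vertices rule out both exceptions: every vertex has two neighbours, so none is pendant,
    and [outer_pair] leaves only two vertices in [X]. *)
Lemma clique_indec : 2 < #|X| -> indec (switch e (clique X)).
Proof.
move=> X3 M; apply/negP=> nM.
have csym : symmetric (clique X) by move=> x y; rewrite /clique eq_sym andbCA.
have cirr : irreflexive (clique X) by move=> x; rewrite /clique eqxx !andbF.
have cX x y : clique X x y -> x \in X by case/andP.
have third x y : exists z, [/\ z \in X, z != x & z != y].
  have : ~~ (X \subset [set x; y]).
    apply/negP=> /subset_leq_card; rewrite cards2 => le; have := leq_trans X3 le.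
    by case: (_ != _).
  by case/subsetPn=> z zX; rewrite in_set2 negb_or => /andP[zx zy]; exists z.
have cnbr x : x \in X -> exists y, clique X x y.
  by move=> xX; have [z [zX zx _]] := third x x; exists z; rewrite /clique xX zX eq_sym.
have ccut N : ntm N -> exists x y, [/\ x \in N, y \notin N & clique X x y].
  case/sys_hit=> -[x xX xN] [y yX yN]; exists x, y; split=> //.
  by rewrite /clique xX yX (mem_neq xN yN).
have cpath x y z N : clique X x y -> clique X y z -> x != z -> ~~ clique X x z ->
    md N -> x \in N -> z \in N -> y \in N.
  by case/and3P=> xX _ _ /and3P[_ zX _] xz; rewrite /clique xX zX xz.
have [] := bad_module te sysX csym cirr cX cnbr ccut cpath nM.
  case=> a [c [aX cX' gac uniq _]]; have [z [zX za zc]] := third a c.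
  by case/eqP: zc; apply: uniq; rewrite /clique aX zX eq_sym.
case=> x0 [c [n [_ _ _ _ EX]]]; have [z [zX zx zc]] := third x0 c.
by move: zX; rewrite EX in_set2 (negbTE zx) (negbTE zc).
Qed.

(** A module meets [X] in consecutive ranks, and a nonempty set of consecutive ranks closed under
    shifts by [k], half of [#|X|] rounded down, is everything; this yields the edge across each
    nontrivial module. No vertex is isolated, and the edges number [#|X| - k]. *)
Lemma rank_graph : 1 < #|X| -> exists l : seq (V * V),
  [/\ size l = uphalf #|X|, forall p, p \in l -> p.1 != p.2 &
      [\/ indec (switch e (link l)),
          #|X| <= 3 /\ pendant_block e X b (link l) | outer_pair e X b]].
Proof.
move=> X2; have [r [rI rint _]] := factorizing_order te [set: V].
have [x0 x0X] : exists x, x \in X by apply/card_gt0P; apply: leq_trans X2.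
pose s := sort (relpre r leq) (enum X).
set m := #|X| in X2 *; pose k := m./2.
have sm : size s = m by rewrite size_sort -cardE.
have su : uniq s by rewrite sort_uniq enum_uniq.
have smem x : (x \in s) = (x \in X) by rewrite mem_sort mem_enum.
pose el i := nth x0 s i.
have elX i : i < m -> el i \in X by move=> im; rewrite -smem mem_nth ?sm.
have elI i j : i < m -> j < m -> (el i == el j) = (i == j).
  by move=> im jm; rewrite nth_uniq ?sm.
have elE x : x \in X -> exists2 i, i < m & x = el i.
  by move=> xX; exists (index x s); rewrite /el ?nth_index ?smem // -sm index_mem smem.
have elr i j : i <= j -> j < m -> r (el i) <= r (el j).
  move=> ij jm; have im := leq_ltn_trans ij jm.
  apply: (@sorted_leq_nth _ (relpre r leq)); rewrite ?inE ?sm //.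
  - by move=> u v w /=; apply: leq_trans.
  - by move=> u /=.
  - by apply: sort_sorted => u v /=; apply: leq_total.
have elint N i j h : md N -> el i \in N -> el h \in N -> i <= j <= h -> h < m -> el j \in N.
  move=> mN iN hN /andP[ij jh] hm; apply: (rint N _ _ _ mN iN hN); rewrite ?inE //.
  by rewrite !elr // (leq_ltn_trans jh).
have mk := half_bounds m.
have k0 : 0 < k by rewrite /k half_gt0.
have [mk1 mk2] := andP mk; rewrite -/k in mk1 mk2.
pose l := [seq (el i, el (i + k)) | i <- iota 0 (m - k)].
have lP x y : reflect (exists i, [/\ i + k < m, x = el i & y = el (i + k)]) ((x, y) \in l).
  apply: (iffP mapP) => [[i]|[i [ik -> ->]]].
    by rewrite mem_iota add0n /= ltn_subRL addnC => ik [-> ->]; exists i.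
  by exists i; rewrite // mem_iota add0n /= ltn_subRL addnC.
have lk i j : i < m -> j < m -> link l (el i) (el j) = (j == i + k) || (i == j + k).
  move=> im jm; apply/idP/idP.
    case/orP=> /lP[h [hk /eqP + /eqP]]; rewrite !elI // ?(leq_ltn_trans (leq_addr k h)) //.
      by move=> /eqP-> ->.
    by move=> /eqP-> ->; rewrite orbT.
  case/orP=> /eqP E; apply/orP; [left | right]; apply/lP.
    by exists i; rewrite -E.
  by exists j; rewrite -E.
have gX x y : link l x y -> x \in X.
  case/orP=> /lP[i [ik Ex Ey]]; [rewrite Ex | rewrite Ey]; apply: elX => //.
  exact: leq_ltn_trans (leq_addr k i) ik.
have gidx x y : link l x y -> exists i j, [/\ i < m, j < m, x = el i, y = el j &
    (j == i + k) || (i == j + k)].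
  move=> gxy; have xX := gX _ _ gxy; have yX : y \in X by apply: (gX y x); rewrite link_sym.
  have [i im Ex] := elE x xX; have [j jm Ey] := elE y yX; exists i, j; split=> //.
  by rewrite -lk // -Ex -Ey.
have girr : irreflexive (link l).
  move=> x; apply/negP=> /[dup] gxx /gX /elE[i im Ex]; move: gxx.
  by rewrite Ex lk // orbb -{1}[i]addn0 eqn_add2l eq_sym -leqn0 leqNgt k0.
exists l; split.
- by rewrite size_map size_iota uphalf_half -[X in X - _](odd_double_half m) -addnn addnA addnK.
- move=> [x y] /lP[i [ik -> ->]] /=; rewrite elI //; last exact: leq_ltn_trans (leq_addr k i) ik.
  by rewrite -{1}[i]addn0 eqn_add2l eq_sym -lt0n.
have gnbr x : x \in X -> exists y, link l x y.
  move=> /elE[i im ->]; case: (ltnP (i + k) m) => ik.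
    by exists (el (i + k)); rewrite lk // eqxx.
  have ki : k <= i.
    rewrite leqNgt; apply/negP=> ki; have := leq_trans mk1 ik.
    by rewrite leq_add2r leqNgt ki.
  exists (el (i - k)); rewrite lk ?subnK ?eqxx ?orbT //.
  exact: leq_ltn_trans (leq_subr k i) im.
have gcut N : ntm N -> exists x y, [/\ x \in N, y \notin N & link l x y].
  move=> nN; have [[x xX xN] [y yX yN]] := sys_hit nN; have mN := ntm_mod nN.
  case: (boolP [exists u, exists v, [&& u \in N, v \notin N & link l u v]]).
    by move=> /existsP[u /existsP[v /and3P[? ? ?]]]; exists u, v.
  move=> /existsPn closed0.
  have closed i j : i < m -> j < m -> (j == i + k) || (i == j + k) -> el i \in N -> el j \in N.
    move=> im jm E iN; apply/negPn/negP=> jN; case/negP: (closed0 (el i)).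
    by apply/existsP; exists (el j); rewrite iN jN lk.
  have exlo : exists i, (i < m) && (el i \in N).
    by have [i im Ex] := elE x xX; exists i; rewrite im -Ex.
  case: (ex_minnP exlo) => lo /andP[lom loN] minlo.
  (* The least rank [lo] in [N] is below [k], so [lo + k] is in [N] too. If [lo] were positive, the
     rank [lo - 1 + k] would lie between them and bring in [lo - 1]. So ranks 0 to [k] are in [N],
     and shifting them reaches rank [2k], hence all of [X]. *)
  have lok : lo < k.
    rewrite ltnNge; apply/negP=> klo; have lt : lo - k < lo.
      by rewrite ltn_subrL k0 (leq_trans k0).
    have := minlo (lo - k); rewrite (ltn_trans lt lom) leqNgt lt /= => H.
    apply/notF/H/(closed lo) => //; first exact: ltn_trans lt lom.
    by rewrite subnK // eqxx orbT.
  have lokm : lo + k < m by apply: leq_trans mk1; rewrite ltn_add2r.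
  have lokN : el (lo + k) \in N by apply: (closed lo); rewrite ?eqxx.
  have lo0 : lo = 0.
    case: lo => [//|lo] in lom loN minlo lok lokm lokN *.
    have lt : lo < m by apply: ltnW.
    have ltk : lo + k < m by apply: ltn_trans lokm; rewrite ltn_add2r.
    have lN : el (lo + k) \in N.
      by apply: (elint N lo.+1 _ (lo.+1 + k)); rewrite // leq_add2r leqnSn andbT -addn1 leq_add2l.
    have := minlo lo; rewrite lt ltnn /= => H.
    by exfalso; apply/notF/H/(closed (lo + k)); rewrite // eqxx orbT.
  rewrite lo0 add0n in lokN loN lokm.
  have low j : j <= k -> el j \in N by move=> jk; apply: (elint N 0 j k).
  have all_in j : j < m -> el j \in N.
    move=> jm; case: (leqP j k) => [|kj]; first exact: low.
    have jk : j - k <= k.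
      by rewrite leq_subLR -ltnS; apply: leq_trans jm mk2.
    apply: (closed (j - k)); rewrite ?low ?subnK ?eqxx ?(ltnW kj) //.
    exact: leq_ltn_trans (leq_subr k j) jm.
  by have [j jm Ey] := elE y yX; rewrite Ey all_in in yN.
have gpath x y z N : link l x y -> link l y z -> x != z -> md N -> x \in N -> z \in N -> y \in N.
  move=> /gidx[i [j [im jm -> -> ij]]] /gidx[j' [h [j'm hm + -> jh]]].
  move/eqP; rewrite !elI // => /eqP Ej ih mN iN hN; rewrite -{j' j'm}Ej in jh.
  case/orP: ij => /eqP E1; case/orP: jh => /eqP E2.
  - by apply: (elint N i j h); rewrite // E2 E1 !leq_addr.
  - by case/eqP: ih; apply: (@addIn k); rewrite -E1.
  - by case/eqP: ih; rewrite E1 E2.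
  - by apply: (elint N h j i); rewrite // E1 E2 !leq_addr.
case: (boolP [exists M, ntmod (switch e (link l)) setT M]) => [/existsP[M nM]|/existsPn noM].
  have gpath' x y z N : link l x y -> link l y z -> x != z -> ~~ link l x z ->
    md N -> x \in N -> z \in N -> y \in N by move=> ? ? ? _; apply: gpath.
  have [pb|] := bad_module te sysX (@link_sym _ l) girr gX gnbr gcut gpath' nM; last first.
    by constructor 3.
  constructor 2; split=> //; case: pb => a [c [aX cX gac uniq [_ mW b3]]].
  case: sysX => Xb Xk Xd Xh Xtw.
  have WX y : y \in X -> y \in a |: b c -> y = a \/ y = c.
    move=> yX; rewrite in_setU1 => /orP[/eqP|yb]; [by left | right].
    apply/eqP/negPn/negP=> yc; by rewrite (disjointFr (Xd _ _ yX cX yc) (Xb y yX)) in yb.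
  rewrite leqNgt; apply/negP=> m4.
  have nW : ntm (a |: b c).
    apply: ntmI => //.
      by apply: leq_trans (ltnW b3) (subset_leq_card (subsetUr _ _)).
    apply/eqP=> WT; have : X \subset [set a; c].
      by apply/subsetP=> y yX; rewrite in_set2; case: (WX y yX) => [|->|->]; rewrite ?WT ?inE ?eqxx ?orbT.
    move/subset_leq_card; rewrite cards2 -/m => le; have := leq_trans m4 le.
    by case: (_ != _).
  have [x [y [xW yW gxy]]] := gcut _ nW; have xX := gX _ _ gxy.
  have xc : x = c.
    case: (WX x xX xW) => // xa; rewrite xa in gxy.
    by rewrite (uniq y gxy) in_setU1 (Xb c cX) orbT in yW.
  rewrite {x xX xW}xc in gxy.
  have [i [j [im jm Ea Ec ij]]] := gidx _ _ gac.
  have [j' [h [j'm hm + Ey jh]]] := gidx _ _ gxy.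
  rewrite Ec => /eqP; rewrite elI // => /eqP Ej; rewrite -{j' j'm}Ej in jh.
  have ih : i != h.
    by apply: contraNneq yW => ih; rewrite Ey -ih -Ea in_setU1 eqxx.
  have aW : el i \in a |: b c by rewrite -Ea in_setU1 eqxx.
  have cW : el j \in a |: b c by rewrite -Ec in_setU1 (Xb c cX) orbT.
  (* The ranks of [a] and [c] differ by [k], which is at least 2 here, so this module contains a
     rank in between, although it meets [X] only in [a] and [c]. *)
  have only n : n < m -> el n \in a |: b c -> n = i \/ n = j.
    move=> nm nW'; case: (WX (el n) (elX n nm) nW') => /eqP.
      by rewrite Ea elI // => /eqP; left.
    by rewrite Ec elI // => /eqP; right.
  have k1 : 1 < k.
    by move: (leq_trans m4 mk2); rewrite ltnS -[3]/(1 + 2) addnn; case: (k) => [|[]].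
  case/orP: ij => /eqP E1; case/orP: jh => /eqP E2.
  + have : el i.+1 \in a |: b c.
      by apply: (elint _ i i.+1 j); rewrite // leqnSn E1 -addn1 leq_add2l ltnW.
    case/only; first by apply: leq_ltn_trans jm; rewrite E1 -addn1 leq_add2l.
      by move/eqP; rewrite -addn1 -[X in _ == X]addn0 eqn_add2l.
    by rewrite E1 => /eqP; rewrite -addn1 eqn_add2l => /eqP E; rewrite -E in k1.
  + by case/eqP: ih; apply: (@addIn k); rewrite -E1.
  + by case/eqP: ih; rewrite E1 E2.
  + have : el j.+1 \in a |: b c.
      by apply: (elint _ j j.+1 i); rewrite // leqnSn E1 -addn1 leq_add2l ltnW.
    case/only; first by apply: leq_ltn_trans im; rewrite E1 -addn1 leq_add2l.
      by rewrite E1 => /eqP; rewrite -addn1 eqn_add2l => /eqP E; rewrite -E in k1.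
    by move/eqP; rewrite -addn1 -[X in _ == X]addn0 eqn_add2l.
by constructor 1.
Qed.

End Transversal.

(** * Small configurations *)

Section Special.

Variables (V : finType) (e : rel V).
Hypothesis te : tour e.
Implicit Types (M N Q K C D : {set V}).

Notation ntm := (ntmod e setT).
Notation md := (modin e setT).
Notation minmod := (minmod e).

Section MinimalModule.

Variable K : {set V}.
Hypothesis mK : minmod K.

(** A module of a module is a module of T, so minimality makes the subtournament on [K]
    indecomposable. *)
Lemma minmod_within R : modin e K R -> 1 < #|R| -> R = K.
Proof.
case/minmodP: mK => /and3P[mdK _ KT] minK mR R1; have [sR _] := modinP _ _ _ mR.
apply: minK => //; apply: ntmI => //; first exact: modin_trans mdK mR.
by apply: contraNneq KT => RT; rewrite -subTset -RT.
Qed.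

(** A source or sink [c] of [K] would make [K :\ c] a module of [K]. *)
Lemma minmod_no_end c o : 2 < #|K| -> c \in K -> ~ (forall k, k \in K -> k != c -> e c k = o).
Proof.
move=> K3 cK H; have mR : modin e K (K :\ c).
  apply/modinP; split; first exact: subD1set.
  move=> x y v; rewrite !in_setD1 => /andP[xc xK] /andP[yc yK] vK.
  by rewrite vK andbT negbK => /eqP->; rewrite !H.
have R1 : 1 < #|K :\ c| by rewrite (cardsD1 c) cK in K3.
by have /setP/(_ c) := minmod_within mR R1; rewrite in_setD1 eqxx cK.
Qed.

(* Iterating c -> b from a failing c runs into a 3-cycle which is a module of K. *)
Lemma minmod_good_vertex D c1 o : c1 \in K -> c1 \notin D ->
  3 < #|K| \/ (exists2 d, d \in D & d \in K) ->
  exists c, [/\ c \in K, c \notin D & forall b, b \in K -> b \notin D -> b != c ->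
    e c b = o -> ~ (forall k, k \in K -> k != b -> k != c -> e b k = o)].
Proof.
move=> c1K c1D big.
pose bad c b := [&& b \in K, b \notin D, b != c, e c b == o &
  [forall k in K, (k != b) ==> (k != c) ==> (e b k == o)]].
have badP c b : bad c b -> [/\ b \in K, b \notin D, b != c, e c b = o &
    forall k, k \in K -> k != b -> k != c -> e b k = o].
  case/and5P=> bK bD bc /eqP cb /forall_inP H; split=> // k kK kb kc.
  by have := H k kK; rewrite kb kc => /eqP.
case: (boolP [exists c, [&& c \in K, c \notin D & ~~ [exists b, bad c b]]]).
  move=> /existsP[c /and3P[cK cD /existsPn nb]]; exists c; split=> // b bK bD bc cb H.
  case/negP: (nb b); rewrite /bad bK bD bc cb eqxx /=.
  by apply/forall_inP=> k kK; apply/implyP=> kb; apply/implyP=> kc; rewrite H.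
move=> /existsPn allbad; exfalso.
have next c : c \in K -> c \notin D -> exists b, bad c b.
  by move=> cK cD; have := allbad c; rewrite cK cD negbK => /existsP.
have opp x y : x != y -> e x y = o -> e y x = ~~ o by move=> xy; rewrite (tourF te xy) => ->.
have abs : o = ~~ o -> False by case: (o).
have [b1 /badP[b1K b1D b1c E1 H1]] := next c1 c1K c1D.
have [b2 /badP[b2K b2D b21 E2 H2]] := next b1 b1K b1D.
have [b3 /badP[b3K b3D b32 E3 H3]] := next b2 b2K b2D.
have c1b1 := opp _ _ _ E1; rewrite eq_sym in c1b1.
have b2c : b2 != c1.
  by apply/eqP=> E; apply: abs; rewrite -c1b1 // -E2 E.
have b31 : b3 != b1.
  apply/eqP=> E; apply: abs; rewrite -(opp _ _ _ E2) 1?eq_sym //.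
  by rewrite -E3 E.
have b3c : b3 = c1.
  apply/eqP/negPn/negP=> b3c; apply: abs.
  rewrite -(opp b1 b3) 1?eq_sym //; first by rewrite H3 // eq_sym.
  exact: H1.
rewrite {b3 b3K b3D b32 b31}b3c in E3 H3.
pose R := [set c1; b1; b2].
have RK : R \subset K by apply/subsetP=> x; rewrite !inE => /orP[/orP[]|]/eqP->.
have mR : modin e K R.
  apply/modinP; split=> //.
  suff H x v : x \in R -> v \in K -> v \notin R -> e v x = ~~ o.
    by move=> x y v xR yR vK vR; rewrite !H.
  rewrite !inE !negb_or => /orP[/orP[]|]/eqP-> vK /andP[/andP[v1 v2] v3]; apply: opp.
  - by rewrite eq_sym.
  - exact: H3.
  - by rewrite eq_sym.
  - exact: H1.
  - by rewrite eq_sym.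
  - exact: H2.
have R3 : #|R| = 3.
  by rewrite /R setUC cardsU1 cards2 !inE negb_or b2c b21 eq_sym b1c.
have ER : R = K by apply: minmod_within; rewrite ?R3.
(* The 3-cycle avoids [D], so it can be all of [K] only if [K] has three elements and misses [D]. *)
case: big => [|[d dD]]; first by rewrite -ER R3.
rewrite -ER !inE => /orP[/orP[]|]/eqP dE; move: dD; rewrite dE.
- by rewrite (negbTE c1D).
- by rewrite (negbTE b1D).
- by rewrite (negbTE b2D).
Qed.

End MinimalModule.

Lemma link1 (x y u v : V) : link [:: (x, y)] u v = (u == x) && (v == y) || (u == y) && (v == x).
Proof. by rewrite /link !inE !xpair_eqE [(v == x) && _]andbC. Qed.

Section Attached.

Variables (e' : rel V) (K : {set V}) (a c : V) (o : bool).
Hypotheses (te' : tour e') (mK : minmod K) (K3 : 2 < #|K|) (aK : a \notin K) (cK : c \in K).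
Hypothesis eK : {in K &, e' =2 e}.
Hypothesis ak : forall k, k \in K -> k != c -> e' a k = o.
Hypothesis ac : e' a c = ~~ o.

(** As [K] is indecomposable, [M] contains it or has at most one element of it. In the first case
    [a] is in [M], since the reversed arc makes [a] split [K]. If [M] meets [a |: K] in [{a, u}],
    every other [k] sees [u] as it sees [a]: this is the near-source or near-sink that
    [minmod_good_vertex] excludes. *)
Lemma attached_module M : ntmod e' setT M ->
  [\/ a |: K \subset M, exists2 u, u \in K & M :&: (a |: K) = [set a; u] /\ u != c /\
        (e c u = o /\ forall k, k \in K -> k != u -> k != c -> e u k = o) |
      #|M :&: (a |: K)| <= 1].
Proof.
move=> nM; have mM := ntm_mod nM.
have mMK : modin e K (M :&: K).
  have /modinP[sMK H] := modin_restr mM (subsetT K).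
  apply/modinP; split=> // x y v xM yM vK vM.
  have := H x y v xM yM vK vM; rewrite !eK //; first by case/setIP: yM.
  by case/setIP: xM.
case: (ltnP 1 #|M :&: K|) => [MK1|MK1].
  have KM : K \subset M by apply/setIidPr/(minmod_within mK mMK).
  constructor 1; rewrite subUset KM andbT sub1set; apply/negPn/negP=> aM.
  have [k kK kc] := card2_ex c (ltnW K3).
  have := ntm_eq mM (subsetP KM _ kK) (subsetP KM _ cK) aM.
  by rewrite ak // ac; case: (o).
case: (boolP (a \in M)) => aM; last first.
  constructor 3; apply: leq_trans MK1; apply: subset_leq_card; apply/subsetP=> x.
  rewrite !inE => /andP[xM /orP[/eqP E|xK]]; last by rewrite xM.
  by rewrite E (negbTE aM) in xM.
case: (set_0Vmem (M :&: K)) => [MK0|[u uMK]].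
  constructor 3; rewrite setIUr MK0 setU0 -(cards1 a); apply: subset_leq_card; exact: subsetIr.
have MKE : M :&: K = [set u].
  by apply/eqP; rewrite eq_sym eqEcard sub1set uMK cards1.
have [uM uK] := setIP uMK.
have kM k : k \in K -> k != u -> k \notin M.
  move=> kK ku; apply/negP=> kM; have : k \in M :&: K by rewrite inE kM.
  by rewrite MKE inE (negbTE ku).
have ka k : k \in K -> a != k by move=> kK; apply: contraNneq aK => ->.
have kE k : k \in K -> k != u -> e k u = e' k a.
  by move=> kK ku; rewrite -eK //; apply: (ntm_eq mM) => //; apply: kM.
have uc : u != c.
  apply/eqP=> uc; apply: (minmod_no_end mK (o := o) K3 cK) => k kK kc.
  rewrite te 1?eq_sym // -uc kE ?uc // (tourF te') ?ka // ak // negbK //.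
constructor 2; exists u => //; split; first by rewrite setIUr MKE (setIidPr _) // sub1set.
split=> //; split; first by rewrite kE 1?eq_sym // (tourF te') ?ka // ac negbK.
by move=> k kK ku kc; rewrite te 1?eq_sym // kE // (tourF te') ?ka // ak // negbK.
Qed.

End Attached.

Lemma switch_tour g : symmetric g -> tour (switch e g).
Proof. by move=> gs x y xy; rewrite /switch (te xy) gs addNb. Qed.

(** This settles a pendant block when [X] has two elements: the arc from [a] goes to a good vertex
    of the block, which exists because [K] has at least four vertices. *)
Lemma end_indec a K : minmod K -> 3 < #|K| -> a \notin K -> setT = a |: K ->
  exists x y, x != y /\ indec (switch e (link [:: (x, y)])).
Proof.
move=> mK K4 aK TE; have [c1 c1K] : exists c, c \in K by apply/card_gt0P; apply: leq_trans K4.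
have mdK : md K by case/minmodP: mK => /ntm_mod.
pose o := e a c1.
have [|c [cK _ good]] := @minmod_good_vertex K mK set0 c1 o c1K _ (or_introl K4).
  by rewrite inE.
have ca : a != c by apply: contraNneq aK => ->.
exists a, c; split=> // M; apply/negP=> nM.
have ak k : k \in K -> e a k = o by move=> kK; apply: (ntm_eq mdK).
have ka k : k \in K -> (k == a) = false by move=> kK; apply: contraNF aK => /eqP<-.
set e' := switch _ _ in nM.
have := @attached_module e' K a c o _ mK (ltnW K4) aK cK _ _ _ M nM.
case.
- exact: (switch_tour (@link_sym _ _)).
- by move=> x y xK yK; rewrite /e' /switch link1 !ka // andbF addbF.
- by move=> k kK kc; rewrite /e' /switch link1 (negbTE kc) (ka k) // !andbF addbF ak.
- by rewrite /e' /switch link1 !eqxx addbT ak.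
- by rewrite -TE subTset; case/and3P: nM => _ _ /negP.
- case=> u uK [_ [uc [E H]]]; apply: (good u) => //; by rewrite inE.
by rewrite -TE setIT; case/and3P: nM => _; rewrite ltnNge => /negP.
Qed.

(** * The outer pair: one pair of twins *)

Section Twin.

Variables (p q : V) (C : {set V}).
Hypothesis pq : p != q.
Hypothesis CE : C = ~: [set p; q].
Hypothesis mpq : md [set p; q].
Hypothesis hitpq : forall Q, ntm Q -> (p \in Q) || (q \in Q).
Hypothesis maxpq : forall Q, ntm Q -> p \in Q -> q \in Q -> Q = [set p; q].
Hypothesis C2 : 1 < #|C|.

Let Cp y : y \in C -> y != p. Proof. by rewrite CE !inE negb_or => /andP[]. Qed.
Let Cq y : y \in C -> y != q. Proof. by rewrite CE !inE negb_or => /andP[]. Qed.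
Let Ceq y : y \in C -> e y p = e y q.
Proof. by move=> yC; apply: (ntm_eq mpq); rewrite in_set2 ?eqxx ?orbT // negb_or Cp // Cq. Qed.
Let Ceq' y : y \in C -> e p y = e q y.
Proof. by move=> yC; rewrite te 1?eq_sym ?Cp // Ceq // [RHS]te // eq_sym Cq. Qed.
Let inC y : y != p -> y != q -> y \in C. Proof. by rewrite CE !inE negb_or => -> ->. Qed.

(** A module of the tournament without [p] lifts to T, with [p] added if it contains the twin [q];
    [hitpq] and [maxpq] then leave only trivial ones. *)
Lemma twin_quotient_prime Q : modin e (~: [set p]) Q -> 1 < #|Q| -> Q = ~: [set p].
Proof.
move=> /modinP[sQ HQ] Q1; have pQ : p \notin Q.
  by apply/negP=> /(subsetP sQ); rewrite !inE eqxx.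
have QT : Q != setT by apply: contraNneq pQ => ->; rewrite inE.
case: (boolP (q \in Q)) => qQ; last first.
  have mQ : md Q.
    apply: modT => x y v xQ yQ vQ; have [->|vp] := eqVneq v p; last by apply: HQ; rewrite ?inE.
    have xC z : z \in Q -> z \in C by move=> zQ; apply: inC; [move: pQ | move: qQ]; apply: contraNneq => <-.
    by rewrite !Ceq' ?xC //; apply: HQ; rewrite // !inE eq_sym.
  by have := hitpq (ntmI mQ Q1 QT); rewrite (negbTE pQ) (negbTE qQ).
have mU : md (p |: Q).
  have H x v : x \in p |: Q -> v \notin p |: Q -> e v x = e v q.
    rewrite !in_setU1 negb_or => /orP[/eqP->|xQ] /andP[vp vQ].
      by apply: Ceq; apply: inC => //; apply: contraNneq vQ => ->.
    by apply: HQ; rewrite ?inE.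
  by apply: modT => x y v xU yU vU; rewrite (H x) ?(H y).
have [UT|UT] := eqVneq (p |: Q) setT.
  apply/setP=> v; rewrite !inE; have := in_setT v; rewrite -UT in_setU1.
  by have [->|] := eqVneq v p; rewrite //= (negbTE pQ).
have nU : ntm (p |: Q).
  by apply: ntmI => //; apply: leq_trans Q1 (subset_leq_card (subsetUr _ _)).
have := maxpq nU; rewrite !in_setU1 eqxx qQ orbT => /(_ isT isT)/setP UE.
have [w wQ wq] := card2_ex q Q1; have := UE w.
rewrite !inE wQ orbT (negbTE wq) orbF => /esym/eqP wp.
by rewrite wp (negbTE pQ) in wQ.
Qed.

(* The two cases: after the reversal, p is a source or a sink, or a twin of some y in C. *)
Lemma twin_switch x : x \in C -> ~ indec (switch e (link [:: (x, p)])) ->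
  (forall y, y \in C -> e q y = e p q (+) (y == x)) \/
  exists y, [/\ y \in C, y != x, e q p = e q y, e x y = ~~ e x q &
    forall w, w \in C -> w != x -> w != y -> e w y = e w q].
Proof.
move=> xC nind; set e' := switch _ _ in nind.
case: (boolP [exists M, ntmod e' setT M]) => [/existsP[M nM]|/existsPn noM]; last first.
  by case: nind.
have mM := ntm_mod nM; have xp := Cp xC; have xq := Cq xC.
have e'E u v : u != p -> v != p -> e' u v = e u v.
  by move=> up vp; rewrite /e' /switch link1 (negbTE up) (negbTE vp) andbF addbF.
have e'p u : u != p -> e' u p = e u p (+) (u == x).
  by move=> up; rewrite /e' /switch link1 eqxx (negbTE up) andbT orbF.
have e'p' u : u != p -> e' p u = e p u (+) (u == x).
  by move=> up; rewrite /e' /switch link1 eqxx (eq_sym p) (negbTE xp).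
have mM' : modin e (~: [set p]) (M :&: ~: [set p]).
  have /modinP[sM H] := modin_restr mM (subsetT (~: [set p])).
  apply/modinP; split=> // u w v uM wM vS vM; have := H u w v uM wM vS vM.
  by move: uM wM vS; rewrite !inE => /andP[_ u1] /andP[_ w1] v1; rewrite !e'E.
case: (ltnP 1 #|M :&: ~: [set p]|) => [M1|M1].
  have /setIidPr sM := twin_quotient_prime mM' M1.
  have pM : p \notin M.
    apply/negP=> pM; case/and3P: nM => _ _ /eqP; apply; apply/setP=> v; rewrite inE.
    by have [->//|vp] := eqVneq v p; apply: (subsetP sM); rewrite !inE.
  left=> y yC; have inM z : z != p -> z \in M by move=> zp; apply: (subsetP sM); rewrite !inE.
  have qp : q != p by rewrite eq_sym.
  have := ntm_eq mM (inM y (Cp yC)) (inM q qp) pM.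
  rewrite (e'p' y (Cp yC)) (e'p' q qp) Ceq' // (eq_sym q) (negbTE xq) addbF => <-.
  by rewrite addbK.
have [|u uM up] := card2_ex p (_ : 1 < #|M|); first by case/and3P: nM.
have ME v : v \in M -> v = p \/ v = u.
  move=> vM; have [->|vp] := eqVneq v p; [by left | right].
  by move/card_le1_eqP: M1; apply; rewrite !inE ?vM ?uM.
have pM : p \in M.
  case/and3P: nM => _ c1 _; apply/negPn/negP=> pM; have [v vM vu] := card2_ex u c1.
  by case: (ME v vM) => E; rewrite E ?eqxx // in vu; rewrite E (negbTE pM) in vM.
have nME v : v != p -> v != u -> v \notin M by move=> vp vu; apply/negP=> /ME[]/eqP; apply/negP.
have key v : v != p -> v != u -> e v p (+) (v == x) = e v u.
  by move=> vp vu; rewrite -e'p // -e'E //; apply: (ntm_eq mM); rewrite ?nME.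
have [uq|uq] := eqVneq u q.
  have := key x xp; rewrite uq xq eqxx Ceq // => /(_ isT).
  by case: (e x q).
have uC := inC up uq.
(* [M = {p, x}] is impossible: [{q, x}] would be a module once [p] is deleted. *)
have [ux|ux] := eqVneq u x.
  exfalso; have mq : modin e (~: [set p]) [set q; x].
    apply/modinP; split.
      by apply/subsetP=> w; rewrite !inE => /orP[]/eqP->; rewrite 1?eq_sym // eq_sym.
    suff H v : v != p -> v \notin [set q; x] -> e v q = e v x.
      by move=> y z v; rewrite !inE => /orP[]/eqP-> /orP[]/eqP-> vp vq; rewrite // H // !inE.
    rewrite in_set2 negb_or => vp /andP[vq vx].
    by have := key v vp; rewrite ux vx (negbTE vx) addbF => <- //; rewrite Ceq ?inC.
  have qx : #|[set q; x]| = 2 by rewrite cards2 eq_sym xq.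
  have := twin_quotient_prime mq; rewrite qx => /(_ isT) E2.
  have [w wC wx] := card2_ex x C2; have := Cp wC; have := Cq wC.
  by move/setP/(_ w): E2; rewrite !inE (negbTE wx) orbF => ->; case: (w == p).
right; exists u; split=> //.
- have := key q; rewrite eq_sym pq => /(_ isT); rewrite eq_sym uq (eq_sym q) (negbTE xq) addbF.
  exact.
- have := key x xp; rewrite eq_sym ux eqxx addbT Ceq // => /(_ isT) <-; by [].
- move=> w wC wx wu; have := key w (Cp wC) wu; rewrite (negbTE wx) addbF => <-.
  by rewrite Ceq.
Qed.

End Twin.

Lemma indec_dec (e' : rel V) : indec e' \/ ~ indec e'.
Proof.
case: (boolP [forall M, ~~ ntmod e' setT M]) => [/forallP|]; first by left.
by move=> /forallPn[M nM]; right=> /(_ M) H; rewrite H in nM.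
Qed.

(* Counting: reversing the arc between x in C and one of the twins p, q fails for
   at most #|C| + 2 of the 2 * #|C| choices. *)
Lemma twin_indec p q C : p != q -> C = ~: [set p; q] -> md [set p; q] ->
  (forall Q, ntm Q -> (p \in Q) || (q \in Q)) ->
  (forall Q, ntm Q -> p \in Q -> q \in Q -> Q = [set p; q]) ->
  2 < #|C| -> exists x y, x != y /\ indec (switch e (link [:: (x, y)])).
Proof.
move=> pq CE mpq hit max C3.
have qp : q != p by rewrite eq_sym.
have CE' : C = ~: [set q; p] by rewrite CE setUC.
have mqp : md [set q; p] by rewrite setUC.
have hit' Q : ntm Q -> (q \in Q) || (p \in Q) by rewrite orbC; apply: hit.
have max' Q : ntm Q -> q \in Q -> p \in Q -> Q = [set q; p].
  by move=> nQ qQ pQ; rewrite setUC; apply: max.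
pose P (t : bool) := if t then p else q.
pose o t := if t then e p q else e q p.
have oN t : o (~~ t) = ~~ o t by case: t; rewrite /o /= (te pq) ?negbK.
pose cond (u : V * bool) y := [&& y \in C, y != u.1, ~~ o u.2 == e q y,
  e u.1 y == ~~ e u.1 q & [forall w in C, (w != u.1) ==> (w != y) ==> (e w y == e w q)]].
(* [BS] collects the choices that turn the twin into a source or a sink, [BU] those that make it a
   twin of some [y] in [C]. In [BS] the chosen twin determines [x]; in [BU], [y] determines both [x]
   and the chosen twin. *)
pose BS := [set u : V * bool | (u.1 \in C) && [forall y in C, e q y == o u.2 (+) (y == u.1)]].
pose BU := [set u : V * bool | (u.1 \in C) && [exists y, cond u y]].
have Ceq y : y \in C -> e y p = e y q.
  by move=> yC; apply: (ntm_eq mpq); rewrite ?set21 ?set22 //; move: yC; rewrite CE inE.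
have Cne y : y \in C -> (y != p) /\ (y != q) by rewrite CE !inE negb_or => /andP[].
have Ceq' y : y \in C -> e p y = e q y.
  move=> yC; have [yp yq] := Cne y yC.
  by rewrite (tourF te yp) (tourF te yq) Ceq.
have cBS : #|BS| <= 2.
  rewrite -card_bool -cardsT -(card_in_imset (f := snd) (D := BS)); first exact/subset_leq_card/subsetT.
  move=> [x t] [x' t']; rewrite !inE /= => /andP[xC /forall_inP H] /andP[x'C /forall_inP H'] tt'.
  rewrite -{t'}tt' in H' *; congr pair; apply/eqP/negPn/negP=> xx'.
  have := H x xC; have := H' x xC.
  by rewrite eqxx (negbTE xx') => /eqP->; case: (o t).
have cBU : #|BU| <= #|C|.
  pose h (u : V * bool) := odflt u.1 [pick y | cond u y].
  have hP u : u \in BU -> cond u (h u).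
    rewrite inE => /andP[_ /existsP[y cy]]; rewrite /h; case: pickP => //= /(_ y).
    by rewrite cy.
  rewrite -(card_in_imset (f := h) (D := BU)).
    apply: subset_leq_card; apply/subsetP=> y /imsetP[u /hP + ->].
    by case/and5P.
  move=> [x t] [x' t'] /[dup] uB /hP /and5P[/= hC hx /eqP E1 /eqP E2 /forall_inP E3].
  move=> /[dup] uB' /hP /and5P[/= hC' hx' /eqP E1' /eqP E2' /forall_inP E3'] Eh.
  rewrite -{}Eh in hC' hx' E1' E2' E3'; move: hC hx E1 E2 E3 hC' hx' E1' E2' E3'.
  move: (h (x, t)) => y yC yx E1 E2 E3 _ yx' E1' E2' E3'.
  move: uB uB'; rewrite !inE /= => /andP[xC _] /andP[x'C _].
  have -> : t = t'.
    by move: E1; rewrite -E1'; case: (t); case: (t'); rewrite // /o (te pq); case: (e q p).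
  congr pair; apply/eqP/negPn/negP=> xx'.
  have := E3' x xC; rewrite xx' eq_sym yx /= E2; by case: (e x q).
case: (boolP (setX C setT \subset BS :|: BU)) => [sub|/subsetPn[[x t]]].
  have := leq_trans (subset_leq_card sub) (leq_card_setU _ _).1.
  rewrite cardsX cardsT card_bool muln2 -addnn => le.
  have := leq_trans le (leq_add cBS cBU); rewrite leq_add2r leqNgt C3.
  by [].
rewrite in_setX inE andbT /= => xC; rewrite in_setU negb_or => /andP[nS nU].
have [xp xq] := Cne x xC.
exists x, (P t); split; first by rewrite /P; case: (t).
have C2 : 1 < #|C| := ltnW C3.
have nS' : ~ (forall y, y \in C -> e q y = o t (+) (y == x)).
  move=> H; case/negP: nS; rewrite inE /= xC; apply/forall_inP=> y yC; exact/eqP/H.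
have nU' : ~ (exists y, [/\ y \in C, y != x, ~~ o t = e q y, e x y = ~~ e x q &
    forall w, w \in C -> w != x -> w != y -> e w y = e w q]).
  case=> y [yC yx E1 E2 E3]; case/negP: nU; rewrite inE /= xC; apply/existsP; exists y.
  rewrite /cond yC yx E1 E2 !eqxx /=; apply/forall_inP=> w wC.
  by apply/implyP=> wx; apply/implyP=> wy; apply/eqP/E3.
have [//|nind] := indec_dec (switch e (link [:: (x, P t)])).
case: t @P nS' nU' nind nS nU => P nS' nU' nind _ _; exfalso.
  case: (twin_switch pq CE mpq hit max C2 xC nind); first exact: nS'.
  case=> y [yC yx E1 E2 E3]; apply: nU'; exists y; split=> //.
  by rewrite -E1; symmetry; exact: (oN true).
case: (twin_switch qp CE' mqp hit' max' C2 xC nind).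
  by move=> H; apply: nS' => y yC; rewrite -Ceq' // H.
case=> y [yC yx E1 E2 E3]; apply: nU'; exists y; split=> //.
- by rewrite -Ceq' // -E1; symmetry; exact: (oN false).
- by rewrite E2 Ceq.
- by move=> w wC wx wy; rewrite -(Ceq w) // E3.
Qed.

(** This settles a pendant block when [X] has a third element [z]. Both arcs end in [K], at
    different vertices, chosen so that [c'] is the only vertex that could still form a bad pair with
    [a]; the arc between [c'] and [z] then rules this pair out. *)
Lemma two_arcs a z K : minmod K -> 2 < #|K| -> a \notin K -> md (a |: K) -> z \notin a |: K ->
  (forall Q, comod e Q -> ~~ [disjoint Q & z |: (a |: K)]) -> ~~ md [set a; z] ->
  exists c c', [/\ c \in K, c' \in K & indec (switch e (link [:: (a, c); (c', z)]))].
Proof.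
move=> mK K3 aK mW zW hit ntw; have mdK : md K by case/minmodP: mK => /ntm_mod.
have [k0 k0K] : exists k, k \in K by apply/card_gt0P; apply: leq_trans K3.
pose o := e a k0.
have eak k : k \in K -> e a k = o by move=> kK; apply: (ntm_eq mdK).
(* [c'] is a good vertex for the opposite direction; with only three vertices in [K] no such choice
   is guaranteed, and the last case below uses the size instead. *)
have [c' [c'K good']] : exists c', c' \in K /\ (#|K| <= 3 \/ forall b, b \in K -> b != c' ->
    e c' b = ~~ o -> ~ (forall k, k \in K -> k != b -> k != c' -> e b k = ~~ o)).
  case: (leqP #|K| 3) => K4; first by exists k0; split=> //; left.
  have [|c' [c'K _ H]] := @minmod_good_vertex K mK set0 k0 (~~ o) k0K _ (or_introl K4).
    by rewrite inE.
  by exists c'; split=> //; right=> b bK; apply: H; rewrite ?inE.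
have [c1 c1K c1c'] := card2_ex c' (ltnW K3).
have [||c [cK cD good]] := @minmod_good_vertex K mK [set c'] c1 o c1K; first by rewrite inE.
  by right; exists c'; rewrite ?inE.
have cc' : c != c' by rewrite inE in cD.
have {}good b : b \in K -> b != c -> e c b = o ->
    (forall k, k \in K -> k != b -> k != c -> e b k = o) -> b = c'.
  move=> bK bc E H; apply/eqP/negPn/negP=> bc'; apply: (good b) => //.
  by rewrite inE.
exists c, c'; split=> // M; apply/negP=> nM; set e' := switch _ _ in nM.
have mM := ntm_mod nM.
have ka k : k \in K -> (k == a) = false by move=> kK; apply: contraNF aK => /eqP<-.
have ak k : k \in K -> (a == k) = false by rewrite eq_sym; apply: ka.
have az : (a == z) = false by apply: contraNF zW => /eqP<-; rewrite in_setU1 eqxx.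
have kz k : k \in K -> (k == z) = false.
  by move=> kK; apply: contraNF zW => /eqP<-; rewrite in_setU1 kK orbT.
have za : (z == a) = false by rewrite eq_sym.
have zk k : k \in K -> (z == k) = false by rewrite eq_sym; apply: kz.
have lE u v : link [:: (a, c); (c', z)] u v =
    [|| (u == a) && (v == c), (u == c) && (v == a), (u == c') && (v == z) | (u == z) && (v == c')].
  rewrite /link !inE !xpair_eqE; case: (u == a); case: (v == c); case: (u == c); case: (v == a);
    by case: (u == c'); case: (v == z); case: (u == z); case: (v == c').
have e'K : {in K &, e' =2 e}.
  by move=> x y xK yK; rewrite /e' /switch lE !(ka x, ka y, kz x, kz y) // !andbF addbF.
have e'ak k : k \in K -> k != c -> e' a k = o.
  by move=> kK kc; rewrite /e' /switch lE (negbTE kc) (ak c) // (ak c') // az andbF addbF eak.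
have e'ac : e' a c = ~~ o by rewrite /e' /switch lE !eqxx addbT eak.
have e'out v w : v \notin a |: K -> e' v w = e v w (+) ((v == z) && (w == c')).
  rewrite in_setU1 negb_or => /andP[va vK]; rewrite /e' /switch lE (negbTE va) /=.
  have H k : k \in K -> (v == k) = false by move=> kK; apply: contraNF vK => /eqP->.
  by rewrite (H c) // (H c').
have te' : tour e' := switch_tour (@link_sym _ _).
have aW : a \in a |: K by rewrite in_setU1 eqxx.
have KW k : k \in K -> k \in a |: K by move=> kK; rewrite in_setU1 kK orbT.
have sW v w w' : w \in a |: K -> w' \in a |: K -> v \notin a |: K -> e v w = e v w'.
  by move=> wW w'W vW; apply: (ntm_eq mW).
have sW' v w w' : w \in a |: K -> w' \in a |: K -> v \notin a |: K -> e w v = e w' v.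
  by move=> wW w'W vW; apply: (modin_eq' te mW) => //; rewrite inE.
have [d [dK dc dc']] : exists d, [/\ d \in K, d != c & d != c'].
  have : ~~ (K \subset [set c; c']).
    by apply/negP=> /subset_leq_card; rewrite cards2 cc' leqNgt K3.
  by case/subsetPn=> d dK; rewrite in_set2 negb_or => /andP[]; exists d.
have [cW c'W dW] := And3 (KW c cK) (KW c' c'K) (KW d dK).
have e'ka k : k \in K -> k != c -> e' k a = ~~ o.
  by move=> kK kc; rewrite (te' _ _ (negbT (ka k kK))) e'ak.
have e'ca : e' c a = o by rewrite (te' _ _ (negbT (ka c cK))) e'ac negbK.
have noM_hit (Q : {set V}) : ntm Q -> ~ (Q \subset ~: (z |: (a |: K))) /\ ~ (z |: (a |: K) \subset Q).
  move=> nQ; split=> sQ.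
    have := hit Q; rewrite /comod nQ => /(_ isT)/negP; apply.
    by rewrite disjoints_subset.
  have := hit (~: Q); rewrite /comod setCK nQ orbT => /(_ isT)/negP; apply.
  by rewrite disjoint_sym disjoints_subset setCK.
have e'in w v : w \in a |: K -> v \notin a |: K -> e' w v = e w v (+) ((v == z) && (w == c')).
  move=> wW vW; have wv := mem_neq wW vW.
  by rewrite (te' _ _ wv) (te wv) e'out // addNb.
case: (attached_module te' mK K3 aK cK e'K e'ak e'ac nM) => [WM|[u uK [MW [uc [E H]]]]|MW1].
- case: (boolP (z \in M)) => zM; last first.
    have := ntm_eq mM (subsetP WM _ aW) (subsetP WM _ (KW c' c'K)) zM.
    rewrite !e'out // !eqxx (ak c') // andbF addbF addbT (sW z a c') //.
    by case: (e z c').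
  have nM' : ntm M.
    case/and3P: nM => _ M1 MT; apply: ntmI => //; apply: modT => x y v xM yM vM.
    have vW : v \notin a |: K by apply: contra vM; apply: (subsetP WM).
    have vz : (v == z) = false by apply: contraNF vM => /eqP->.
    by have := ntm_eq mM xM yM vM; rewrite !e'out // vz !addbF.
  by case: (noM_hit M nM') => _; apply; rewrite subUset sub1set zM.
(* The reversed arc at [c'] makes [z] separate [a] from [c'], so [z] is in [M]. But [c] and [d] see
   [z] alike and [a] differently. *)
- have uc' := good u uK uc E H; rewrite {u H}uc' in uK MW uc E.
  have inM w : w \in a |: K -> (w \in M) = (w == a) || (w == c').
    by move=> wW; have /setP/(_ w) := MW; rewrite !inE -in_setU1 wW andbT.
  have aM : a \in M by rewrite inM // eqxx.
  have c'M : c' \in M by rewrite inM // eqxx orbT.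
  have cM : c \notin M by rewrite inM // ka // (negbTE cc').
  have dM : d \notin M by rewrite inM // ka // (negbTE dc').
  have zM : z \in M.
    apply/negPn/negP=> zM; have := ntm_eq mM aM c'M zM.
    rewrite !e'out // !eqxx (ak c') // andbF addbF addbT (sW z a c') //.
    by case: (e z c').
  have := ntm_eq mM aM zM cM; have := ntm_eq mM aM zM dM.
  rewrite e'ca e'ka // !e'in // (negbTE cc') (negbTE dc') !andbF !addbF.
  by rewrite (sW' z c d) // => <-; case: (o).
case: (set_0Vmem (M :&: (a |: K))) => [MW0|[u /[dup] uMW /setIP[uM uW]]].
  have outM x : x \in M -> x \notin a |: K.
    by move=> xM; apply/negP=> xW; have /setP/(_ x) := MW0; rewrite inE xM xW inE.
  have aM : a \notin M by apply/negP=> /outM/negP.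
  have c'M : c' \notin M by apply/negP=> /outM/negP; rewrite c'W.
  case: (boolP (z \in M)) => zM.
    have [m mM1 mz] := ntm_card z nM; have mW1 := outM m mM1.
    have := ntm_eq mM zM mM1 aM; have := ntm_eq mM zM mM1 c'M.
    rewrite !e'in // !eqxx (ak c') // (negbTE mz) !andbF !addbF addbT.
    by rewrite (sW' z c' a) ?(sW' m c' a) // => <-; case: (e a z).
  have nM' : ntm M.
    case/and3P: nM => _ M1 MT; apply: ntmI => //; apply: modT => x y v xM yM vM.
    have xz w : w \in M -> (w == z) = false by move=> wM; apply: contraNF zM => /eqP<-.
    have e'M w : w \in M -> e' v w = e v w.
      move=> wM; case: (boolP (v \in a |: K)) => vW; first by rewrite e'in ?outM // xz // /= addbF.
      have wc' : (w == c') = false by apply: contraNF c'M => /eqP<-.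
      by rewrite e'out // wc' andbF addbF.
    by rewrite -!e'M //; apply: (ntm_eq mM).
  case: (noM_hit M nM') => + _; apply; apply/subsetP=> x xM.
  by rewrite in_setC in_setU1 negb_or outM // andbT; apply: contraNneq zM => <-.
have uniqW w : w \in M -> w \in a |: K -> w = u.
  by move=> wM wW; move/card_le1_eqP: MW1; apply; rewrite // inE wM.
have nMW w : w \in a |: K -> w != u -> w \notin M.
  by move=> wW wu; apply: contra wu => wM; rewrite (uniqW w).
have no_out (w : V) (r : bool) : w \in K -> ~ (forall k, k \in K -> k != w -> e k w = r).
  move=> wK H; apply: (minmod_no_end mK (o := ~~ r) K3 wK) => k kK kw.
  by rewrite (tourF te kw) H.
(* All of [a |: K] would see such an [m] alike, hence also [u]; but [c] and [d] see [a] differently,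
   and [K] has no source or sink. *)
have onlyz m : m \in M -> m != u -> m = z.
  move=> mM1 mu; have mW1 : m \notin a |: K by apply: contra mu => mW1; rewrite (uniqW m).
  apply/eqP/negPn/negP=> mz.
  have H w : w \in a |: K -> w != u -> e' w u = e a m.
    move=> wW wu; have := ntm_eq mM uM mM1 (nMW w wW wu); rewrite [in RHS]e'in // (negbTE mz) addbF.
    by move=> ->; apply: sW'.
  have [ua|ua] := eqVneq u a.
    have := H c (KW c cK); have := H d (KW d dK); rewrite ua !ka // e'ca e'ka // => <- // /(_ isT).
    by case: (o).
  have uK : u \in K by move: uW; rewrite in_setU1 (negbTE ua).
  by apply: (no_out u (e a m) uK) => k kK ku; rewrite -(H k) ?(KW k) // e'K.
have zM : z \in M by have [m mM1 mu] := ntm_card u nM; rewrite -(onlyz m).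
have H w : w \in a |: K -> w != u -> e' w u = e a z (+) (w == c').
  move=> wW wu; have := ntm_eq mM uM zM (nMW w wW wu); rewrite [in RHS]e'in // eqxx.
  by move=> ->; rewrite (sW' z w a).
have [ua|ua] := eqVneq u a.
  have := H c (KW c cK); have := H d (KW d dK); rewrite ua !ka // e'ca e'ka //.
  rewrite (negbTE cc') (negbTE dc') !addbF => /(_ isT) <- /(_ isT).
  by case: (o).
have uK : u \in K by move: uW; rewrite in_setU1 (negbTE ua).
have [uc'|uc'] := eqVneq u c'.
  apply: (no_out u (e a z) uK) => k kK ku; rewrite -e'K // H ?(KW k) //.
  by rewrite -uc' (negbTE ku) addbF.
(* Otherwise this set is a module of T, because an outside vertex sees [z] and [u], both in [M],
   alike. *)
have WzT : z |: (a |: K) = setT.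
  apply/eqP/negPn/negP=> UT; have mU : md (z |: (a |: K)).
    have HU x v : x \in z |: (a |: K) -> v \notin z |: (a |: K) -> e v x = e v u.
      rewrite 2!(in_setU1 _ z) negb_or => + /andP[vz vW].
      case/orP=> [/eqP->|xW]; last exact: sW.
      have vu : v != u by apply: contraNneq vW => ->.
      have vM : v \notin M by apply: contra vz => vM; rewrite (onlyz v).
      by have := ntm_eq mM zM uM vM; rewrite !e'out // (negbTE vz) /= !addbF.
    by apply: modT => x y v xU yU vU; rewrite (HU x) ?(HU y).
  have nU : ntm (z |: (a |: K)).
    apply: ntmI => //; apply: leq_trans (ltnW K3) _.
    by apply/subset_leq_card/(subset_trans (subsetUr [set a] K))/subsetUr.
  by case: (noM_hit _ nU) => _; apply.
have [uc|uc] := eqVneq u c.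
  have q : e a z = ~~ o.
    by have := H a aW; rewrite uc eq_sym ka // e'ac (ak c') // addbF => /(_ isT)<-.
  case/negP: ntw; apply: modT.
  suff Haz v : v != a -> v != z -> e v a = e v z.
    move=> x y v; rewrite !in_set2 negb_or => /orP[]/eqP-> /orP[]/eqP-> /andP[va vz] //.
      exact: Haz.
    by rewrite Haz.
  move=> va vz; have vK : v \in K.
    by have := in_setT v; rewrite -WzT !in_setU1 (negbTE va) (negbTE vz).
  by rewrite (sW' z v a) ?(KW v) // q (tourF te (negbT (ak v vK))) eak.
have q : e a z = o.
  by have := H a aW; rewrite eq_sym ka // e'ak // (ak c') // addbF => /(_ isT)<-.
have Hu k : k \in K -> k != u -> e u k = ~~ o (+) (k == c').
  by move=> kK ku; rewrite (tourF te ku) -e'K // (H k (KW k kK) ku) q addNb.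
have Ec' : e c' u = ~~ o.
  by rewrite -e'K // H // 1?eq_sym // eqxx addbT q.
(* All other vertices of [K] except [c'] see [u] alike, and [c'] does the opposite. If [K] has three
   vertices this contradicts the choice of [c], otherwise that of [c']. *)
case: good' => [K3'|good'].
  suff : u = c' by apply/eqP.
  apply: good => //.
    have cu : c != u by rewrite eq_sym.
    by rewrite -e'K // (H c) // (negbTE cc') addbF q.
  move=> k kK ku kc; suff -> : k = c' by rewrite Hu 1?eq_sym // eqxx addbT negbK.
  apply/eqP/negPn/negP=> kc'; have : [set c; c'; u; k] \subset K.
    by apply/subsetP=> w; rewrite !inE => /orP[/orP[/orP[]|]|]/eqP->.
  move/subset_leq_card; rewrite setUC cardsU1 setUC cardsU1 cards2 cc' !inE !negb_or.
  by rewrite ku kc kc' uc uc' /= => /leq_trans/(_ K3').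
case: (good' u uK uc' Ec') => k kK ku kc'.
by rewrite Hu // (negbTE kc') addbF.
Qed.

End Special.

(** * Matching certificates for the indices *)

Section Index.

Variables (V : finType) (e : rel V).
Hypothesis te : tour e.

Lemma ntmod_ext (e1 e2 : rel V) M : e1 =2 e2 -> ntmod e1 setT M = ntmod e2 setT M.
Proof.
move=> E; rewrite /ntmod; congr (_ && _); apply/modinP/modinP=> -[sM H]; split=> // x y v.
  by rewrite -!E; apply: H.
by rewrite !E; apply: H.
Qed.

Lemma indec_ext (e1 e2 : rel V) : e1 =2 e2 -> indec e1 -> indec e2.
Proof. by move=> E i1 M; rewrite -(ntmod_ext M E). Qed.

(** If no edge touched [Q], no arc between [Q] and its complement would be reversed, and the module
    [Q] or [~: Q] would survive. *)
Lemma comod_switch (g : rel V) Q : symmetric g -> indec (switch e g) -> comod e Q ->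
  exists2 x, x \in Q & exists y, g x y.
Proof.
move=> gs ind cQ.
case: (boolP [exists x, (x \in Q) && [exists y, g x y]]) => [|/existsPn no].
  by move=> /existsP[x /andP[xQ /existsP[y gxy]]]; exists x => //; exists y.
have g0 x y : x \in Q -> g x y = false.
  by move=> xQ; apply/negP=> gxy; case/negP: (no x); rewrite xQ; apply/existsP; exists y.
have stable (N : {set V}) : (forall v x, v \notin N -> x \in N -> g v x = false) ->
    ntmod e setT N -> ntmod (switch e g) setT N.
  move=> gN /and3P[mN N1 NT]; apply: ntmI => //; apply: modT => x y v xN yN vN.
  by rewrite /switch !gN // !addbF; apply: (ntm_eq mN).
case/orP: cQ => nQ.
  have /negP[] := ind Q; apply: stable nQ => v x vQ xQ; by rewrite gs g0.
have /negP[] := ind (~: Q); apply: stable nQ => v x; rewrite inE negbK => vQ _.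
by rewrite g0.
Qed.

Lemma card_hit (P : {set {set V}}) (S : {set V}) : trivIset P ->
  (forall Q, Q \in P -> exists2 x, x \in Q & x \in S) -> #|P| <= #|S|.
Proof.
move=> tP hit; have PS Q : Q \in P -> exists x, (x \in Q) && (x \in S).
  by case/hit=> x xQ xS; exists x; rewrite xQ.
case: (set_0Vmem P) => [->|[Q0 Q0P]]; first by rewrite cards0.
have [x0 _] := PS Q0 Q0P.
pose h (Q : {set V}) := odflt x0 [pick x | (x \in Q) && (x \in S)].
have hP Q : Q \in P -> (h Q \in Q) && (h Q \in S).
  by case/PS=> x xQS; rewrite /h; case: pickP => //= /(_ x); rewrite xQS.
rewrite -(card_in_imset (f := h) (D := P)).
  by apply: subset_leq_card; apply/subsetP=> x /imsetP[Q /hP/andP[_ +] ->].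
move=> Q Q' QP Q'P E; have [hQ _] := andP (hP Q QP); have [hQ' _] := andP (hP Q' Q'P).
rewrite -(def_pblock tP QP hQ) -(def_pblock tP Q'P hQ'); by rewrite E.
Qed.

(** One number [m] for all certificates: the disjoint co-modules give the lower bounds, the set and
    the list the upper bounds. *)
Definition solved m :=
  [/\ exists P : {set {set V}}, [/\ trivIset P, forall Q, Q \in P -> comod e Q & #|P| = m],
      exists2 Y : {set V}, #|Y| = m & indec (switch e (clique Y)) &
      exists l : seq (V * V), [/\ size l = uphalf m, forall p, p \in l -> p.1 != p.2 &
        indec (switch e (link l))]].

Lemma solved_exists : 4 < #|V| -> ~ trans_even e setT -> exists m, solved m.
Proof.
move=> V5 nte.
case: (boolP [exists Q, ntmod e setT Q]) => [exQ|/existsPn noQ]; last first.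
  exists 0; split.
  - by exists set0; split=> [|Q|]; rewrite ?cards0 ?inE //; apply/trivIsetP=> A B; rewrite inE.
  - exists set0; rewrite ?cards0 //; apply: indec_ext noQ => x y.
    by rewrite /switch /clique !inE addbF.
  - by exists [::]; split=> //; apply: indec_ext noQ => x y; rewrite /switch /link addbF.
have [Q0 nQ0] := existsP exQ.
have [X [b sysX]] : exists X b, sys e X b.
  by apply: sys_exists => //; [apply: leq_trans V5 | exists Q0].
have [Xb Xk Xd Xh Xtw] := sysX.
have b_uniq x y w : x \in X -> y \in X -> w \in b x -> w \in b y -> x = y.
  move=> xX yX wx wy; apply/eqP/negPn/negP=> xy.
  by rewrite (disjointFr (Xd _ _ xX yX xy) wx) in wy.
have X2 : 1 < #|X|.
  have [[x xX xQ] [y yX yQ]] := sys_hit sysX nQ0.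
  by apply/card_gt1P; exists x, y; rewrite xX yX (mem_neq xQ yQ).
exists #|X|.
have solP : exists P : {set {set V}}, [/\ trivIset P, forall Q, Q \in P -> comod e Q & #|P| = #|X|].
  exists (b @: X); split.
  - apply/trivIsetP=> A B /imsetP[x xX ->] /imsetP[y yX ->] xy; apply: Xd => //.
    by apply: contraNneq xy => ->.
  - move=> Q /imsetP[x xX ->]; rewrite /comod; case: (Xk x xX) => [/minmodP[-> _]//|[-> xx]|[-> *]].
      rewrite orbC ntmI //; last by apply/eqP=> /setP/(_ x); rewrite !inE eqxx.
      by rewrite cardsC1; move: V5; case: #|V| => [|[|[|]]].
    by rewrite orbT.
  - apply: card_in_imset => x y xX yX bE; apply: (b_uniq x y x) => //; first exact: Xb.
    by rewrite -bE; apply: Xb.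
(* Inverting a two-element set reverses one arc, so for two elements a single suitable arc yields
   both certificates; it need not join the elements of [X]. *)
have pair_sol : #|X| = 2 -> (exists x y, x != y /\ indec (switch e (link [:: (x, y)]))) ->
    solved #|X|.
  move=> E2 [x [y [xy ind]]]; split=> //; rewrite E2.
    exists [set x; y]; first by rewrite cards2 xy.
    apply: indec_ext ind => u v; rewrite /switch link1 /clique !in_set2.
    congr (_ (+) _); apply/idP/idP.
      by case/orP=> /andP[/eqP-> /eqP->]; rewrite !eqxx ?orbT ?xy //= eq_sym xy.
    by case/and3P=> /orP[]/eqP-> /orP[]/eqP->; rewrite ?eqxx ?orbT.
  by exists [:: (x, y)]; split=> // p; rewrite inE => /eqP->.
have [l [sl ll ind3]] := rank_graph te sysX X2.
case: ind3 => [ind|[X3 [a [c [aX cX gac _ [mbc mW b3]]]]]|[x0 [c [n [x0X oX cn bE XE]]]]].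
- have [X3|X3] := ltnP 2 #|X|.
    by split=> //; [exists X => //; apply: (clique_indec te sysX) | exists l].
  have E2 : #|X| = 2 by apply/eqP; rewrite eqn_leq X3.
  apply: pair_sol => //; move: sl; rewrite E2; case: l ll ind => [|[x y] [|]] //= ll ind _.
  by exists x, y; split=> //; apply: (ll (x, y)); rewrite inE.
(* Pendant block: if [X] is [{a, c}], then [a |: b c] is everything and one arc suffices; otherwise
   the third element [z] supplies the second arc. *)
- have ac : a != c.
    apply/eqP=> E; move: gac; rewrite E /link orbb => /ll.
    by rewrite eqxx.
  have ab : a \notin b c by apply/negP=> abc; rewrite (b_uniq _ _ _ aX cX (Xb a aX) abc) eqxx in ac.
  have nW : a |: b c != setT -> ntmod e setT (a |: b c).
    by move=> WT; apply: ntmI => //; apply: leq_trans (ltnW b3) (subset_leq_card (subsetUr _ _)).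
  case: (boolP (X \subset [set a; c])) => [sX|/subsetPn[z zX]].
    have E2 : #|X| = 2.
      apply/eqP; rewrite eqn_leq X2 andbT; apply: leq_trans (subset_leq_card sX) _.
      by rewrite cards2; case: (_ != _).
    apply: pair_sol => //; have WT : a |: b c = setT.
      apply/eqP/negPn/negP=> /nW/(sys_hit sysX)[_ [x /(subsetP sX)]].
      by rewrite in_set2 in_setU1 => /orP[]/eqP->; rewrite ?eqxx ?(Xb c cX) ?orbT.
    apply: (end_indec te mbc _ ab) => //.
    by move: V5; rewrite -cardsT -WT cardsU1 ab add1n ltnS.
  rewrite in_set2 negb_or => /andP[za zc].
  have c3 : #|[set z; a; c]| = 3.
    by rewrite setUC cardsU1 cards2 in_set2 negb_or eq_sym zc eq_sym ac za.
  have sX : [set z; a; c] \subset X by apply/subsetP=> x; rewrite !inE => /orP[/orP[]|]/eqP->.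
  have E3 : #|X| = 3.
    by apply/eqP; rewrite eqn_leq X3 -[X in X <= _]c3 subset_leq_card.
  have zW : z \notin a |: b c.
    rewrite in_setU1 negb_or za; apply/negP=> zb.
    by rewrite (b_uniq _ _ _ zX cX (Xb z zX) zb) eqxx in zc.
  have XE : X \subset z |: (a |: b c).
    have <- : [set z; a; c] = X by apply/eqP; rewrite eqEcard sX E3 c3.
    apply/subsetP=> x; rewrite !inE => /orP[/orP[]|]/eqP->; rewrite ?eqxx ?orbT //.
    by rewrite Xb ?orbT.
  split=> //.
    by exists X => //; apply: (clique_indec te sysX); rewrite E3.
  have [||c1 [c2 [c1b c2b ind]]] := @two_arcs V e te a z (b c) mbc b3 ab mW zW.
  - move=> Q /Xh[x xX xQ]; apply/negP=> dQ.
    by have := disjointFr dQ xQ; rewrite (subsetP XE).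
  - by rewrite Xtw // eq_sym.
  exists [:: (a, c1); (c2, z)]; split; rewrite ?E3 // => p.
  rewrite !inE => /orP[]/eqP-> /=; first by apply: contraNneq ab => ->.
  by apply: contraNneq zW => <-; rewrite in_setU1 c2b orbT.
(* Outer pair: order at least five leaves at least three vertices besides the twins [c] and [n]. *)
have x0c : x0 != c.
  apply/eqP=> E; have : c \in ~: b x0 by rewrite bE set21.
  by rewrite -E inE Xb.
have [nN C1 _ ohit omax] := oX.
apply: pair_sol; first by rewrite XE cards2 x0c.
have bE' : b x0 = ~: [set c; n] by rewrite -bE setCK.
apply: (twin_indec te cn bE').
- by rewrite -bE; apply: ntm_mod nN.
- move=> Q /ohit[y [yX yx0 yQ]]; move: yX; rewrite XE in_set2 (negbTE yx0) => /eqP E.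
  by rewrite -E yQ.
- move=> Q /[dup] nQ /ntm_mod mQ cQ nQ'; case: (omax Q mQ).
  + by rewrite bE; apply/subsetP=> w; rewrite in_set2 => /orP[]/eqP->.
  + by rewrite bE.
  + by move=> E; case/and3P: nQ => _ _; rewrite E eqxx.
have := cardsC [set c; n]; rewrite -bE' cards2 cn => E.
by move: V5; rewrite -E addnC addn2 !ltnS.
Qed.

End Index.

(** * Families of disjoint co-modules *)

Section Bounds.

Variables (V : finType) (e : rel V).
Hypothesis te : tour e.
Hypothesis e_irr : irreflexive e.
Variable P : {set {set V}}.
Hypotheses (tP : trivIset P) (cP : forall Q, Q \in P -> comod e Q).

Lemma comod_card Q : comod e Q -> (#|Q| == 1) || (1 < #|Q|).
Proof.
case: (leqP 2 #|Q|) => [|Q1] cQ; first by rewrite orbT.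
rewrite orbF eqn_leq -ltnS Q1 card_gt0 /=; apply/eqP=> Q0; move: cQ.
by rewrite /comod Q0 setC0 /ntmod cards0 eqxx !andbF.
Qed.

Lemma comod1_extreme p : comod e [set p] -> extreme e p.
Proof. by rewrite /comod {1}/ntmod cards1 andbF /= => /ntm_mod. Qed.

Lemma extreme_eq p x y : extreme e p -> x != p -> y != p -> e p x = e p y.
Proof. by move=> xp xp' yp; apply: (ntm_eq xp); rewrite !inE ?eqxx. Qed.

(** A singleton co-module is a source or a sink, and there is at most one of each. *)
Lemma comods_singletons : #|[set Q in P | #|Q| == 1]| <= 2.
Proof.
rewrite leqNgt; apply/negP=> /card_gt2P[A [B [D [[+ + +] [AB BD DA]]]]].
rewrite !inE => /andP[/cP + /cards1P[a Ea]] /andP[/cP + /cards1P[b Eb]] /andP[/cP + /cards1P[d Ed]].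
move: AB BD DA; rewrite {}Ea {}Eb {}Ed !(inj_eq set1_inj) => ab bd da.
move=> /comod1_extreme xa /comod1_extreme xb /comod1_extreme xd.
have [ba db ad] : [/\ b != a, d != b & a != d] by split; rewrite eq_sym.
have := extreme_eq xa ba da; have := extreme_eq xb ab db; have := extreme_eq xd ad bd.
rewrite (te ab) (te bd) (te da).
by case: (e b a); case: (e d b); case: (e a d).
Qed.

Lemma comods_double : #|P|.*2 <= #|cover P| + #|[set Q in P | #|Q| == 1]|.
Proof.
rewrite -(eqP tP) -muln2 -sum_nat_const -[X in _ <= _ + X]sum1_card.
rewrite [X in _ <= _ + X](eq_bigl (fun Q => (Q \in P) && (#|Q| == 1))) => [|Q]; last by rewrite inE.
rewrite big_mkcondr -big_split /=; apply: leq_sum => Q /cP /comod_card.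
by case: eqP => [->|_] //= Q1; rewrite addn0.
Qed.

Lemma comods_bound : #|P|.*2 <= #|V|.+2.
Proof.
apply: leq_trans comods_double _; rewrite -addn2.
exact: leq_add (max_card _) comods_singletons.
Qed.

(** Equality in the count forces two singletons and two pairs that partition the vertices. The
    source and the sink lie on no 3-cycle, so a 3-cycle would have two vertices in one pair; but the
    pairs are modules, and the third vertex separates those two. *)
Lemma comods_order6 : #|V| = 6 -> #|P| = 4 -> {in setT & &, forall x y z, e x y -> e y z -> e x z}.
Proof.
move=> V6 P4; have := comods_double; rewrite P4 => le8.
have c1 := comods_singletons; have cc : #|cover P| <= 6 by rewrite -V6 max_card.
set P1 := [set Q in P | #|Q| == 1] in le8 c1.
have P1E : #|P1| = 2.
  by apply/eqP; rewrite eqn_leq c1 -(leq_add2l 6); apply: leq_trans le8 _; rewrite leq_add2r.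
have covE : #|cover P| = 6.
  by apply/eqP; rewrite eqn_leq cc -(leq_add2r 2) -[X in _ <= _ + X]P1E.
have covT x : x \in cover P.
  have /eqP -> : cover P == setT by rewrite eqEcard subsetT cardsT V6 covE.
  by rewrite inE.
pose P2 := P :\: P1.
have P2E : #|P2| = 2.
  have := cardsID P1 P; rewrite P4 (setIidPr _) ?P1E; first by move=> [] .
  by apply/subsetP=> Q; rewrite inE => /andP[].
have P2c Q : Q \in P2 -> #|Q| = 2.
  move=> QP2; have sum4 : \sum_(Q in P2) #|Q| = 4.
    have := covE; rewrite -(eqP tP) (big_setID P1) /= (setIidPr _); last first.
      by apply/subsetP=> R; rewrite inE => /andP[].
    rewrite (eq_bigr (fun=> 1)) ?sum1_card ?P1E; first by move=> [].
    by move=> R; rewrite inE => /andP[_ /eqP].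
  have two R : R \in P2 -> 1 < #|R|.
    by rewrite !inE => /andP[R1 RP]; move: (comod_card (cP RP)) R1; rewrite RP; case: eqP.
  apply/eqP; rewrite eqn_leq two // andbT; move: sum4; rewrite (big_setD1 Q) //= => sum4.
  have [R RD] : exists R, R \in P2 :\ Q.
    by apply/card_gt0P; have := cardsD1 Q P2; rewrite QP2 P2E add1n => -[<-].
  have [RQ RP2] := setD1P RD; rewrite (big_setD1 R) //= in sum4.
  rewrite -(leq_add2r 2) -[X in _ <= X]sum4 leq_add2l.
  by apply: leq_trans (two R RP2) (leq_addr _ _).
have [p [q [pP1 qP1 pq]]] : exists p q, [/\ [set p] \in P, [set q] \in P & p != q].
  have /card_gt1P[A [B [+ + AB]]] : 1 < #|P1| by rewrite P1E.
  rewrite !inE => /andP[AP /cards1P[p Ep]] /andP[BP /cards1P[q Eq]].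
  by exists p, q; rewrite -Ep -Eq; split=> //; apply: contraNneq AB => E; rewrite Ep Eq E.
have xp := comod1_extreme (cP pP1); have xq := comod1_extreme (cP qP1).
(* If the complement of the pair is a module, it contains the source and the sink, which a vertex of
   the pair sees differently. *)
have P2mod Q : Q \in P2 -> modin e setT Q.
  move=> QP2; have [QP Q1] := setDP QP2; case/orP: (cP QP) => [/ntm_mod//|/ntm_mod mC].
  have notin r : [set r] \in P -> r \in ~: Q.
    move=> rP; rewrite inE; apply/negP=> rQ; have := P2c Q QP2.
    by rewrite -(def_pblock tP QP rQ) (def_pblock tP rP (set11 r)) cards1.
  have /set0Pn[x xQ] : Q != set0 by rewrite -card_gt0 P2c.
  have xC : x \notin ~: Q by rewrite inE negbK.
  have xpq r : r \in ~: Q -> x != r by rewrite inE => rQ; apply: contraNneq rQ => <-.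
  have := ntm_eq mC (notin p pP1) (notin q qP1) xC.
  have qp : q != p by rewrite eq_sym.
  have := extreme_eq xp qp (xpq _ (notin p pP1)); have := extreme_eq xq pq (xpq _ (notin q qP1)).
  rewrite (te pq) (te (xpq _ (notin p pP1))) (te (xpq _ (notin q qP1))).
  by case: (e q p); case: (e p x); case: (e q x).
have in_P2 u v w : e u v -> e v w -> e w u -> pblock P u \in P2.
  move=> uv vw wu; rewrite !inE pblock_mem ?covT // andbT; apply/negP=> /cards1P[r Er].
  have ur : u = r by apply/set1P; rewrite -Er mem_pblock.
  have xu : extreme e u by apply: comod1_extreme; apply: cP; rewrite ur -Er pblock_mem.
  have nv : v != u by apply: contraTneq uv => ->; rewrite e_irr.
  have nw : w != u by apply: contraTneq wu => ->; rewrite e_irr.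
  have := extreme_eq xu nv nw; rewrite uv => /esym uw.
  by move: wu; rewrite te // uw.
have nopair u v w : e u v -> e v w -> e w u -> pblock P u != pblock P v.
  move=> uv vw wu; apply/eqP=> E; have uP := in_P2 u v w uv vw wu; have mu := P2mod _ uP.
  have uu : u \in pblock P u by rewrite mem_pblock.
  have vu : v \in pblock P u by rewrite E mem_pblock.
  have wv : w != v by apply: contraTneq vw => ->; rewrite e_irr.
  have wNu : w != u by apply: contraTneq wu => ->; rewrite e_irr.
  have wN : w \notin pblock P u.
    have uv' : u != v by apply: contraTneq uv => ->; rewrite e_irr.
    have E2 : [set u; v] = pblock P u.
      apply/eqP; rewrite eqEcard P2c // cards2 uv' andbT.
      by apply/subsetP=> r; rewrite in_set2 => /orP[]/eqP->.
    by rewrite -E2 in_set2 negb_or wNu.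
  by have := ntm_eq mu uu vu wN; rewrite wu te // vw.
move=> x y z _ _ _ xy yz; apply/negPn/negP=> xz.
have zx : e z x.
  have nzx : z != x.
    by apply: contraTneq xy => zx; rewrite te -?zx ?yz //; apply: contraTneq yz => ->; rewrite e_irr.
  by rewrite te.
have : #|[set pblock P x; pblock P y; pblock P z]| <= 2.
  rewrite -P2E; apply: subset_leq_card; apply/subsetP=> Q.
  by rewrite !in_setU !in_set1 => /orP[/orP[]|]/eqP->; [apply: in_P2 xy yz zx | apply: in_P2 yz zx xy | apply: in_P2 zx xy yz].
rewrite setUC cardsU1 cards2 (nopair x y z) // !inE negb_or (nopair z x y) //.
by rewrite eq_sym (nopair y z x).
Qed.

End Bounds.

(** * From tournaments to relations, and the index equalities *)

Section Bridge.

Variable T : tournament.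

Lemma arc_tour : tour (@arc T).
Proof. by move=> x y /arc_total; case: (arc x y); case: (arc y x). Qed.

Lemma is_moduleE (M : {set T}) : is_module M = modin (@arc T) setT M.
Proof.
apply/idP/modinP => [H|[_ H]].
  split; rewrite ?subsetT // => x y v xM yM _ vM; apply/eqP.
  by move/forall_inP/(_ x xM)/forall_inP/(_ y yM)/forall_inP: H; apply; rewrite inE.
apply/forall_inP=> x xM; apply/forall_inP=> y yM; apply/forall_inP=> v.
by rewrite inE => vM; apply/eqP/H; rewrite ?inE.
Qed.

Lemma trivial_setE (M : {set T}) : trivial_set M = (#|M| <= 1) || (M == setT).
Proof.
rewrite /trivial_set orbA; congr (_ || _).
rewrite leq_eqVlt ltnS leqn0 cards_eq0 orbC; congr (_ || _).
by apply/existsP/cards1P => -[u]; [move/eqP; exists u | move->; exists u].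
Qed.

Lemma nontrivial_moduleE (M : {set T}) : nontrivial_module M = ntmod (@arc T) setT M.
Proof. by rewrite /nontrivial_module is_moduleE trivial_setE negb_or -ltnNge. Qed.

Lemma comoduleE (M : {set T}) : comodule M = comod (@arc T) M.
Proof. by rewrite /comodule !nontrivial_moduleE. Qed.

Lemma indecomposableP : reflect (indec (@arc T)) (indecomposable T).
Proof.
have E M : is_module M ==> trivial_set M = ~~ ntmod (@arc T) setT M.
  by rewrite -nontrivial_moduleE /nontrivial_module negb_and negbK implybE.
by apply: (iffP forallP) => H M; have := H M; rewrite E.
Qed.

End Bridge.

Lemma Inv_arcE (T : tournament) (X : {set T}) : @arc (Inv X) =2 switch (@arc T) (clique X).
Proof.
move=> x y; rewrite /= /Inv_arc /switch /clique.
have [->|xy] := eqVneq x y; first by rewrite !andbF addbF if_same.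
rewrite andbT; case: ifP => _; last by rewrite addbF.
by rewrite addbT (tourF (@arc_tour T) xy).
Qed.

Lemma rev_arcE (T : tournament) (B : {set T * T}) : B \subset arcs T ->
  @arc (reverse B) =2 switch (@arc T) (link (enum B)).
Proof.
move=> sB x y; rewrite /= /rev_arc /switch /link !mem_enum.
have [->|xy] := eqVneq x y.
  case: (boolP ((y, y) \in B)) => [/(subsetP sB)|]; last by rewrite addbF.
  by rewrite inE /= arc_irr.
case: ifP => _; last by rewrite addbF.
by rewrite addbT (tourF (@arc_tour T) xy).
Qed.

Lemma indices (T : tournament) : 4 < #|T| -> ~ transitive_even T ->
  [/\ decomp_sub_index T = comodular_index T,
      decomp_arc_index T = uphalf (comodular_index T) &
      exists P : {set {set T}}, [/\ trivIset P, forall Q, Q \in P -> comod (@arc T) Q &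
        #|P| = comodular_index T]].
Proof.
move=> T5 nte; have te := @arc_tour T.
have nte' : ~ trans_even (@arc T) setT.
  case=> tr; rewrite cardsT => ev; apply: nte; split=> // y x z.
  by apply: tr; rewrite inE.
have [m [[P [tP cP Pm]] [Y Ym indY] [l [sl ll indl]]]] := solved_exists te T5 nte'.
have mE : comodular_index T = m.
  apply/eqP; rewrite eqn_leq; apply/andP; split.
    apply/bigmax_leqP=> R /andP[tR /forall_inP cR]; rewrite -Ym.
    apply: card_hit tR _ => Q /cR; rewrite comoduleE => cQ.
    have [|x xQ [y /and3P[xY _ _]]] := comod_switch _ indY cQ; last by exists x.
    by move=> u v; rewrite /clique eq_sym andbCA.
  rewrite -Pm; apply: (leq_bigmax_cond (F := fun P : {set {set T}} => #|P|)).
  by rewrite tP; apply/forall_inP=> Q /cP; rewrite comoduleE.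
rewrite mE; split; last by exists P.
- have iY : indecomposable (Inv Y).
    by apply/indecomposableP; apply: indec_ext indY => x y; rewrite Inv_arcE.
  apply/eqP; rewrite eqn_leq -{1}Ym decomp_sub_index_le //=.
  have [X' iX' ->] := decomp_sub_index_attained iY; rewrite -Pm.
  have ind' : indec (switch (@arc T) (clique X')).
    by apply: indec_ext (indecomposableP _ iX') => x y; rewrite Inv_arcE.
  apply: card_hit tP _ => Q /cP cQ.
  have [|x xQ [y /and3P[xY _ _]]] := comod_switch _ ind' cQ; last by exists x.
  by move=> u v; rewrite /clique eq_sym andbCA.
(* Each listed pair is oriented as an arc of T; repeated pairs give the same arc, whence only an
   inequality for the size of [B]. *)
- pose B := [set p : T * T | arc p.1 p.2 & link l p.1 p.2].
  have sB : B \subset arcs T by apply/subsetP=> p; rewrite !inE => /andP[].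
  have BE : link (enum B) =2 link l.
    move=> x y; rewrite {1}/link !mem_enum !inE /= (link_sym l y x) -andb_orl.
    have [->|xy] := eqVneq x y.
      by rewrite arc_irr /=; apply/esym/negP; rewrite /link orbb => /ll; rewrite eqxx.
    by rewrite (te x y) // orNb.
  have iB : indecomposable (reverse B).
    apply/indecomposableP; apply: indec_ext indl => x y; rewrite rev_arcE // /switch.
    by rewrite BE.
  pose orient (p : T * T) := if arc p.1 p.2 then p else (p.2, p.1).
  have cB : #|B| <= uphalf m.
    rewrite -sl -(size_map orient); apply: leq_trans (card_size _).
    apply: subset_leq_card; apply/subsetP=> -[x y]; rewrite inE /= => /andP[axy].
    have xy : x != y by apply: contraTneq axy => ->; rewrite arc_irr.
    case/orP=> lxy; apply/mapP; [exists (x, y) | exists (y, x)] => //; rewrite /orient /= ?axy //.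
    by rewrite te 1?eq_sym // axy.
  apply/eqP; rewrite eqn_leq; apply/andP; split.
    exact: leq_trans (decomp_arc_index_le sB iB) cB.
  have [B' /andP[sB' iB'] ->] := decomp_arc_index_attained sB iB.
  have ind' : indec (switch (@arc T) (link (enum B'))).
    by apply: indec_ext (indecomposableP _ iB') => x y; rewrite rev_arcE.
  pose S := [set p.1 | p in B'] :|: [set p.2 | p in B'].
  have le : m <= #|S|.
    rewrite -Pm; apply: card_hit tP _ => Q /cP cQ.
    have [x xQ [y]] := comod_switch (@link_sym _ _) ind' cQ.
    rewrite /link !mem_enum => xyB; exists x => //; rewrite inE.
    by case/orP: xyB => H; apply/orP; [left | right]; apply/imsetP; [exists (x, y) | exists (y, x)].
  have : m <= #|B'|.*2.
    apply: leq_trans le _; rewrite -addnn; apply: leq_trans (leq_card_setU _ _).1 _.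
    by apply: leq_add; apply: leq_imset_card.
  by rewrite leq_uphalf_double.
Qed.

(** Half of [n + 2], rounded down, is [uphalf n.+1]. For order 6 this is 4, which [comods_order6]
    allows only in the transitive case. *)
Lemma decomp_sub_index_bound (T : tournament) : 4 < #|T| -> ~ transitive_even T ->
  decomp_sub_index T <= if #|T| == 6 then 3 else uphalf #|T|.+1.
Proof.
move=> T5 nte; have [-> _ [P [tP cP <-]]] := indices T5 nte; have te := @arc_tour T.
have b := comods_bound te tP cP.
have b' : #|P| <= uphalf #|T|.+1 by rewrite -[uphalf _]/(#|T|.+2./2) geq_half_double.
case: eqP => // T6; rewrite leqNgt; apply/negP=> P4; apply: nte; split; last by rewrite T6.
have PE : #|P| = 4.
  by apply/eqP; rewrite eqn_leq P4 andbT -leq_double; rewrite T6 in b.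
move=> y x z; apply: (comods_order6 te (@arc_irr T) tP cP T6 PE); rewrite ?inE //.
Qed.

(** * Extremal tournaments *)

Section Example.

Variable n : nat.

(* Consecutive pairs {2i-1, 2i} in increasing order, except that, for even n,
   the pairs {5, 6} and {1, 2} are exchanged so as to create a 3-cycle. *)
Definition swapped (i j : nat) := ~~ odd n && ((i == 1) && (j == 3) || (i == 3) && (j == 1)).

Definition pairs_arc : rel 'I_n := fun i j => (i < j) (+) swapped (uphalf i) (uphalf j).

Lemma pairs_irr : irreflexive pairs_arc.
Proof.
by move=> i; rewrite /pairs_arc ltnn /swapped; case: (uphalf i) => [|[|[|[|k]]]] /=; rewrite andbF.
Qed.

Lemma swappedC i j : swapped i j = swapped j i.
Proof. by rewrite /swapped [(j == 1) && _]andbC [(j == 3) && _]andbC orbC. Qed.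

Lemma pairs_total x y : x != y -> pairs_arc x y (+) pairs_arc y x.
Proof.
rewrite -val_eqE /= /pairs_arc swappedC => xy; rewrite addbACA addbb addbF.
by case: ltngtP xy.
Qed.

Definition pairs_tournament := Tournament pairs_irr pairs_total.

Definition pair_block (i : nat) : {set pairs_tournament} := [set j : 'I_n | uphalf j == i].

(** The blocks are [{0}], [{1, 2}], [{3, 4}] and so on, the last one a singleton for even [n]. For
    [n = 6] this last block [{5}] lies on the 3-cycle and is no co-module. *)
Definition pair_number := if n == 6 then 3 else n./2.+1.

Hypothesis n5 : 4 < n.

Lemma pairs_arcE (v x : 'I_n) : uphalf v != uphalf x ->
  pairs_arc v x = (uphalf v < uphalf x) (+) swapped (uphalf v) (uphalf x).
Proof. by move=> vx; rewrite /pairs_arc; congr (_ (+) _); move: vx; lia. Qed.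

Lemma pair_block_ntmod (M : {set pairs_tournament}) (x y z : 'I_n) :
  modin (@arc pairs_tournament) setT M -> x \in M -> y \in M -> x != y -> z \notin M ->
  ntmod (@arc pairs_tournament) setT M.
Proof.
move=> mM xM yM xy zM; apply: ntmI => //; first by apply/card_gt1P; exists x, y.
by apply: contraNneq zM => ->; rewrite inE.
Qed.

Lemma pair_block_comod i : i < pair_number -> comod (@arc pairs_tournament) (pair_block i).
Proof.
move=> iN; have [n0 n1 n2] : [/\ 0 < n, 1 < n & 2 < n] by split; apply: leq_trans n5.
have in_block (j : 'I_n) : (j \in pair_block i) = (uphalf j == i) by rewrite inE.
case: (posnP i) => [i0|ipos].
  rewrite /comod orbC (@pair_block_ntmod _ (Ordinal n1) (Ordinal n2) (Ordinal n0)) //.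
  - apply: modT => x y v; rewrite !inE i0 negbK => x0 y0 /eqP v0.
    by rewrite /= !pairs_arcE ?v0 1?eq_sym // !lt0n x0 y0 /swapped !andbF.
  - by rewrite inE in_block i0.
  - by rewrite inE in_block i0.
  - by rewrite inE in_block i0.
have mB : modin (@arc pairs_tournament) setT (pair_block i).
  apply: modT => x y v; rewrite !inE => /eqP xi /eqP yi vi.
  by rewrite /= !pairs_arcE ?xi ?yi.
case: (ltnP i.*2 n) => i2.
  have i1 : i.*2.-1 < n by apply: leq_ltn_trans (leq_pred _) i2.
  rewrite /comod (@pair_block_ntmod _ (Ordinal i1) (Ordinal i2) (Ordinal n0)) //.
  - by rewrite in_block /=; move: ipos; lia.
  - by rewrite in_block /=; lia.
  - by rewrite -val_eqE /=; move: ipos; lia.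
  - by rewrite in_block /=; move: ipos; lia.
(* Only the last block for even [n] remains; as [n] is not 6 the exchange does not touch it, and its
   vertex is a sink. *)
have [n6 ni] : n != 6 /\ n = i.*2.
  by move: iN i2; rewrite /pair_number; clear; case: eqP; lia.
have ev : ~~ odd n by rewrite ni odd_double.
have nn : n.-1 < n by rewrite ltn_predL.
rewrite /comod orbC (@pair_block_ntmod _ (Ordinal n0) (Ordinal n1) (Ordinal nn)) //.
- have i13 : (i != 1) && (i != 3) by move: n5 n6; rewrite ni; clear; lia.
  apply: modT => x y v; rewrite !inE negbK => xi yi /eqP vi.
  have le w : (i < uphalf (w : 'I_n)) = false by have := ltn_ord w; rewrite {2}ni; clear; lia.
  rewrite /= !pairs_arcE ?vi 1?eq_sym // !le /swapped.
  by case/andP: i13 => /negbTE-> /negbTE->.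
- by rewrite inE in_block /=; move: ipos; clear; lia.
- by rewrite inE in_block /=; move: n5; rewrite ni; clear; lia.
- by rewrite inE in_block /= negbK; move: n5; rewrite ni; clear; lia.
Qed.

Lemma pairs_not_transitive_even : ~ transitive_even pairs_tournament.
Proof.
case=> tr; rewrite card_ord => ev; have n6 : 5 < n by move: n5 ev; clear; case: n => [|[|[|[|[|[|]]]]]].
have [n1 n3] : 1 < n /\ 3 < n by split; apply: leq_trans n6.
(* The 3-cycle 1, 3, 5 takes one vertex from each of the blocks 1, 2, 3. *)
have := tr (Ordinal n3 : pairs_tournament) (Ordinal n1) (Ordinal n6).
by rewrite /= /pairs_arc /swapped ev /= => /(_ isT isT).
Qed.

Lemma pairs_comodular_index : pair_number <= comodular_index pairs_tournament.
Proof.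
have block_ne i : i < pair_number -> exists j : 'I_n, j \in pair_block i.
  move=> iN; have i1 : i.*2.-1 < n.
    by move: iN n5; rewrite /pair_number; clear; case: eqP; lia.
  by exists (Ordinal i1); rewrite inE /=; clear; lia.
pose P := [set pair_block i | i : 'I_pair_number].
have cP : #|P| = pair_number.
  rewrite card_imset ?card_ord // => i j E; have [k ki] := block_ne i (ltn_ord i).
  apply/val_inj => /=; have := ki; rewrite E !inE => /eqP <-.
  by move: ki; rewrite inE => /eqP.
rewrite -[X in X <= _]cP; apply: (leq_bigmax_cond (F := fun P : {set {set _}} => #|P|)).
apply/andP; split.
  apply/trivIsetP=> A B /imsetP[i _ ->] /imsetP[j _ ->] ij; apply/pred0P=> k /=.
  by rewrite !inE; apply: contraNF ij => /andP[/eqP-> /eqP->].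
by apply/forall_inP=> Q /imsetP[i _ ->]; rewrite comoduleE; apply: pair_block_comod.
Qed.

End Example.

Theorem corollary1p1 :
  (forall T : tournament, 5 <= #|T| -> ~ transitive_even T ->
     decomp_arc_index T = uphalf (decomp_sub_index T) /\
     uphalf (decomp_sub_index T) = uphalf (comodular_index T)) /\
  (forall n : nat, 5 <= n ->
     decomp_sub_index_of_order n (if n == 6 then 3 else uphalf n.+1)).
Proof.
split=> [T T5 nte|n n5]; first by have [-> -> _] := indices T5 nte.
split; last by move=> T Tn nte; rewrite -Tn; apply: decomp_sub_index_bound; rewrite ?Tn.
have cT : #|pairs_tournament n| = n by rewrite card_ord.
have nte := @pairs_not_transitive_even n n5.
exists (pairs_tournament n); split=> //; apply/eqP; rewrite eqn_leq.
have [E _ _] : [/\ decomp_sub_index (pairs_tournament n) = comodular_index (pairs_tournament n),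
    True & True].
  by have [-> _ _] := @indices (pairs_tournament n) (eq_ind_r (leq 5) n5 cT) nte.
have := decomp_sub_index_bound (eq_ind_r (leq 5) n5 cT) nte; rewrite cT => -> /=.
exact: leq_trans (pairs_comodular_index n5) (eq_leq (esym E)).
Qed.
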